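(* For any analytic self-map $\phi\colon\mathbb{D}\to\mathbb{D}$, the following assertions are equivalent: 1) there is $w\in H^2$, $w\not\equiv0$, such that $M_wC_\phi$ is a Hilbert–Schmidt operator on $H^2$; 2) there is $\tilde w\in H^\infty$, $\tilde w\not\equiv0$, such that $M_{\tilde w}C_\phi\in S_p(H^2)$ for all $p>0$; 3) there exist $p<\infty$ and $w_p\in H^\infty$, $w_p\not\equiv0$, such that $M_{w_p}C_\phi\in S_p(H^2)$; 4) $\displaystyle\int_{\mathbb{T}}\log\frac{1}{1-|\phi^\ast|}\,dm<\infty$.
   Context: $\mathbb{D}$ is the open unit disk, $\mathbb{T}=\partial\mathbb{D}$, $m$ the normalized Lebesgue measure on $\mathbb{T}$, $H^2$ the Hardy space, $H^\infty$ the bounded analytic functions on $\mathbb{D}$. $M_wC_\phi$ is the operator $f\mapsto w\,(f\circ\phi)$. $\phi^\ast$ is the radial limit function of $\phi$ (defined $m$-a.e.), the integrand in 4) being $+\infty$ where $|\phi^\ast|=1$. $S_p(H^2)$, $p>0$, is the Schatten class of compact operators $T$ on $H^2$ with $\sum_n s_n(T)^p<\infty$. *)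

(* Defs.v *)
From HB Require Import structures.
From mathcomp Require Import all_boot all_order all_algebra.
From mathcomp Require Import all_classical all_reals all_analysis.
From mathcomp Require Import complex.
Import Order.TTheory GRing.Theory Num.Theory.
Import numFieldNormedType.Exports.

Set Implicit Arguments.
Unset Strict Implicit.
Unset Printing Implicit Defensive.

Local Open Scope ring_scope.
Local Open Scope complex_scope.
Local Open Scope classical_set_scope.

HB.instance Definition _ (R : rcfType) := NormedModule.copy R[i] (R[i])^o.

Section HardyDefs.
Variable R : realType.

Definition modc (z : R[i]) : R := complex.Re `|z|.

Definition has_taylor (a : nat -> R[i]) (f : R[i] -> R[i]) : Prop :=
  forall z : R[i], modc z < 1 ->
    series (fun k => a k * z ^+ k) @ \oo --> f z.

Definition analytic_disk (f : R[i] -> R[i]) : Prop :=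
  exists a, has_taylor a f.

Definition analytic_selfmap (phi : R[i] -> R[i]) : Prop :=
  analytic_disk phi /\ forall z, modc z < 1 -> modc (phi z) < 1.

(* the Taylor coefficients of f at 0 (unique when f is analytic on D) *)
Definition taylor_coef (f : R[i] -> R[i]) : nat -> R[i] :=
  xget (fun _ => 0) [set a | has_taylor a f].

Definition h2_nsq (f : R[i] -> R[i]) : \bar R :=
  (\sum_(0 <= k <oo) ((modc (taylor_coef f k)) ^+ 2)%:E)%E.

Definition H2 (f : R[i] -> R[i]) : Prop :=
  analytic_disk f /\ (h2_nsq f < +oo)%E.

Definition Hinf (f : R[i] -> R[i]) : Prop :=
  analytic_disk f /\ exists M : R, forall z, modc z < 1 -> modc (f z) <= M.

Definition nonzero_disk (f : R[i] -> R[i]) : Prop :=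
  exists z, modc z < 1 /\ f z != 0.

Definition op := (R[i] -> R[i]) -> (R[i] -> R[i]).

Definition wcomp (w phi : R[i] -> R[i]) : op := fun f z => w z * f (phi z).

Definition maps_H2 (T : op) : Prop := forall f, H2 f -> H2 (T f).

Definition opnorm_sq (T : op) : \bar R :=
  ereal_sup [set h2_nsq (T f) | f in [set f | H2 f /\ (h2_nsq f <= 1)%E]].

Definition finite_rank_le (n : nat) (F : op) : Prop :=
  (forall f g (c : R[i]), H2 f -> H2 g ->
     F (fun z => f z + c * g z) = (fun z => F f z + c * F g z)) /\
  exists g : 'I_n -> (R[i] -> R[i]), (forall i, H2 (g i)) /\
    forall f, H2 f -> exists c : 'I_n -> R[i],
      F f = (fun z => \sum_(i < n) c i * g i z).

(* square of the (n+1)-th singular (= approximation) number of T on H^2: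
   s_{n+1}(T)^2 = inf { ||T - F||^2 : rank F <= n } *)
Definition sing_sq (T : op) (n : nat) : \bar R :=
  ereal_inf [set opnorm_sq (fun f z => T f z - F f z) |
             F in [set F | finite_rank_le n F]].

Definition schatten (p : R) (T : op) : Prop :=
  maps_H2 T /\
  (\sum_(0 <= n <oo) (sing_sq T n) `^ (p / 2) < +oo)%E.

Definition hilbert_schmidt (T : op) : Prop :=
  maps_H2 T /\ (\sum_(0 <= n <oo) h2_nsq (T (fun z => (z ^+ n)%R)) < +oo)%E.

Definition expi (t : R) : R[i] := (cos t) +i* (sin t).

Definition radial_limit (phi : R[i] -> R[i]) (zeta : R[i]) : R[i] :=
  lim (phi (r%:C * zeta) @[r --> 1^'-]).

(* log (1 / (1 - x)), = +oo when x >= 1 (i.e. where |phi^*| = 1) *)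
Definition log_inv_1m (x : R) : \bar R :=
  if x < 1 then (ln (1 - x)^-1)%:E else +oo%E.

(* int_T log (1/(1-|phi^*|)) dm < oo, with m normalized Lebesgue measure on T,
   parametrized by t in [0,1] via zeta = e^{2 pi i t} *)
Definition log_condition (phi : R[i] -> R[i]) : Prop :=
  (\int[lebesgue_measure]_(t in `[0%R, 1%R])
      log_inv_1m (modc (radial_limit phi (expi (2 * pi * t)))) < +oo)%E.

End HardyDefs.

(* Main.v *)
Require Import Defs.
From HB Require Import structures.
From mathcomp Require Import all_boot all_order all_algebra.
From mathcomp Require Import all_classical all_reals all_analysis.
From mathcomp Require Import measurable_realfun complex.
From mathcomp Require Import ring lra.
Import Order.TTheory GRing.Theory Num.Theory.
Import numFieldNormedType.Exports.
Local Open Scope ring_scope.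
Local Open Scope complex_scope.
Local Open Scope classical_set_scope.

Set Implicit Arguments.
Unset Strict Implicit.
Unset Printing Implicit Defensive.

Local Notation Re := complex.Re.
Local Notation Im := complex.Im.

(** Write [e_n] for the monomials and [T] for the weighted composition operator,
    so that [T e_n = w phi^n], whose norms decrease with [n].

    Necessity of the logarithmic condition. If [T] is Hilbert-Schmidt, then
    [||w phi^(4^i)||^2] is [O(4^-i)]. If [T] is in a Schatten class, approximate
    it by an operator [F] of rank [2^i]: an orthonormal basis of the polynomials
    of degree less than [4^i] adapted to the kernel of [F] has the same sum of
    [||T u||^2] as the monomials, which again gives geometric decay of
    [||w phi^(4^i)||^2]. Hence for some [s > 1] the integral of
    [|w|^2 G(|phi|^2)], where [G(x) = 1 + \sum_i s^i x^(4^i)], is bounded on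
    circles. By Jensen's inequality, in the form [|w(0)|^2 exp(\int u) <=
    \int |w|^2 exp u], the integral of [log G(|phi|^2)] is bounded too, and
    [log G(|phi|^2)] dominates a multiple of [log (1 / (1 - |phi|))] up to a
    constant; Fatou's lemma concludes.

    Sufficiency. If [h = log (1 / (1 - |phi^*|))] is integrable, so is some [g >= 0]
    with [g >= m h - X_m] for every [m]. The outer function [w] with
    [log |w| = - P[g]] then satisfies [|w| <= C_m (1 - |phi|)^m] for every [m], so
    truncating Taylor series approximates [T] by operators of rank [n] with an
    error smaller than any power of [1/n]. *)

(** The exponents [4^i] follow the scale of [1 - |phi|^2]: where it is of order [4^-i], the power
    [|phi|^(2 * 4^i)] is bounded below, so [G(|phi|^2)] is at least a constant times [s^i], a
    positive power of [1 / (1 - |phi|^2)]. Geometric decay of the norms is what leaves room for some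
    [s > 1]. A rank [2^i] operator can only disturb [2^i] of [4^i] orthonormal directions, a
    fraction [2^-i], so every exponent [p] is treated alike. Jensen's inequality in exponential form
    avoids [log |w|] and the zeros of [w]: it is the mean value inequality for [w] times a
    nonvanishing function. Only a zero at the origin is harmful, and it is divided out. One weight
    must serve every [p > 0]; a multiple [m h] in the exponent would only win the power [m], whence
    the superlinear majorant. Norms in [H2] are read on circles of radius less than 1 by Parseval's
    formula, so that [w] and [f] never need boundary values. Only the bounded function [phi] does,
    and Fatou's theorem is proved for it by means of Lebesgue points. Analyticity is handled as
    uniform polynomial approximation on smaller disks, which spares contour integrals. *)

Section ComplexModulus.
Variable R : realType.
Implicit Types (z w : R[i]) (x : R).

(** * Modulus and limits in [R[i]] *)

Lemma modcE z : modc z = Num.sqrt (Re z ^+ 2 + Im z ^+ 2).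
Proof. by rewrite /modc normc_def. Qed.

Lemma normC_modc z : `|z| = (modc z)%:C.
Proof. by rewrite /modc normc_def. Qed.

Lemma modc_ge0 z : 0 <= modc z.
Proof. by rewrite modcE sqrtr_ge0. Qed.

Lemma sqr_modc z : modc z ^+ 2 = Re z ^+ 2 + Im z ^+ 2.
Proof. by rewrite modcE sqr_sqrtr// addr_ge0// sqr_ge0. Qed.

Lemma modcM z w : modc (z * w) = modc z * modc w.
Proof. by apply: complexI; rewrite rmorphM -!normC_modc normrM. Qed.

Lemma modcX z n : modc (z ^+ n) = modc z ^+ n.
Proof. by apply: complexI; rewrite rmorphXn /= -!normC_modc normrX. Qed.

Lemma modcV z : modc z^-1 = (modc z)^-1.
Proof. by apply: complexI; rewrite fmorphV /= -!normC_modc normfV. Qed.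

Lemma modcD z w : modc (z + w) <= modc z + modc w.
Proof. by rewrite -lecR rmorphD /= -!normC_modc ler_normD. Qed.

Lemma modcN z : modc (- z) = modc z.
Proof. by apply: complexI; rewrite -!normC_modc normrN. Qed.

Lemma modcB z w : modc (z - w) <= modc z + modc w.
Proof. by rewrite (le_trans (modcD _ _))// modcN. Qed.

Lemma modc_distC z w : modc (z - w) = modc (w - z).
Proof. by rewrite -modcN opprB. Qed.

Lemma modc0 : modc (0 : R[i]) = 0.
Proof. by apply: complexI; rewrite -normC_modc normr0. Qed.

Lemma modc1 : modc (1 : R[i]) = 1.
Proof. by apply: complexI; rewrite -normC_modc normr1. Qed.

Lemma modc_real x : modc x%:C = `|x|.
Proof. by rewrite modcE /= expr0n addr0 sqrtr_sqr. Qed.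

Lemma modc_nat n : modc (n%:R : R[i]) = n%:R.
Proof. by apply: complexI; rewrite -normC_modc normr_nat rmorph_nat. Qed.

Lemma modcJ z : modc (conjc z) = modc z.
Proof. by rewrite !modcE; case: z => a b /=; rewrite sqrrN. Qed.

Lemma modc_eq0 z : (modc z == 0) = (z == 0).
Proof. by rewrite -(inj_eq (@complexI R)) -normC_modc normr_eq0. Qed.

Lemma modc_gt0 z : (0 < modc z) = (z != 0).
Proof. by rewrite lt_def modc_ge0 andbT modc_eq0. Qed.

Lemma Re_le_modc z : `|Re z| <= modc z.
Proof.
by rewrite modcE -sqrtr_sqr ler_sqrt ?addr_ge0 ?sqr_ge0// lerDl sqr_ge0.
Qed.

Lemma Im_le_modc z : `|Im z| <= modc z.
Proof.
by rewrite modcE -sqrtr_sqr ler_sqrt ?addr_ge0 ?sqr_ge0// lerDr sqr_ge0.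
Qed.

Lemma modc_le_ReIm z : modc z <= `|Re z| + `|Im z|.
Proof.
rewrite -(@ler_pXn2r _ 2) ?nnegrE ?modc_ge0 ?addr_ge0//.
rewrite sqr_modc -(real_normK (num_real (Re z))) -(real_normK (num_real (Im z))).
have := mulr_ge0 (normr_ge0 (Re z)) (normr_ge0 (Im z)); nra.
Qed.

Lemma modc_sum (I : Type) (s : seq I) (P : pred I) (F : I -> R[i]) :
  modc (\sum_(i <- s | P i) F i) <= \sum_(i <- s | P i) modc (F i).
Proof.
elim/big_ind2 : _ => [|a b c d ab cd|//]; first by rewrite modc0.
by rewrite (le_trans (modcD _ _))// lerD.
Qed.

Lemma modc_triangle z w : modc z <= modc w + modc (z - w).
Proof. by rewrite -[in leLHS](subrK w z) addrC; exact: modcD. Qed.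

Lemma mulcJ z : z * conjc z = (modc z ^+ 2)%:C.
Proof.
by rewrite sqr_modc; case: z => a b; simpc; congr (_ +i* _) => /=; ring.
Qed.

Lemma ReD z w : Re (z + w) = Re z + Re w.
Proof. by case: z w => a b [c d]. Qed.
Lemma ImD z w : Im (z + w) = Im z + Im w.
Proof. by case: z w => a b [c d]. Qed.
Lemma ReN z : Re (- z) = - Re z.
Proof. by case: z. Qed.
Lemma ImN z : Im (- z) = - Im z.
Proof. by case: z. Qed.
Lemma ReM z w : Re (z * w) = Re z * Re w - Im z * Im w.
Proof. by case: z w => a b [c d]. Qed.
Lemma ImM z w : Im (z * w) = Re z * Im w + Im z * Re w.
Proof. by case: z w => a b [c d]. Qed.
Lemma ReMr x z : Re (x%:C * z) = x * Re z.
Proof. by rewrite ReM /= mul0r subr0. Qed.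
Lemma ImMr x z : Im (x%:C * z) = x * Im z.
Proof. by rewrite ImM /= mul0r addr0. Qed.

Lemma eqc z w : Re z = Re w -> Im z = Im w -> z = w.
Proof. by case: z w => a b [c d] /= -> ->. Qed.

(* The norm of R[i] takes values in R[i], so the library's epsilons are
   complex numbers. *)
Lemma cvgcP (T : Type) (F : set_system T) {FF : Filter F} (f : T -> R[i])
    (l : R[i]) :
  f @ F --> l <-> forall e : R, 0 < e -> \forall x \near F, modc (f x - l) < e.
Proof.
split=> [/cvgrPdist_lt fl e e0|fl].
  have /fl : (0 : R[i]) < e%:C by rewrite ltcR.
  by apply: filterS => x; rewrite normC_modc ltcR modc_distC.
apply/cvgrPdist_lt => e; rewrite ltcE /= => /andP[/eqP ei e0].
have -> : e = (Re e)%:C by apply: eqc.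
move: (fl _ e0); apply: filterS => x.
by rewrite normC_modc ltcR modc_distC.
Qed.

Lemma cvgc_lim (T : Type) (F : set_system T) {FF : ProperFilter F}
  (f : T -> R[i]) (l : R[i]) : f @ F --> l -> lim (f @ F) = l.
Proof. by move=> fl; apply/cvg_lim. Qed.

Lemma cvgc_ReIm (T : Type) (F : set_system T) {FF : Filter F} (f : T -> R[i])
    (l : R[i]) :
  Re (f x) @[x --> F] --> Re l -> Im (f x) @[x --> F] --> Im l ->
  f @ F --> l.
Proof.
move=> /cvgrPdist_lt fr /cvgrPdist_lt fi; apply/cvgcP => e e0.
have e2 : 0 < e / 2 by rewrite divr_gt0.
near=> x.
rewrite (le_lt_trans (modc_le_ReIm _))// ReD ImD ReN ImN.
rewrite [ltRHS](splitr e) ltrD// distrC.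
- by near: x; exact: fr.
- by near: x; exact: fi.
Unshelve. all: by end_near. Qed.

Lemma cvg_Re (T : Type) (F : set_system T) {FF : Filter F} (f : T -> R[i])
    (l : R[i]) : f @ F --> l -> Re (f x) @[x --> F] --> Re l.
Proof.
move=> /cvgcP fl; apply/cvgrPdist_lt => e /fl; apply: filterS => x.
by apply: le_lt_trans; rewrite distrC -ReN -ReD; exact: Re_le_modc.
Qed.

Lemma cvg_Im (T : Type) (F : set_system T) {FF : Filter F} (f : T -> R[i])
    (l : R[i]) : f @ F --> l -> Im (f x) @[x --> F] --> Im l.
Proof.
move=> /cvgcP fl; apply/cvgrPdist_lt => e /fl; apply: filterS => x.
by apply: le_lt_trans; rewrite distrC -ImN -ImD; exact: Im_le_modc.
Qed.

Lemma cvg_modc (T : Type) (F : set_system T) {FF : Filter F} (f : T -> R[i])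
    (l : R[i]) : f @ F --> l -> modc (f x) @[x --> F] --> modc l.
Proof.
move=> /cvgcP fl; apply/cvgrPdist_lt => e /fl; apply: filterS => x.
apply: le_lt_trans; have := modc_triangle l (f x); rewrite modc_distC.
by have := modc_triangle (f x) l; rewrite ler_norml => h1 h2; apply/andP; split; lra.
Qed.

End ComplexModulus.

(** * Real integrals over the parameter interval [[0, 1]] of the circle *)

Section CircleIntegral.
Variable R : realType.
Implicit Types f g : R -> R.
Local Notation mu := (@lebesgue_measure R).
Local Notation D := (`[0%R, 1%R]%classic : set R).

Definition mfun f := measurable_fun [set: R] f.
Definition itg f := mu.-integrable D (EFin \o f).
Definition II f : R := \int[mu]_(t in D) f t.

Lemma muD : mu D = 1%E.
Proof. by rewrite lebesgue_measure_itv /= lte_fin ltr01 oppr0 adde0. Qed.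

Lemma mD : @measurable _ (measurableTypeR R) D. Proof. exact: measurable_itv. Qed.
Hint Resolve mD : core.

Lemma itg_bd f (B : R) : mfun f -> (forall t, `|f t| <= B) -> itg f.
Proof.
move=> mf fB.
apply: (@measurable_bounded_integrable _ (measurableTypeR R) _ mu) => //.
- by rewrite [X in (X < _)%E](_ : _ = 1%E) ?ltry//; exact: muD.
- exact: measurable_funTS.
exists B; split => //; first exact: num_real.
by move=> M BM t _ /=; rewrite (le_trans (fB t))// ltW.
Qed.

Lemma itg_cst (c : R) : itg (fun=> c).
Proof. by apply: (@itg_bd _ `|c|) => //; exact: measurable_cst. Qed.

Lemma itgD f g : itg f -> itg g -> itg (fun t => f t + g t).
Proof.
by move=> fi gi; have := integrableD mD fi gi; apply: eq_integrable => // t _.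
Qed.

Lemma itgZ (c : R) f : itg f -> itg (fun t => c * f t).
Proof.
by move=> fi; have := integrableZl mD c fi; apply: eq_integrable => // t _.
Qed.

Lemma itgN f : itg f -> itg (fun t => - f t).
Proof.
by move=> fi; have := itgZ (-1) fi; apply: eq_integrable => // t _ /=;
  rewrite mulN1r.
Qed.

Lemma itgB f g : itg f -> itg g -> itg (fun t => f t - g t).
Proof. by move=> fi gi; apply: itgD => //; exact: itgN. Qed.

Lemma itg_norm f : itg f -> itg (fun t => `|f t|).
Proof. by move=> fi; exact: (integrable_norm fi). Qed.

Lemma itgM_bd f g (B : R) : mfun f -> (forall t, `|f t| <= B) -> itg g ->
  itg (fun t => f t * g t).
Proof.
move=> mf fB gi; have /= := integrableMr (mu := mu) mD (h := f) (g := EFin \o g).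
move=> H; have := H _ _ gi; apply.
  exact: measurable_funTS.
exists B; split => //; first exact: num_real.
by move=> M BM t _ /=; rewrite (le_trans (fB t))// ltW.
Qed.

Lemma itg_le f g : mfun f -> itg g -> (forall t, `|f t| <= g t) -> itg f.
Proof.
move=> mf gi fg; apply: (le_integrable mD _ _ gi).
  by apply/measurable_EFinP; exact: measurable_funTS.
by move=> t _ /=; rewrite lee_fin (le_trans (fg t)) ?ler_norm.
Qed.

Lemma itg_sum (I : Type) (s : seq I) (F : I -> R -> R) :
  (forall i, itg (F i)) -> itg (fun t => \sum_(i <- s) F i t).
Proof.
move=> Fi; elim: s => [|i s IH].
  by apply: eq_integrable (itg_cst 0) => // t _ /=; rewrite big_nil.
by apply: eq_integrable (itgD (Fi i) IH) => // t _ /=; rewrite big_cons.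
Qed.

Lemma IID f g : itg f -> itg g -> II (fun t => f t + g t) = II f + II g.
Proof. exact: RintegralD. Qed.

Lemma IIZ (c : R) f : itg f -> II (fun t => c * f t) = c * II f.
Proof. exact: RintegralZl. Qed.

Lemma IIB f g : itg f -> itg g -> II (fun t => f t - g t) = II f - II g.
Proof. exact: RintegralB. Qed.

Lemma II_cst (c : R) : II (fun=> c) = c.
Proof. rewrite /II (@Rintegral_cst _ (measurableTypeR R) _ mu _ mD).
by rewrite -[RHS]mulr1; congr (_ * _); rewrite -[RHS]/(fine 1%E); congr fine; exact: muD. Qed.

Lemma eq_II f g : (forall t, f t = g t) -> II f = II g.
Proof. by move=> fg; apply: eq_Rintegral => t _. Qed.

Lemma II_sum (I : Type) (s : seq I) (F : I -> R -> R) :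
  (forall i, itg (F i)) ->
  II (fun t => \sum_(i <- s) F i t) = \sum_(i <- s) II (F i).
Proof.
move=> Fi; elim: s => [|i s IH].
  by rewrite big_nil -[RHS]II_cst; apply: eq_II => t; rewrite big_nil.
by rewrite big_cons -IH -IID//; [apply: eq_II => t; rewrite big_cons|
  exact: itg_sum].
Qed.

Lemma le_II f g : itg f -> itg g -> (forall t, f t <= g t) -> II f <= II g.
Proof. by move=> fi gi fg; apply: le_Rintegral => // t _. Qed.

Lemma II_ge0 f : (forall t, 0 <= f t) -> 0 <= II f.
Proof. by move=> f0; apply: Rintegral_ge0. Qed.

Lemma norm_II f : itg f -> `|II f| <= II (fun t => `|f t|).
Proof. by move=> fi; apply: le_normr_Rintegral. Qed.

Lemma EFin_II f : itg f -> (II f)%:E = (\int[mu]_(t in D) (f t)%:E)%E.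
Proof. by move=> fi; rewrite /II /Rintegral fineK//; exact: integrable_fin_num. Qed.

Lemma ae_imp (P Q : R -> Prop) : (forall x, P x -> Q x) ->
  {ae mu, forall x, P x} -> {ae mu, forall x, Q x}.
Proof.
move=> PQ [N [mN N0 PN]]; exists N; split => // x nQ; apply: PN.
by move=> Px; apply: nQ; exact: PQ.
Qed.

Lemma ae_and (P Q : R -> Prop) : {ae mu, forall x, P x} ->
  {ae mu, forall x, Q x} -> {ae mu, forall x, P x /\ Q x}.
Proof.
move=> [N [mN N0 PN]] [M [mM M0 QM]]; exists (N `|` M); split => //.
- exact: measurableU.
- by rewrite null_set_setU.
- move=> x /not_andP[nP|nQ]; [left; exact: PN|right; exact: QM].
Qed.

(** Almost everywhere [g - f] equals its positive part, whose integral is nonnegative. *)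
Lemma II_ae_le f g : itg f -> itg g ->
  {ae mu, forall t, D t -> f t <= g t} -> II f <= II g.
Proof.
move=> fi gi fg; rewrite -subr_ge0 -IIB// -lee_fin EFin_II; last exact: itgB.
have mh : @measurable_fun _ _ (measurableTypeR R) _ D (EFin \o (fun t => g t - f t)).
  exact: (measurable_int mu (itgB gi fi)).
rewrite (@ae_eq_integral _ (measurableTypeR R) _ mu D (fun t => (Num.max 0 (g t - f t))%:E))//.
- by apply: integral_ge0 => t _; rewrite lee_fin le_max lexx.
- move/measurable_EFinP : mh => mh.
  by apply/measurable_EFinP; apply: measurable_maxr.
- by apply: ae_imp fg => t h Dt; rewrite max_r// subr_ge0; exact: h.
Qed.

Lemma II_dct (f_ : nat -> R -> R) f g :
  (forall n, mfun (f_ n)) -> mfun f -> itg g ->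
  (forall n t, `|f_ n t| <= g t) ->
  {ae mu, forall t, D t -> (fun n => f_ n t) @ \oo --> f t} ->
  itg f /\ (fun n => II (f_ n)) @ \oo --> II f.
Proof.
move=> mf_ mf gi fg ff.
have [||||fi _ H] := @dominated_convergence _ (measurableTypeR R) _ mu D mD
  (fun n => EFin \o f_ n) (EFin \o f) (EFin \o g) _ _ _ gi.
- by move=> n; apply/measurable_EFinP; exact: (measurable_funTS (mf_ n)).
- by apply/measurable_EFinP; exact: measurable_funTS.
- by apply: ae_imp ff => t h Dt; apply: cvg_EFin; [exact: nearW|exact: h].
- by apply: aeW => t n _ /=; rewrite lee_fin.
split => //.
have fi_ n : itg (f_ n) by apply: itg_le gi _.
rewrite /II /Rintegral; apply: fine_cvg; rewrite fineK; first exact: H.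
exact: (integrable_fin_num mD fi).
Qed.

End CircleIntegral.

(** * Complex integrals on the circle, orthogonality of the exponentials, Parseval's formula *)

Section CircleIntegralC.
Variable R : realType.
Implicit Types f g : R -> R[i].
Local Notation mu := (@lebesgue_measure R).
Local Notation D := (`[0%R, 1%R]%classic : set R).

Definition ee (t : R) : R[i] := expi (2 * pi * t).

Lemma expiD (s t : R) : expi (s + t) = expi s * expi t.
Proof. by rewrite /expi cosD sinD; apply: eqc; rewrite ?ReM ?ImM //=; ring. Qed.

Lemma expi0 : expi (0 : R) = 1.
Proof. by rewrite /expi cos0 sin0. Qed.

Lemma expiX (t : R) n : expi t ^+ n = expi (n%:R * t).
Proof.
elim: n => [|n IH]; first by rewrite expr0 mul0r expi0.
by rewrite exprS IH -expiD -[in RHS]natr1 mulrDl mul1r addrC.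
Qed.

Lemma modc_expi (t : R) : modc (expi t) = 1.
Proof. by rewrite modcE /= cos2Dsin2 sqrtr1. Qed.

Lemma conj_expi (t : R) : conjc (expi t) = expi (- t).
Proof. by rewrite /expi cosN sinN. Qed.

Lemma eeX t n : ee t ^+ n = expi (n%:R * (2 * pi) * t).
Proof. by rewrite /ee expiX; congr expi; ring. Qed.

Lemma modc_ee t : modc (ee t) = 1.
Proof. exact: modc_expi. Qed.

Lemma eeJ t : ee t * conjc (ee t) = 1.
Proof. by rewrite mulcJ modc_ee expr1n. Qed.

Lemma ee1 : ee 1 = 1.
Proof. by rewrite /ee /expi mulr1 mulrC mulr_natr cos2pi sin2pi. Qed.

Definition cmf f := mfun (fun t => Re (f t)) /\ mfun (fun t => Im (f t)).
Definition citg f := itg (fun t => Re (f t)) /\ itg (fun t => Im (f t)).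
Definition cI f : R[i] := II (fun t => Re (f t)) +i* II (fun t => Im (f t)).

Lemma cmf_cst (c : R[i]) : cmf (fun=> c).
Proof. by split; exact: measurable_cst. Qed.

Lemma cmf_real (f : R -> R) : mfun f -> cmf (fun t => (f t)%:C).
Proof. by move=> mf; split => //; exact: measurable_cst. Qed.

Lemma cmfD f g : cmf f -> cmf g -> cmf (fun t => f t + g t).
Proof.
move=> [f1 f2] [g1 g2]; split.
- rewrite (_ : (fun t => _) = (fun t => Re (f t) + Re (g t))).
    exact: measurable_funD.
  by apply/funext => t; rewrite ReD.
- rewrite (_ : (fun t => _) = (fun t => Im (f t) + Im (g t))).
    exact: measurable_funD.
  by apply/funext => t; rewrite ImD.
Qed.

Lemma cmfM f g : cmf f -> cmf g -> cmf (fun t => f t * g t).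
Proof.
move=> [f1 f2] [g1 g2]; split.
- rewrite (_ : (fun t => _) =
    (fun t => Re (f t) * Re (g t) - Im (f t) * Im (g t))).
    by apply: measurable_funB; exact: measurable_funM.
  by apply/funext => t; rewrite ReM.
- rewrite (_ : (fun t => _) =
    (fun t => Re (f t) * Im (g t) + Im (f t) * Re (g t))).
    by apply: measurable_funD; exact: measurable_funM.
  by apply/funext => t; rewrite ImM.
Qed.

Lemma cmfX f n : cmf f -> cmf (fun t => f t ^+ n).
Proof.
move=> mf; elim: n => [|n IH]; first exact: cmf_cst.
by rewrite (_ : (fun t => _) = (fun t => f t * f t ^+ n)); [exact: cmfM|
  apply/funext => t; rewrite exprS].
Qed.

Lemma cmfJ f : cmf f -> cmf (fun t => conjc (f t)).
Proof.
move=> [f1 f2]; split.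
- by rewrite (_ : (fun t => _) = (fun t => Re (f t)))//; apply/funext => t; case: (f t).
- rewrite (_ : (fun t => _) = (fun t => - Im (f t))).
    exact: measurableT_comp.
  by apply/funext => t; case: (f t).
Qed.

Lemma cmf_sum (I : Type) (s : seq I) (F : I -> R -> R[i]) :
  (forall i, cmf (F i)) -> cmf (fun t => \sum_(i <- s) F i t).
Proof.
move=> mF; elim: s => [|i s IH].
  rewrite (_ : (fun t => _) = fun=> 0); first exact: cmf_cst.
  by apply/funext => t; rewrite big_nil.
rewrite (_ : (fun t => _) = (fun t => F i t + \sum_(i <- s) F i t)).
  exact: cmfD.
by apply/funext => t; rewrite big_cons.
Qed.

Lemma mfun_sqr_modc f : cmf f -> mfun (fun t => modc (f t) ^+ 2).
Proof.
move=> [f1 f2]; rewrite (_ : (fun t => _) = (fun t => Re (f t) ^+ 2 + Im (f t) ^+ 2)).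
  by apply: measurable_funD; exact: measurable_funX.
by apply/funext => t; rewrite sqr_modc.
Qed.

Lemma mfun_modc f : cmf f -> mfun (fun t => modc (f t)).
Proof.
move=> /mfun_sqr_modc mf.
rewrite (_ : (fun t => _) = Num.sqrt \o (fun t => modc (f t) ^+ 2)); last first.
  by apply/funext => t /=; rewrite sqrtr_sqr ger0_norm// modc_ge0.
apply: measurableT_comp mf; apply: continuous_measurable_fun.
exact: sqrt_continuous.
Qed.

Lemma cmf_cvg (F : nat -> R -> R[i]) f : (forall n, cmf (F n)) ->
  (forall t, F n t @[n --> \oo] --> f t) -> cmf f.
Proof.
move=> mF Ff; split.
- by apply: (@measurable_fun_cvg _ _ _ _ (fun n t => Re (F n t))) => [n|t _];
    [exact: (mF n).1|exact: cvg_Re].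
- by apply: (@measurable_fun_cvg _ _ _ _ (fun n t => Im (F n t))) => [n|t _];
    [exact: (mF n).2|exact: cvg_Im].
Qed.

Lemma continuous_scale (c : R) (f : R -> R) : continuous f ->
  continuous (fun t => f (c * t)).
Proof.
move=> cf t; apply: (@continuous_comp _ _ _ ( *%R c) f).
- exact: mulrl_continuous.
- exact: cf.
Qed.

Lemma cmf_expi (c : R) : cmf (fun t => expi (c * t)).
Proof.
split => /=; apply: continuous_measurable_fun; apply: continuous_scale.
- exact: continuous_cos.
- exact: continuous_sin.
Qed.

Lemma cmf_ee : cmf ee.
Proof. exact: cmf_expi. Qed.

Lemma citg_bd f (B : R) : cmf f -> (forall t, modc (f t) <= B) -> citg f.
Proof.
move=> [f1 f2] fB; split; apply: (@itg_bd _ _ B) => // t.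
- exact: le_trans (Re_le_modc _) (fB t).
- exact: le_trans (Im_le_modc _) (fB t).
Qed.

Lemma eq_citg f g : (forall t, f t = g t) -> citg f -> citg g.
Proof. by move=> fg; rewrite (_ : f = g)//; apply/funext. Qed.

Lemma citg_cst (c : R[i]) : citg (fun=> c).
Proof. by split; exact: itg_cst. Qed.

Lemma citgD f g : citg f -> citg g -> citg (fun t => f t + g t).
Proof.
move=> [f1 f2] [g1 g2]; split.
- by have := itgD f1 g1; congr itg; apply/funext => t; rewrite ReD.
- by have := itgD f2 g2; congr itg; apply/funext => t; rewrite ImD.
Qed.

Lemma citgZ (c : R[i]) f : citg f -> citg (fun t => c * f t).
Proof.
move=> [f1 f2]; split.
- by have := itgB (itgZ (Re c) f1) (itgZ (Im c) f2); congr itg; apply/funext => t; rewrite ReM.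
- by have := itgD (itgZ (Re c) f2) (itgZ (Im c) f1); congr itg; apply/funext => t; rewrite ImM.
Qed.

Lemma citg_sum (I : Type) (s : seq I) (F : I -> R -> R[i]) :
  (forall i, citg (F i)) -> citg (fun t => \sum_(i <- s) F i t).
Proof.
move=> mF; elim: s => [|i s IH].
  by apply: eq_citg (citg_cst 0) => t; rewrite big_nil.
by apply: eq_citg (citgD (mF i) IH) => t; rewrite big_cons.
Qed.

Lemma eq_cI f g : (forall t, f t = g t) -> cI f = cI g.
Proof. by move=> fg; rewrite (_ : f = g)//; apply/funext. Qed.

Lemma cI_cst (c : R[i]) : cI (fun=> c) = c.
Proof. by rewrite /cI !II_cst; case: c. Qed.

Lemma cI_real (f : R -> R) : cI (fun t => (f t)%:C) = (II f)%:C.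
Proof. by rewrite /cI /= II_cst. Qed.

Lemma cID f g : citg f -> citg g -> cI (fun t => f t + g t) = cI f + cI g.
Proof.
move=> [f1 f2] [g1 g2]; apply: eqc; rewrite ?ReD ?ImD /= -IID//; apply: eq_II => t.
- by rewrite ReD.
- by rewrite ImD.
Qed.

Lemma cIZ (c : R[i]) f : citg f -> cI (fun t => c * f t) = c * cI f.
Proof.
move=> [f1 f2]; apply: eqc; rewrite ?ReM ?ImM /= -!IIZ//.
- by rewrite -IIB; [apply: eq_II => t; rewrite ReM|exact: itgZ|exact: itgZ].
- by rewrite -IID; [apply: eq_II => t; rewrite ImM|exact: itgZ|exact: itgZ].
Qed.

Lemma cIB f g : citg f -> citg g -> cI (fun t => f t - g t) = cI f - cI g.
Proof.
move=> fi gi; rewrite -mulN1r -cIZ// -cID//; last exact: citgZ.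
by apply: eq_cI => t; rewrite mulN1r.
Qed.

Lemma cI_sum (I : Type) (s : seq I) (F : I -> R -> R[i]) :
  (forall i, citg (F i)) ->
  cI (fun t => \sum_(i <- s) F i t) = \sum_(i <- s) cI (F i).
Proof.
move=> mF; elim: s => [|i s IH].
  by rewrite big_nil -[RHS]cI_cst; apply: eq_cI => t; rewrite big_nil.
rewrite big_cons -IH -cID//; last exact: citg_sum.
by apply: eq_cI => t; rewrite big_cons.
Qed.

Lemma cIJ f : citg f -> cI (fun t => conjc (f t)) = conjc (cI f).
Proof.
move=> [f1 f2]; rewrite /cI; congr (_ +i* _).
- by apply: eq_II => t; case: (f t).
- by rewrite -mulN1r -IIZ//; apply: eq_II => t; rewrite mulN1r; case: (f t).
Qed.

Lemma Re_cI f : Re (cI f) = II (fun t => Re (f t)). Proof. by []. Qed.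

(* Rotate [f] so that its integral becomes a nonnegative real. *)
Lemma modc_cI_le f (g : R -> R) : citg f -> itg g ->
  (forall t, modc (f t) <= g t) -> modc (cI f) <= II g.
Proof.
move=> fi gi fg.
have [->|I0] := eqVneq (cI f) 0.
  by rewrite modc0 II_ge0// => t; rewrite (le_trans (modc_ge0 _) (fg t)).
pose c := conjc (cI f) / (modc (cI f))%:C.
have m0 : (modc (cI f))%:C != 0 by rewrite -modc_gt0 modc_real normr_gt0 modc_eq0.
have c1 : modc c = 1.
  rewrite modcM modcV modcJ modc_real ger0_norm ?modc_ge0// divff//.
  by rewrite modc_eq0.
have cE : c * cI f = (modc (cI f))%:C.
  by rewrite /c mulrAC (mulrC (conjc _)) mulcJ rmorphXn expr2 -mulrA divff// mulr1.
have -> : modc (cI f) = Re (c * cI f) by rewrite cE.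
rewrite -cIZ// Re_cI; apply: le_II => //; first exact: (citgZ c fi).1.
move=> t; apply: le_trans (fg t).
by rewrite (le_trans (ler_norm _))// (le_trans (Re_le_modc _))// modcM c1 mul1r.
Qed.

Lemma modc_cI_le_cst f (B : R) : citg f -> (forall t, modc (f t) <= B) ->
  modc (cI f) <= B.
Proof.
by move=> fi fB; rewrite -[leRHS]II_cst; apply: modc_cI_le => //; exact: itg_cst.
Qed.

Lemma is_derive_chain (f g : R -> R) (x df dg : R) : is_derive x 1 g dg ->
  is_derive (g x) 1 f df -> is_derive x 1 (f \o g) (df * dg).
Proof.
move=> [g1 g2] [f1 f2]; apply: DeriveDef; last first.
  by rewrite -derive1E derive1_comp// !derive1E f2 g2.
by apply/derivable1_diffP; apply: differentiable_comp; exact/derivable1_diffP.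
Qed.

Lemma II_FTC (f F : R -> R) : continuous f ->
  (forall x : R, is_derive x 1 F (f x)) -> II f = F 1 - F 0.
Proof.
move=> cf dF; rewrite /II /Rintegral (@continuous_FTC2 R f F)//.
- exact: continuous_subspaceT.
- have cF : continuous F.
    by move=> x; apply: differentiable_continuous; apply/derivable1_diffP;
      exact: (ex_derive (is_derive := dF x)).
  split.
  + by move=> x _; exact: (ex_derive (is_derive := dF x)).
  + exact/cvg_at_right_filter/cF.
  + exact/cvg_at_left_filter/cF.
- by move=> x _; rewrite derive1E; exact: (derive_val (is_derive := dF x)).
Qed.

(** For [n > 0] the antiderivatives of [cos (c t)] and [sin (c t)], with [c = 2 pi n], take equal
    values at 0 and 1. *)
Lemma cI_eeX n : cI (fun t => ee t ^+ n) = (n == 0%N)%:R.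
Proof.
case: n => [|n].
  by rewrite -[RHS]cI_cst; apply: eq_cI => t; rewrite expr0.
pose c : R := n.+1%:R * (2 * pi).
have c0 : c != 0 by rewrite mulf_neq0 ?mulf_neq0 ?gt_eqF ?pi_gt0.
have [cc cs] : cos c = 1 /\ sin c = 0.
  have : expi c = 1 by rewrite -[c]mulr1 -eeX ee1 expr1n.
  by case.
rewrite /cI; under eq_fun do rewrite eeX -/c /=.
under [in X in _ +i* X]eq_fun do rewrite eeX -/c /=.
have dc (x : R) : is_derive x (1 : R) ( *%R c) c.
  by have := is_deriveZ c (is_derive_id x (1 : R)); rewrite /GRing.scale /= mulr1.
have -> : II (fun t => cos (c * t)) = c^-1 * sin (c * 1) - c^-1 * sin (c * 0).
  apply: (@II_FTC _ (fun t => c^-1 * sin (c * t))).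
    by apply: continuous_scale; exact: continuous_cos.
  move=> x; have := is_deriveZ c^-1 (is_derive_chain (dc x) (is_derive_sin (c * x))).
  by move=> h; apply: is_derive_eq h _; rewrite /GRing.scale /=; field.
have -> : II (fun t => sin (c * t)) = - c^-1 * cos (c * 1) - - c^-1 * cos (c * 0).
  apply: (@II_FTC _ (fun t => - c^-1 * cos (c * t))).
    by apply: continuous_scale; exact: continuous_sin.
  move=> x; have := is_deriveZ (- c^-1) (is_derive_chain (dc x) (is_derive_cos (c * x))).
  by move=> h; apply: is_derive_eq h _; rewrite /GRing.scale /=; field.
by rewrite !mulr1 !mulr0 cc cs cos0 sin0 !mulr0 !subrr.
Qed.

Lemma citg_eeX (a : R[i]) m n : citg (fun t => a * (ee t ^+ m * conjc (ee t ^+ n))).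
Proof.
apply: (@citg_bd _ (modc a)).
  apply: cmfM; first exact: cmf_cst.
  by apply: cmfM; [|apply: cmfJ]; apply: cmfX; exact: cmf_ee.
by move=> t; rewrite !modcM modcJ !modcX modc_ee !expr1n !mulr1.
Qed.

Lemma cI_eeXJ m n : cI (fun t => ee t ^+ m * conjc (ee t ^+ n)) = (m == n)%:R.
Proof.
wlog mn : m n / (n <= m)%N => [H|].
  have [/H//|/ltnW /H nm] := leqP n m.
  rewrite eq_sym -[RHS]conjc_nat -nm -cIJ.
    by apply: eq_cI => t; rewrite rmorphM /= conjcK mulrC.
  by apply: eq_citg (citg_eeX 1 n m) => t; rewrite mul1r.
rewrite -(subnK mn); set k := (m - n)%N.
rewrite -[in RHS](add0n n) eqn_add2r -cI_eeX; apply: eq_cI => t.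
by rewrite exprD -mulrA rmorphXn /= -exprMn eeJ expr1n mulr1.
Qed.

Lemma parseval n (a : nat -> R[i]) :
  II (fun t => modc (\sum_(k < n) a k * ee t ^+ k) ^+ 2) =
  \sum_(k < n) modc (a k) ^+ 2.
Proof.
apply: complexI; rewrite -cI_real rmorph_sum /=.
have -> : cI (fun t => (modc (\sum_(k < n) a k * ee t ^+ k) ^+ 2)%:C) =
    cI (fun t => \sum_(k < n) \sum_(j < n)
       (a k * conjc (a j)) * (ee t ^+ k * conjc (ee t ^+ j))).
  apply: eq_cI => t; rewrite -mulcJ rmorph_sum /= mulr_suml.
  apply: eq_bigr => k _; rewrite mulr_sumr; apply: eq_bigr => j _.
  by rewrite rmorphM /=; ring.
rewrite cI_sum => [|k]; last by apply: citg_sum => j; exact: citg_eeX.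
apply: eq_bigr => k _; rewrite cI_sum => [|j]; last exact: citg_eeX.
have e j : cI (fun t => (a k * conjc (a j)) * (ee t ^+ k * conjc (ee t ^+ j))) =
    (a k * conjc (a j)) * (k == j :> nat)%:R.
  rewrite cIZ ?cI_eeXJ//.
  by apply: eq_citg (citg_eeX 1 k j) => t; rewrite mul1r.
rewrite (bigD1 k)//= big1 => [|j jk].
  by rewrite e eqxx mulr1 addr0 mulcJ.
by rewrite e [_ == _ :> nat]eq_sym val_eqE (negbTE jk) mulr0.
Qed.

End CircleIntegralC.

(** * Elementary estimates on sums and sequences *)

Section Sequences.
Variable R : realType.
Implicit Types (u : nat -> R) (q B e : R).

Lemma cvg_le_cst u (l c : R) : u n @[n --> \oo] --> l ->
  (\forall n \near \oo, u n <= c) -> l <= c.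
Proof. by move=> ul h; exact: (ler_cvg_to ul (cvg_cst c) h). Qed.

Lemma cvg_ge_cst u (l c : R) : u n @[n --> \oo] --> l ->
  (\forall n \near \oo, c <= u n) -> c <= l.
Proof. by move=> ul h; exact: (ler_cvg_to (cvg_cst c) ul h). Qed.

Lemma div01 (x y : R) : 0 <= x -> x < y -> 0 <= x / y < 1.
Proof.
move=> x0 xy; have y0 : 0 < y by rewrite (le_lt_trans x0).
by rewrite divr_ge0 ?(ltW y0)//= ltr_pdivrMr// mul1r.
Qed.

Lemma geo_sum q n m : (n <= m)%N ->
  (1 - q) * \sum_(n <= k < m) q ^+ k = q ^+ n - q ^+ m.
Proof.
move=> nm; rewrite -(subnK nm); elim: (m - n)%N => [|k IH].
  by rewrite add0n big_geq// mulr0 subrr.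
by rewrite addSn big_nat_recr ?leq_addl//= mulrDr IH exprS; ring.
Qed.

Lemma geo_le q n m : 0 <= q < 1 -> \sum_(n <= k < m) q ^+ k <= q ^+ n / (1 - q).
Proof.
move=> /andP[q0 q1]; rewrite ler_pdivlMr ?subr_gt0// mulrC.
have [nm|mn] := leqP n m.
  by rewrite geo_sum// lerBlDr lerDl exprn_ge0.
by rewrite big_geq ?mulr0 ?exprn_ge0// ltnW.
Qed.

Lemma expr_small q B e : 0 <= q < 1 -> 0 < e ->
  exists N, forall n, (N <= n)%N -> B * q ^+ n <= e.
Proof.
move=> /andP[q0 q1] e0.
have : B * q ^+ n @[n --> \oo] --> B * 0.
  by apply: cvgM; [exact: cvg_cst|apply: cvg_expr; rewrite ger0_norm].
rewrite mulr0 => /cvgrPdist_le /(_ _ e0) [N _ H]; exists N => n Nn.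
have := H n Nn; rewrite sub0r normrN; exact: le_trans (ler_norm _).
Qed.

Lemma invn_small e : 0 < e -> exists N, forall n, (N <= n)%N -> n.+1%:R^-1 <= e.
Proof.
move=> e0; have [N _ H] := near_infty_natSinv_lt (PosNum e0).
by exists N => n Nn; apply: ltW; exact: (H n Nn).
Qed.

Lemma bernoulli_ge (h : R) n : 0 <= h <= 1 -> 1 - n%:R * h <= (1 - h) ^+ n.
Proof.
move=> /andP[h0 h1]; elim: n => [|n IH]; first by rewrite mul0r subr0 expr0.
rewrite exprS (le_trans _ (ler_wpM2l _ IH)) ?subr_ge0// -natr1.
have : 0 <= n%:R * h ^+ 2 by rewrite mulr_ge0 ?sqr_ge0.
nra.
Qed.

(** This lets a radius tend to 1 inside an inequality: Bernoulli's inequality gives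
    [S - m S h <= S (1 - h)^m], and [h] is chosen so that [m S h <= e]. *)
Lemma le_from_scaled (S M : R) m : 0 <= S ->
  (forall r, 0 <= r < 1 -> S * r ^+ m <= M) -> S <= M.
Proof.
move=> S0 H; apply/ler_addgt0Pr => e e0.
pose K := m%:R * S + 1; have K0 : 0 < K by rewrite ltr_wpDl// mulr_ge0.
pose h := Num.min 1 (e / K).
have h0 : 0 < h by rewrite lt_min ltr01 divr_gt0.
have h1 : h <= 1 by rewrite ge_min lexx.
have he : h * K <= e by rewrite -ler_pdivlMr// ge_min lexx orbT.
have r1 : 0 <= 1 - h < 1 by rewrite subr_ge0 h1 ltrBlDr ltrDl.
have := H _ r1; have h01 : 0 <= h <= 1 by rewrite ltW.
have := ler_wpM2l S0 (bernoulli_ge m h01).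
by rewrite /K in he; nra.
Qed.

Lemma Cauchy_Schwarz (s : seq nat) (x y : nat -> R) :
  (forall k, 0 <= x k) -> (forall k, 0 <= y k) ->
  (\sum_(k <- s) x k * y k) ^+ 2 <=
  (\sum_(k <- s) x k ^+ 2) * (\sum_(k <- s) y k ^+ 2).
Proof.
move=> x0 y0; elim: s => [|k s IH]; first by rewrite !big_nil mulr0 expr0n.
rewrite !big_cons.
have A0 : 0 <= \sum_(k <- s) x k * y k by apply: sumr_ge0 => i _; rewrite mulr_ge0.
have X0 : 0 <= \sum_(k <- s) x k ^+ 2 by apply: sumr_ge0 => i _; rewrite sqr_ge0.
have Y0 : 0 <= \sum_(k <- s) y k ^+ 2 by apply: sumr_ge0 => i _; rewrite sqr_ge0.
set A := \sum_(k <- s) x k * y k in A0 IH *.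
set X := \sum_(k <- s) x k ^+ 2 in X0 IH *.
set Y := \sum_(k <- s) y k ^+ 2 in Y0 IH *.
have a0 := x0 k; have b0 := y0 k; move: (x k) (y k) a0 b0 => a b a0 b0.
(* The inductive step reduces to this; after squaring it follows from [A^2 <= X Y] and
   [4 (X b^2) (Y a^2) <= (X b^2 + Y a^2)^2]. *)
suff : 2 * A * (a * b) <= X * b ^+ 2 + Y * a ^+ 2 by nra.
rewrite -(@ler_pXn2r _ 2) ?nnegrE ?mulr_ge0 ?addr_ge0 ?mulr_ge0 ?sqr_ge0//.
have -> : (2 * A * (a * b)) ^+ 2 = 4 * A ^+ 2 * (a ^+ 2 * b ^+ 2) by ring.
have h1 : A ^+ 2 * (a ^+ 2 * b ^+ 2) <= X * Y * (a ^+ 2 * b ^+ 2).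
  by apply: ler_wpM2r => //; rewrite mulr_ge0 ?sqr_ge0.
have h2 := sqr_ge0 (X * b ^+ 2 - Y * a ^+ 2).
nra.
Qed.

Lemma complex_cauchy (u : nat -> R[i]) :
  (forall e, 0 < e -> exists N, forall n m, (N <= n)%N -> (N <= m)%N ->
     modc (u n - u m) <= e) ->
  exists l : R[i], u n @[n --> \oo] --> l.
Proof.
move=> H.
have K (v : nat -> R) : (forall n m, `|v n - v m| <= modc (u n - u m)) ->
    exists l : R, v n @[n --> \oo] --> l.
  move=> vu; suff /cvg_ex[l vl] : cvg (v n @[n --> \oo]) by exists l.
  apply/cauchy_cvgP/cauchy_exP => e e0.
  have e2 : 0 < e / 2 by rewrite divr_gt0.
  have [N HN] := H _ e2.
  exists (v N); exists N => // n /= Nn.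
  rewrite /ball /= (le_lt_trans (vu _ _))// (le_lt_trans (HN _ _ _ Nn))//.
  by rewrite ltr_pdivrMr// ltr_pMr// ltr1n.
have [a ua] : exists l : R, Re (u n) @[n --> \oo] --> l.
  by apply: K => n m; rewrite -ReN -ReD Re_le_modc.
have [b ub] : exists l : R, Im (u n) @[n --> \oo] --> l.
  by apply: K => n m; rewrite -ImN -ImD Im_le_modc.
by exists (a +i* b); apply: cvgc_ReIm.
Qed.

End Sequences.

(** * Analyticity as polynomial approximation, and uniqueness of Taylor coefficients *)

Section Analytic.
Variable R : realType.
Implicit Types (f g : R[i] -> R[i]) (a b : nat -> R[i]) (p : {poly R[i]}).

(** The working form of analyticity, equivalent to [analytic_disk] by [analyticP]: it passes to
    products, compositions and locally uniform limits without rearranging power series. *)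
Definition polyapprox f := forall r e : R, r < 1 -> 0 < e ->
  exists p, forall z, modc z <= r -> modc (f z - p.[z]) <= e.

(** Convergence at the larger radius [rho = (1 + r) / 2] bounds [|a_k| rho^k], so on the disk of
    radius [r] the terms are dominated by a geometric sequence of ratio [r / rho]. *)
Lemma taylor_tail a f (r : R) : has_taylor a f -> 0 <= r < 1 ->
  exists B q : R, [/\ 0 <= B, 0 <= q < 1 & forall n z, modc z <= r ->
    modc (f z - \sum_(k < n) a k * z ^+ k) <= B * q ^+ n].
Proof.
move=> fa /andP[r0 r1].
pose rho := (1 + r) / 2.
have rho1 : rho < 1 by rewrite ltr_pdivrMr// mul1r; lra.
have rho0 : 0 < rho by rewrite divr_gt0// ltr_wpDr.
have rrho : r < rho by rewrite ltr_pdivlMr//; lra.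
have [B B0 aB] : exists2 B : R, 0 <= B & forall k, modc (a k) * rho ^+ k <= B.
  have mrho : modc rho%:C < 1 by rewrite modc_real gtr0_norm.
  have h2 : 0 < 2^-1 :> R by rewrite invr_gt0.
  have /cvgcP/(_ _ h2)[N _ HN] := fa _ mrho.
  pose v k := modc (a k) * rho ^+ k.
  have v0 k : 0 <= v k by rewrite mulr_ge0 ?modc_ge0 ?exprn_ge0// ltW.
  exists (1 + \sum_(k < N) v k); first by rewrite addr_ge0// sumr_ge0.
  move=> k; have [kN|Nk] := ltnP k N.
    by rewrite (bigD1 (Ordinal kN))//= -/(v k) addrCA lerDl addr_ge0// sumr_ge0.
  apply: (@le_trans _ _ 1); last by rewrite lerDl sumr_ge0.
  have -> : modc (a k) * rho ^+ k = modc (a k * rho%:C ^+ k).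
    by rewrite modcM modcX modc_real gtr0_norm.
  (* A term is the difference of two consecutive partial sums, each within [1/2] of the limit. *)
  have -> : a k * rho%:C ^+ k = (series (fun k => a k * rho%:C ^+ k) k.+1 - f rho%:C)
      - (series (fun k => a k * rho%:C ^+ k) k - f rho%:C).
    by rewrite /series /= big_nat_recr//=; ring.
  rewrite (le_trans (modcB _ _))// (splitr 1) lerD//; apply: ltW;
    rewrite mul1r; apply: HN => //=.
  exact: leqW.
pose q := r / rho.
have q01 : 0 <= q < 1 by exact: div01.
exists (B / (1 - q)), q; split => //.
  by rewrite divr_ge0// subr_ge0 ltW//; case/andP : q01.
move=> n z zr.
have z1 : modc z < 1 by rewrite (le_lt_trans zr).
have term k : modc (a k * z ^+ k) <= B * q ^+ k.
  rewrite modcM modcX /q exprMn exprVn mulrCA mulrA.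
  rewrite (_ : r ^+ k * B / rho ^+ k = r ^+ k * (B / rho ^+ k)); last by rewrite mulrA.
  rewrite mulrC ler_pM ?exprn_ge0 ?modc_ge0//.
    by rewrite lerXn2r// nnegrE modc_ge0.
  by rewrite ler_pdivlMr ?exprn_gt0.
apply/ler_addgt0Pr => e e0.
have /cvgcP/(_ _ e0)[N _ HN] := fa _ z1.
pose m := maxn n N.
have := HN m (leq_maxr _ _) => /ltW.
rewrite /series /= (big_cat_nat (n := n)) ?leq_maxl//= modc_distC => hm.
rewrite -(big_mkord xpredT (fun k => a k * z ^+ k)).
set S := \sum_(0 <= i < n) _ in hm *; set T := \sum_(n <= i < m) _ in hm.
have -> : f z - S = T + (f z - (S + T)) by ring.
rewrite (le_trans (modcD _ _))// lerD//.
rewrite (le_trans (modc_sum _ _ _))//.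
rewrite (@le_trans _ _ (\sum_(n <= k < m) B * q ^+ k))//.
  by apply: ler_sum => k _; exact: term.
by rewrite -mulr_sumr mulrAC -mulrA ler_wpM2l// geo_le.
Qed.

Lemma has_taylor_polyapprox a f : has_taylor a f -> polyapprox f.
Proof.
move=> fa r e r1 e0.
wlog r0 : r r1 / 0 <= r => [H|].
  have [/(H r r1)//|r0] := leP 0 r.
  have [p Hp] := H 0 ltr01 (lexx 0); exists p => z zr.
  by apply: Hp; rewrite (le_trans zr)// ltW.
have [|B [q [B0 q01 H]]] := taylor_tail (r := r) fa; first by rewrite r0.
have [N HN] := expr_small B q01 e0.
exists (\poly_(k < N) a k) => z zr; rewrite horner_poly.
exact: le_trans (H _ _ zr) (HN _ (leqnn _)).
Qed.

(** Parseval's formula on the circle of radius [r]: a single square is at most the whole sum, which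
    is at most [M^2]. *)
Lemma cauchy_estimate p (r M : R) k : 0 <= r ->
  (forall z, modc z <= r -> modc p.[z] <= M) -> modc p`_k * r ^+ k <= M.
Proof.
move=> r0 pM.
have M0 : 0 <= M.
  by apply: le_trans (modc_ge0 p.[0]) (pM 0 _); rewrite modc0.
have mr t : modc (r%:C * ee t) = r by rewrite modcM modc_ee mulr1 modc_real ger0_norm.
have [kp|pk] := ltnP k (size p); last first.
  by rewrite nth_default// modc0 mul0r.
rewrite -(@ler_pXn2r _ 2) ?nnegrE ?mulr_ge0 ?modc_ge0 ?exprn_ge0//.
have E t : p.[r%:C * ee t] = \sum_(k < size p) (p`_k * r%:C ^+ k) * ee t ^+ k.
  by rewrite horner_coef; apply: eq_bigr => i _; rewrite exprMn mulrA.
have /= P := parseval (size p) (fun k => p`_k * r%:C ^+ k).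
have : \sum_(k < size p) modc (p`_k * r%:C ^+ k) ^+ 2 <= M ^+ 2.
  rewrite -P -[leRHS]II_cst; apply: le_II.
  - apply: (@itg_bd _ _ (M ^+ 2)).
      apply: mfun_sqr_modc; apply: cmf_sum => i; apply: cmfM; first exact: cmf_cst.
      by apply: cmfX; exact: cmf_ee.
    move=> t; rewrite -E normrX ger0_norm ?modc_ge0// lerXn2r ?nnegrE ?modc_ge0//.
    by rewrite pM// mr.
  - exact: itg_cst.
  - by move=> t; rewrite -E lerXn2r ?nnegrE ?modc_ge0// pM// mr.
apply: le_trans; rewrite (bigD1 (Ordinal kp))//= modcM modcX modc_real.
by rewrite (ger0_norm r0) lerDl sumr_ge0// => i _; rewrite sqr_ge0.
Qed.

(** Let [P n] approximate [f] to within [1 / (n + 1)] on the disk of radius [1 - 1 / (n + 1)]. By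
    Cauchy's estimate each coefficient of [P n] is a Cauchy sequence; the limits [a k] are the
    Taylor coefficients of [f]. *)
Lemma polyapprox_analytic f : polyapprox f -> analytic_disk f.
Proof.
move=> fP.
pose r_ n : R := 1 - n.+1%:R^-1.
have r_1 n : r_ n < 1 by rewrite ltrBlDr ltrDl invr_gt0.
have r_nd n m : (n <= m)%N -> r_ n <= r_ m.
  by move=> nm; rewrite lerD2l lerN2 lef_pV2 ?posrE// ler_nat.
have /choice[P PH] : forall n, exists p, forall z, modc z <= r_ n ->
    modc (f z - p.[z]) <= n.+1%:R^-1.
  by move=> n; apply: fP => //; rewrite invr_gt0.
have r_big (r : R) : r < 1 -> exists N, forall n, (N <= n)%N -> r <= r_ n.
  rewrite -subr_gt0 => /invn_small[N HN]; exists N => n /HN h.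
  by rewrite /r_ lerBrDl -lerBrDr.
have diff r k n m N : 0 <= r <= r_ N -> (N <= n)%N -> (N <= m)%N ->
    modc ((P n)`_k - (P m)`_k) * r ^+ k <= 2 * N.+1%:R^-1.
  move=> /andP[r0 rN] Nn Nm; rewrite -coefB; apply: cauchy_estimate => // z zr.
  rewrite hornerD hornerN.
  have -> : (P n).[z] - (P m).[z] = (f z - (P m).[z]) - (f z - (P n).[z]) by ring.
  rewrite (le_trans (modcB _ _))// mulr2n mulrDl mul1r lerD//.
    rewrite (le_trans (PH m z _)) ?lef_pV2 ?posrE ?ler_nat//.
    by rewrite (le_trans zr)// (le_trans rN)// r_nd.
  rewrite (le_trans (PH n z _)) ?lef_pV2 ?posrE ?ler_nat//.
  by rewrite (le_trans zr)// (le_trans rN)// r_nd.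
have /choice[a Ha] : forall k, exists l : R[i], (P n)`_k @[n --> \oo] --> l.
  move=> k; apply: complex_cauchy => e e0.
  pose hf : R := 2^-1.
  have hf0 : 0 < hf by rewrite invr_gt0.
  have hf1 : hf < 1 by rewrite invf_lt1// ltr1n.
  have k0 : 0 < hf ^+ k by rewrite exprn_gt0.
  pose e' := e * hf ^+ k / 2.
  have e'0 : 0 < e' by rewrite divr_gt0// mulr_gt0.
  have [N1 HN1] := invn_small e'0.
  have [N2 HN2] := r_big _ hf1.
  exists (maxn N1 N2) => n m Nn Nm.
  have h2 : 0 <= hf <= r_ (maxn N1 N2) by rewrite (ltW hf0) HN2// leq_maxr.
  have := diff hf k n m _ h2 Nn Nm.
  have := HN1 _ (leq_maxl N1 N2); rewrite /e' => h3 h4.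
  rewrite -(ler_pM2r k0) (le_trans h4)//.
  by rewrite -ler_pdivlMl// mulrC.
have lim r k n N : 0 <= r <= r_ N -> (N <= n)%N ->
    modc ((P n)`_k - a k) * r ^+ k <= 2 * N.+1%:R^-1.
  move=> rN Nn.
  have := @cvg_modc _ _ _ _ (fun m => (P n)`_k - (P m)`_k) ((P n)`_k - a k).
  move=> H; apply: (@cvg_le_cst _ (fun m => modc ((P n)`_k - (P m)`_k) * r ^+ k)).
    apply: cvgM; last exact: cvg_cst.
    apply: H; apply/cvgcP => e e0.
    have /cvgcP/(_ _ e0) := Ha k; apply: filterS => m.
    by rewrite modc_distC; congr (modc _ < _); ring.
  by exists N => // m /= Nm; exact: diff.
exists a => z z1; apply/cvgcP => e e0.
pose r := (1 + modc z) / 2.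
have z0 := modc_ge0 z.
have r1 : r < 1 by rewrite ltr_pdivrMr// mul1r; lra.
have zr : modc z < r by rewrite ltr_pdivlMr//; lra.
have r0 : 0 < r by rewrite (le_lt_trans z0).
pose q := modc z / r.
have q01 : 0 <= q < 1 by exact: div01.
have q1 : 0 < 1 - q by rewrite subr_gt0; case/andP : q01.
(* Two errors are collected: [e'] for [f - P N], and [2 e' / (1 - q)] for the geometric sum of the
   differences of coefficients; together [e' c = e / 2]. *)
pose c := 1 + 2 / (1 - q).
have c0 : 0 < c by rewrite ltr_wpDl// divr_gt0.
pose e' := e / (2 * c).
have e'0 : 0 < e' by rewrite divr_gt0// mulr_gt0.
have [N1 HN1] := invn_small e'0.
have [N2 HN2] := r_big _ r1.
pose N := maxn N1 N2.
have rN : 0 <= r <= r_ N by rewrite ltW//= HN2// leq_maxr.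
have NE : N.+1%:R^-1 <= e' by rewrite HN1// leq_maxl.
exists (size (P N)) => // K /= KN.
rewrite /series /= big_mkord modc_distC.
have PE : (P N).[z] = \sum_(k < K) (P N)`_k * z ^+ k.
  rewrite horner_coef (big_ord_widen K (fun k => (P N)`_k * z ^+ k))//.
  rewrite big_mkcond /=; apply: eq_bigr => k _; case: ifPn => //.
  by rewrite -leqNgt => kN; rewrite nth_default// mul0r.
have -> : f z - \sum_(k < K) a k * z ^+ k =
    (f z - (P N).[z]) + \sum_(k < K) ((P N)`_k - a k) * z ^+ k.
  rewrite PE; under [X in _ = _ + X]eq_bigr do rewrite mulrBl.
  by rewrite sumrB; ring.
have zN : modc z <= r_ N by rewrite (le_trans (ltW zr))//; case/andP : rN.
apply: (@le_lt_trans _ _ (e' + 2 * e' / (1 - q))).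
  rewrite (le_trans (modcD _ _))// lerD//; first exact: le_trans (PH _ _ zN) NE.
  rewrite (le_trans (modc_sum _ _ _))//.
  apply: (@le_trans _ _ (\sum_(k < K) 2 * e' * q ^+ k)).
    apply: ler_sum => k _; rewrite modcM modcX.
    have -> : modc z ^+ k = r ^+ k * q ^+ k.
      by rewrite -exprMn /q mulrCA divff ?mulr1// gt_eqF.
    rewrite mulrA ler_wpM2r ?exprn_ge0//; first by case/andP : q01.
    rewrite (le_trans (lim r k N N rN (leqnn _)))//.
    by rewrite ler_wpM2l.
  have e20 : 0 <= 2 * e' by exact: mulr_ge0 (ler0n _ 2) (ltW e'0).
  rewrite -mulr_sumr ler_wpM2l//.
  have := geo_le 0 K q01; rewrite big_mkord expr0 mul1r => h.
  exact: h.
have -> : e' + 2 * e' / (1 - q) = e' * c by rewrite /c; ring.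
have -> : e' * c = e / 2 by rewrite /e'; field; rewrite gt_eqF.
by rewrite ltr_pdivrMr// ltr_pMr// ltr1n.
Qed.

Lemma analyticP f : analytic_disk f <-> polyapprox f.
Proof.
split; last exact: polyapprox_analytic.
by move=> [a]; exact: has_taylor_polyapprox.
Qed.

(** On the disk of radius [1/2] both partial sums are uniformly close to [f], so Cauchy's estimate
    makes each difference of coefficients arbitrarily small. *)
Lemma has_taylor_unique a b f : has_taylor a f -> has_taylor b f -> a = b.
Proof.
move=> fa fb; apply/funext => k; apply/eqP; rewrite -subr_eq0 -modc_eq0.
rewrite eq_le modc_ge0 andbT; apply/ler_addgt0Pr => e e0; rewrite add0r.
have h01 : (0 <= 2^-1 :> R) && (2^-1 < 1 :> R) by rewrite invr_ge0 ler0n invf_lt1// ltr1n.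
have [B [q [B0 q01 H]]] := taylor_tail fa h01.
have [B' [q' [B0' q01' H']]] := taylor_tail fb h01.
have k0 : 0 < 2^-1 ^+ k :> R by rewrite exprn_gt0.
pose e' := e * 2^-1 ^+ k / 2; have e'0 : 0 < e' by rewrite divr_gt0// mulr_gt0.
have [N HN] := expr_small B q01 e'0.
have [N' HN'] := expr_small B' q01' e'0.
pose n := maxn k.+1 (maxn N N').
have := @cauchy_estimate (\poly_(k < n) (a k - b k)) 2^-1 (e' + e') k.
rewrite coef_poly leq_maxl => C; rewrite -(ler_pM2r k0).
have -> : e * 2^-1 ^+ k = e' + e' by rewrite /e' -splitr.
apply: C => [|z zr]; first by case/andP : h01.
rewrite horner_poly; under eq_bigr do rewrite mulrBl.
rewrite sumrB; set X := \sum_(i < n) _; set Y := \sum_(i < n) _.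
have -> : X - Y = (f z - Y) - (f z - X) by ring.
rewrite (le_trans (modcB _ _))// lerD//.
  by rewrite (le_trans (H' n _ zr))// HN'// /n !leq_max leqnn !orbT.
by rewrite (le_trans (H n _ zr))// HN// /n !leq_max leqnn !orbT.
Qed.

Lemma taylor_coefP a f : has_taylor a f -> taylor_coef f = a.
Proof.
move=> fa; apply: (@has_taylor_unique _ _ f) => //.
by apply: (@xgetPex _ _ [set a | has_taylor a f]); exists a.
Qed.

Lemma analytic_taylor f : analytic_disk f -> has_taylor (taylor_coef f) f.
Proof. by move=> [a fa]; rewrite (taylor_coefP fa). Qed.

End Analytic.

(** * Closure properties of analytic functions; the complex exponential *)

Section AnalyticClosure.
Variable R : realType.
Implicit Types (f g : R[i] -> R[i]) (p : {poly R[i]}).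

Lemma eq_analytic f g : (forall z, modc z < 1 -> f z = g z) ->
  analytic_disk f -> analytic_disk g.
Proof.
move=> fg [a fa]; exists a => z z1; rewrite -fg//; exact: fa.
Qed.

Lemma analytic_bounded f (r : R) : analytic_disk f -> r < 1 ->
  exists2 M, 0 <= M & forall z, modc z <= r -> modc (f z) <= M.
Proof.
move=> [a fa] r1; have [r0|r0] := leP 0 r.
  have [|B [q [B0 q01 H]]] := taylor_tail (r := r) fa; first by rewrite r0.
  exists B => // z zr; have := H 0%N z zr.
  by rewrite big_ord0 subr0 expr0 mulr1.
by exists 0 => // z zr; have := modc_ge0 z; rewrite leNgt (le_lt_trans zr r0).
Qed.

Lemma analytic_poly p : analytic_disk (fun z => p.[z]).
Proof.
apply/analyticP => r e r1 e0; exists p => z _.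
by rewrite subrr modc0 ltW.
Qed.

Lemma analytic_cst (c : R[i]) : analytic_disk (fun=> c).
Proof. by apply: eq_analytic (analytic_poly c%:P) => z _; rewrite hornerC. Qed.

Lemma analytic_id : analytic_disk (fun z : R[i] => z).
Proof. by apply: eq_analytic (analytic_poly 'X) => z _; rewrite hornerX. Qed.

Lemma analyticD f g : analytic_disk f -> analytic_disk g ->
  analytic_disk (fun z => f z + g z).
Proof.
move=> /analyticP fa /analyticP ga; apply/analyticP => r e r1 e0.
have e2 : 0 < e / 2 by rewrite divr_gt0.
have [p Hp] := fa _ _ r1 e2; have [q Hq] := ga _ _ r1 e2.
exists (p + q) => z zr; rewrite hornerD.
have -> : f z + g z - (p.[z] + q.[z]) = (f z - p.[z]) + (g z - q.[z]) by ring.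
by rewrite (le_trans (modcD _ _))// (splitr e) lerD// ?Hp ?Hq.
Qed.

Lemma analyticM f g : analytic_disk f -> analytic_disk g ->
  analytic_disk (fun z => f z * g z).
Proof.
move=> fa ga; apply/analyticP => r e r1 e0.
have [M M0 HM] := analytic_bounded fa r1.
have [N N0 HN] := analytic_bounded ga r1.
move/analyticP : fa => fa; move/analyticP : ga => ga.
have e1 : 0 < e / 2 / (M + 1) by rewrite !divr_gt0// ltr_wpDl.
have [q Hq] := ga _ _ r1 e1.
have e2 : 0 < e / 2 / (N + e / 2 / (M + 1)) by rewrite !divr_gt0// ltr_wpDl.
have [p Hp] := fa _ _ r1 e2.
exists (p * q) => z zr; rewrite hornerM.
have -> : f z * g z - p.[z] * q.[z] = f z * (g z - q.[z]) + (f z - p.[z]) * q.[z] by ring.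
rewrite (le_trans (modcD _ _))// (splitr e) lerD// modcM.
  apply: (@le_trans _ _ ((M + 1) * (e / 2 / (M + 1)))).
    by rewrite ler_pM ?modc_ge0 ?Hq// (le_trans (HM _ zr))// lerDl.
  by rewrite mulrCA divff ?mulr1// gt_eqF// ltr_wpDl.
have qN : modc q.[z] <= N + e / 2 / (M + 1).
  have -> : q.[z] = g z - (g z - q.[z]) by ring.
  by rewrite (le_trans (modcB _ _))// lerD// ?HN ?Hq.
apply: (le_trans (ler_pM (modc_ge0 _) (modc_ge0 _) (Hp _ zr) qN)).
by rewrite divfK// gt_eqF// ltr_wpDl.
Qed.

Lemma analyticZ (c : R[i]) f : analytic_disk f -> analytic_disk (fun z => c * f z).
Proof. by move=> fa; exact: (analyticM (analytic_cst c) fa). Qed.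

Lemma analyticX f n : analytic_disk f -> analytic_disk (fun z => f z ^+ n).
Proof.
move=> fa; elim: n => [|n IH]; first by apply: eq_analytic (analytic_cst 1).
by apply: eq_analytic (analyticM fa IH) => z _; rewrite exprS.
Qed.

Lemma analytic_sum (I : Type) (s : seq I) (F : I -> R[i] -> R[i]) :
  (forall i, analytic_disk (F i)) ->
  analytic_disk (fun z => \sum_(i <- s) F i z).
Proof.
move=> Fa; elim: s => [|i s IH].
  by apply: eq_analytic (analytic_cst 0) => z _; rewrite big_nil.
by apply: eq_analytic (analyticD (Fa i) IH) => z _; rewrite big_cons.
Qed.

Lemma analytic_lim f : (forall r e : R, r < 1 -> 0 < e ->
    exists2 g, analytic_disk g &
      forall z, modc z <= r -> modc (f z - g z) <= e) ->
  analytic_disk f.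
Proof.
move=> H; apply/analyticP => r e r1 e0.
have e2 : 0 < e / 2 by rewrite divr_gt0.
have [g /analyticP ga fg] := H _ _ r1 e2; have [p Hp] := ga _ _ r1 e2.
exists p => z zr.
have -> : f z - p.[z] = (f z - g z) + (g z - p.[z]) by ring.
by rewrite (le_trans (modcD _ _))// (splitr e) lerD// ?fg ?Hp.
Qed.

(** The last hypothesis keeps the image of a smaller disk away from the unit circle, so that one
    polynomial approximates [f] uniformly on it; for self-maps it is [selfmap_compact]. *)
Lemma analytic_comp f phi : analytic_disk f -> analytic_disk phi ->
  (forall r : R, r < 1 -> exists2 s : R, s < 1 &
     forall z, modc z <= r -> modc (phi z) <= s) ->
  analytic_disk (fun z => f (phi z)).
Proof.
move=> /analyticP fa pa H; apply: analytic_lim => r e r1 e0.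
have [s s1 Hs] := H _ r1; have [p Hp] := fa _ _ s1 e0.
exists (fun z => p.[phi z]); last by move=> z zr; apply: Hp; exact: Hs.
have := @analytic_sum _ (index_enum 'I_(size p)) (fun k z => p`_k * phi z ^+ k).
move=> Hs'; apply: eq_analytic (Hs' _) => [z _|k]; first by rewrite horner_coef.
by apply: analyticZ; exact: analyticX.
Qed.

Lemma analytic_scale f (r : R) : 0 <= r <= 1 -> analytic_disk f ->
  analytic_disk (fun z => f (r%:C * z)).
Proof.
move=> /andP[r0 r1] fa; apply: (@analytic_comp f (fun z => r%:C * z) fa).
  exact: (analyticZ _ analytic_id).
move=> s s1; exists s => // z zs.
by rewrite modcM modc_real ger0_norm// (le_trans _ zs)// ler_piMl// modc_ge0.
Qed.

(** The polar form makes the modulus and the addition formula immediate; analyticity comes from the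
    limit of [(1 + z / n)^n]. *)
Definition cexp (z : R[i]) : R[i] := (expR (Re z))%:C * expi (Im z).

Lemma cexpD z w : cexp (z + w) = cexp z * cexp w.
Proof. by rewrite /cexp ReD ImD expRD expiD rmorphM /=; ring. Qed.

Lemma cexp0 : cexp 0 = 1.
Proof. by rewrite /cexp /= expR0 expi0 mulr1. Qed.

Lemma modc_cexp z : modc (cexp z) = expR (Re z).
Proof. by rewrite modcM modc_expi mulr1 modc_real ger0_norm// expR_ge0. Qed.

Lemma cexp_neq0 z : cexp z != 0.
Proof. by rewrite -modc_gt0 modc_cexp expR_gt0. Qed.

Lemma cexpMn z n : cexp (n%:R * z) = cexp z ^+ n.
Proof.
elim: n => [|n IH]; first by rewrite mul0r cexp0.
by rewrite -natr1 mulrDl mul1r cexpD IH exprSr.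
Qed.

Lemma sin_le_id (y : R) : `|sin y| <= `|y|.
Proof.
wlog y0 : y / 0 <= y => [H|].
  have [/H//|y0] := leP 0 y; rewrite -normrN -sinN -(normrN y); apply: H.
  by rewrite oppr_ge0 ltW.
have [|c _] := @MVT_segment R sin cos 0 y y0.
- by apply: continuous_subspaceT; exact: continuous_sin.
rewrite sin0 !subr0 => ->; rewrite normrM ler_piMl// ler_norml.
by rewrite cos_geN1 cos_le1.
Qed.

Lemma cosB1_le (y : R) : `|cos y - 1| <= y ^+ 2.
Proof.
wlog y0 : y / 0 <= y => [H|].
  have [/H//|y0] := leP 0 y; rewrite -cosN -sqrrN; apply: H.
  by rewrite oppr_ge0 ltW.
have [|c /[!in_itv]/= /andP[c0 cy]] := @MVT_segment R cos (fun x => - sin x) 0 y y0.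
- by apply: continuous_subspaceT; exact: continuous_cos.
rewrite cos0 subr0 => ->; rewrite normrM normrN expr2 (ger0_norm y0) ler_wpM2r//.
by rewrite (le_trans (sin_le_id _))// ger0_norm.
Qed.

Lemma sinBid_le (y : R) : `|y| <= 1 -> `|sin y - y| <= y ^+ 2.
Proof.
wlog y0 : y / 0 <= y => [H|].
  have [/H//|y0] := leP 0 y => y1; rewrite -normrN opprB -sqrrN.
  have -> : y - sin y = sin (- y) - - y by rewrite sinN; ring.
  by apply: H; rewrite ?normrN// oppr_ge0 ltW.
rewrite (ger0_norm y0) => y1.
have [|c /[!in_itv]/= /andP[c0 cy]] := @MVT_segment R (fun x => sin x - x) (fun x => cos x - 1) 0 y y0.
- apply: continuous_subspaceT => x; apply: cvgB; [exact: continuous_sin|exact: cvg_id].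
rewrite sin0 subrr !subr0 => ->; rewrite normrM expr2 (ger0_norm y0) ler_wpM2r//.
rewrite (le_trans (cosB1_le _))//; nra.
Qed.

Lemma expR_mul1B_le1 (x : R) : expR x * (1 - x) <= 1.
Proof.
rewrite -[leRHS](_ : expR x * expR (- x) = 1); last by rewrite -expRD subrr expR0.
by rewrite ler_pM2l ?expR_gt0// expR_ge1Dx.
Qed.

(** [expR_mul1B_le1] at [1/2] gives [exp (1/2) <= 2], which is squared. *)
Lemma expR_le4 (x : R) : x <= 1 -> expR x <= 4.
Proof.
move=> x1; rewrite (le_trans (_ : _ <= expR 1)) ?ler_expR//.
have := expR_mul1B_le1 2^-1; have := expR_gt0 (2^-1 : R).
have -> : expR 1 = expR 2^-1 * expR 2^-1 :> R by rewrite -expRD -[in RHS](mul1r 2^-1) -splitr.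
nra.
Qed.

Lemma expRB1_le (x : R) : `|x| <= 1 -> `|expR x - 1 - x| <= 4 * x ^+ 2.
Proof.
rewrite ler_norml => /andP[x1 x2].
have h1 := expR_ge1Dx x.
have h3 := expR_mul1B_le1 x.
have e4 := expR_le4 x2.
rewrite ger0_norm; last by lra.
have [x0|x0] := leP 0 x; nra.
Qed.

Lemma cexpB1_le (z : R[i]) : modc z <= 1 -> modc (cexp z - 1 - z) <= 16 * modc z ^+ 2.
Proof.
move=> z1; have x1 := le_trans (Re_le_modc z) z1; have y1 := le_trans (Im_le_modc z) z1.
rewrite (le_trans (modc_le_ReIm _))// !ReD !ImD !ReN !ImN !ReMr !ImMr /=.
rewrite sqr_modc oppr0 addr0.
move: (Re z) (Im z) x1 y1 => x y {z z1} x1 y1.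
have hx := expRB1_le x1; have hc := cosB1_le y; have hs := sinBid_le y1.
have e3 : expR x <= 4 by apply: expR_le4; move: x1; rewrite ler_norml => /andP[].
have p := expR_gt0 x.
have hxy : `|(expR x - 1) * y| <= 5 * (x ^+ 2 + y ^+ 2).
  have : `|expR x - 1| <= 5 * `|x|.
    have -> : expR x - 1 = (expR x - 1 - x) + x by ring.
    rewrite (le_trans (ler_normD _ _))//.
    rewrite -(real_normK (num_real x)) in hx.
    have := normr_ge0 x; nra.
  rewrite normrM => h; rewrite (le_trans (ler_wpM2r (normr_ge0 y) h))//.
  rewrite -(real_normK (num_real x)) -(real_normK (num_real y)).
  have := sqr_ge0 (`|x| - `|y|); have := normr_ge0 x; have := normr_ge0 y; nra.
have A : `|expR x * cos y - 1 - x| <= 4 * x ^+ 2 + 4 * y ^+ 2.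
  have -> : expR x * cos y - 1 - x = (expR x - 1 - x) + expR x * (cos y - 1) by ring.
  rewrite (le_trans (ler_normD _ _))// lerD// normrM (gtr0_norm p).
  by rewrite ler_pM// ltW.
have B : `|expR x * sin y - y| <= 4 * y ^+ 2 + 5 * (x ^+ 2 + y ^+ 2).
  have -> : expR x * sin y - y = expR x * (sin y - y) + (expR x - 1) * y by ring.
  rewrite (le_trans (ler_normD _ _))// lerD// normrM (gtr0_norm p).
  by rewrite ler_pM// ltW.
(* The two bounds add up to [9 x^2 + 13 y^2], which the constant 16 absorbs. *)
rewrite (le_trans (lerD A B))//.
have := sqr_ge0 x; have := sqr_ge0 y; nra.
Qed.

Lemma modc_subX (a b : R[i]) (M : R) n : modc a <= M -> modc b <= M ->
  modc (a ^+ n - b ^+ n) <= n%:R * modc (a - b) * M ^+ n.-1.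
Proof.
move=> aM bM; have M0 : 0 <= M by rewrite (le_trans (modc_ge0 a)).
elim: n => [|n IH]; first by rewrite subrr modc0 mul0r mul0r.
have -> : a ^+ n.+1 - b ^+ n.+1 = (a ^+ n - b ^+ n) * a + b ^+ n * (a - b).
  by rewrite !exprSr; ring.
rewrite (le_trans (modcD _ _))// !modcM modcX /=.
rewrite -natr1 mulrDl mul1r mulrDl lerD//.
  rewrite (le_trans (ler_pM (modc_ge0 _) (modc_ge0 _) IH aM))//.
  case: n {IH} => [|n]; first by rewrite !mul0r.
  by rewrite -!mulrA -exprSr.
by rewrite mulrC ler_wpM2l ?modc_ge0// lerXn2r ?nnegrE ?modc_ge0.
Qed.

(** With [h = z / (n + 1)], the powers of [cexp h] and of [1 + h] are compared by telescoping:
    [n + 1] differences of size [16 |h|^2], times powers of [exp |h|]. *)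
Lemma cexp_approx (z : R[i]) (n : nat) : modc z <= n.+1%:R ->
  modc (cexp z - (1 + z / n.+1%:R) ^+ n.+1) <=
  16 * modc z ^+ 2 * expR (modc z) / n.+1%:R.
Proof.
move=> zn; have n0 : n.+1%:R != 0 :> R[i] by rewrite pnatr_eq0.
have n0' : 0 < n.+1%:R :> R by [].
set h := z / n.+1%:R.
have hE : modc h = modc z / n.+1%:R by rewrite modcM modcV modc_nat.
have h1 : modc h <= 1 by rewrite hE ler_pdivrMr// mul1r.
have -> : cexp z = cexp h ^+ n.+1 by rewrite -cexpMn /h mulrCA divff// mulr1.
have M1 : modc (cexp h) <= expR (modc h).
  by rewrite modc_cexp ler_expR (le_trans (ler_norm _))// Re_le_modc.
have M2 : modc (1 + h) <= expR (modc h).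
  by rewrite (le_trans (modcD _ _))// modc1 expR_ge1Dx.
rewrite (le_trans (modc_subX n.+1 M1 M2))// -expRM_natl succnK.
have e1 : expR (n%:R * modc h) <= expR (modc z).
  by rewrite ler_expR hE mulrA ler_pdivrMr// mulrC ler_wpM2l ?modc_ge0// ler_nat.
have := cexpB1_le h1; rewrite opprD addrA => h2.
rewrite (le_trans (ler_pM _ _ (ler_wpM2l (ltW n0') h2) e1)) ?expR_ge0//.
  by rewrite mulr_ge0 ?modc_ge0.
rewrite hE exprMn exprVn.
have K (N x y : R) : N != 0 -> N * (16 * (x / N ^+ 2)) * y = 16 * x * y / N.
  by move=> N0; field.
by rewrite K// gt_eqF.
Qed.

Lemma analytic_cexp f : analytic_disk f -> analytic_disk (fun z => cexp (f z)).
Proof.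
move=> fa; apply: analytic_lim => r e r1 e0.
have [M M0 HM] := analytic_bounded fa r1.
pose K := 16 * M ^+ 2 * expR M.
have K0 : 0 <= K by rewrite !mulr_ge0 ?expR_ge0// exprn_ge0.
have eK : 0 < e / (K + 1) by rewrite divr_gt0// ltr_wpDl.
have [N1 HN1] := invn_small eK.
have M1 : 0 < (M + 1)^-1 by rewrite invr_gt0 ltr_wpDl.
have [N2 HN2] := invn_small M1.
pose n := maxn N1 N2.
exists (fun z => (1 + f z / n.+1%:R) ^+ n.+1).
  apply: analyticX; apply: analyticD; first exact: analytic_cst.
  exact: (analyticM fa (analytic_cst _)).
move=> z zr; have fM := HM _ zr.
have nM : M <= n.+1%:R.
  have := HN2 _ (leq_maxr N1 N2); rewrite lef_pV2 ?posrE ?ltr_wpDl// => h.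
  by rewrite (le_trans _ h)// lerDl.
rewrite (le_trans (cexp_approx (le_trans fM nM)))//.
apply: (@le_trans _ _ (K * (e / (K + 1)))).
  rewrite ler_pM ?mulr_ge0 ?expR_ge0 ?invr_ge0 ?exprn_ge0 ?modc_ge0//; last first.
    by rewrite HN1// leq_maxl.
  rewrite ler_pM ?mulr_ge0 ?expR_ge0 ?exprn_ge0 ?modc_ge0 ?ler_expR//.
  by rewrite ler_wpM2l// lerXn2r// nnegrE modc_ge0.
rewrite mulrCA ler_piMr ?(ltW e0)// ler_pdivrMr ?ltr_wpDl// mul1r lerDl//.
Qed.

End AnalyticClosure.

(** * The norm of [H2] through means on circles *)

Section HardyNorm.
Variable R : realType.
Implicit Types (f g : R[i] -> R[i]) (a : nat -> R[i]) (r : R).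

Definition circ f r (t : R) : R[i] := f (r%:C * ee t).

Lemma modc_circ r t : 0 <= r -> modc (r%:C * ee t) = r.
Proof. by move=> r0; rewrite modcM modc_ee mulr1 modc_real ger0_norm. Qed.

Lemma cmf_circ f r : analytic_disk f -> 0 <= r < 1 -> cmf (circ f r).
Proof.
move=> [a fa] /andP[r0 r1].
apply: (@cmf_cvg _ (fun n t => \sum_(k < n) a k * (r%:C * ee t) ^+ k)).
  move=> n; apply: cmf_sum => k; apply: cmfM; first exact: cmf_cst.
  by apply: cmfX; apply: cmfM; [exact: cmf_cst|exact: cmf_ee].
move=> t; have mt : modc (r%:C * ee t) < 1 by rewrite modc_circ.
apply: cvg_trans (fa _ mt); apply: near_eq_cvg; apply: nearW => n.
by rewrite /series /= big_mkord.
Qed.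

Lemma circ_bounded f r : analytic_disk f -> 0 <= r < 1 ->
  exists2 B, 0 <= B & forall t, modc (circ f r t) <= B.
Proof.
move=> fa /andP[r0 r1]; have [B B0 H] := analytic_bounded fa r1.
by exists B => // t; apply: H; rewrite modc_circ.
Qed.

Lemma itg_circ f r : analytic_disk f -> 0 <= r < 1 ->
  itg (fun t => modc (circ f r t) ^+ 2).
Proof.
move=> fa r01; have [B B0 H] := circ_bounded fa r01.
apply: (@itg_bd _ _ (B ^+ 2)); first by apply: mfun_sqr_modc; exact: cmf_circ.
by move=> t; rewrite normrX ger0_norm ?modc_ge0// lerXn2r ?nnegrE ?modc_ge0.
Qed.

(** The partial sums converge uniformly on the circle at rate [B q^n]. As [|f| <= B] and
    [|S n| <= 2 B] there, the squared moduli differ by at most [3 B^2 q^n]. *)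
Lemma parseval_cvg a f r : has_taylor a f -> 0 <= r < 1 ->
  \sum_(k < n) (modc (a k) * r ^+ k) ^+ 2 @[n --> \oo] -->
  II (fun t => modc (circ f r t) ^+ 2).
Proof.
move=> fa r01; have /andP[r0 r1] := r01.
have [B [q [B0 q01 H]]] := taylor_tail fa r01.
pose S n (t : R) : R[i] := \sum_(k < n) (a k * r%:C ^+ k) * ee t ^+ k.
have SE n t : \sum_(k < n) a k * (r%:C * ee t) ^+ k = S n t.
  by apply: eq_bigr => k _; rewrite exprMn mulrA.
have P n : \sum_(k < n) (modc (a k) * r ^+ k) ^+ 2 = II (fun t => modc (S n t) ^+ 2).
  rewrite (parseval n (fun k => a k * r%:C ^+ k)); apply: eq_bigr => k _.
  by rewrite modcM modcX modc_real ger0_norm.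
have close n t : modc (circ f r t - S n t) <= B * q ^+ n.
  by rewrite -SE; apply: H; rewrite modc_circ.
have fB t : modc (circ f r t) <= B.
  by have := H 0%N (r%:C * ee t); rewrite modc_circ// big_ord0 subr0 expr0 mulr1; exact.
have qn n : q ^+ n <= 1 by case/andP : q01 => q0 q1; rewrite exprn_ile1// ltW.
have qn0 n : 0 <= q ^+ n by case/andP : q01 => q0 _; rewrite exprn_ge0.
have SB n t : modc (S n t) <= 2 * B.
  rewrite (le_trans (modc_triangle _ (circ f r t)))// modc_distC.
  rewrite mulr2n mulrDl mul1r lerD// (le_trans (close _ _))// ler_piMr//.
have iS n : itg (fun t => modc (S n t) ^+ 2).
  apply: (@itg_bd _ _ ((2 * B) ^+ 2)).
    apply: mfun_sqr_modc; apply: cmf_sum => k; apply: cmfM; first exact: cmf_cst.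
    by apply: cmfX; exact: cmf_ee.
  move=> t; rewrite normrX ger0_norm ?modc_ge0// lerXn2r ?nnegrE ?modc_ge0//.
  by rewrite mulr_ge0.
have ifr : itg (fun t => modc (circ f r t) ^+ 2).
  by apply: itg_circ => //; exists a.
apply/cvgrPdist_le => e e0.
have [N HN] := expr_small (3 * B ^+ 2) q01 e0.
exists N => // n /= /HN hn; rewrite P -IIB// (le_trans (norm_II _))//; first exact: itgB.
rewrite -[leRHS]II_cst; apply: le_II; [exact/itg_norm/itgB|exact: itg_cst|].
move=> t; apply: le_trans hn.
have h1 := close n t; have h2 := fB t; have h3 := SB n t.
have h4 : `|modc (circ f r t) - modc (S n t)| <= B * q ^+ n.
  have := modc_triangle (circ f r t) (S n t).
  have := modc_triangle (S n t) (circ f r t); rewrite modc_distC => h5 h6.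
  by rewrite ler_norml; apply/andP; split; lra.
rewrite subr_sqr normrM (ger0_norm (addr_ge0 (modc_ge0 _) (modc_ge0 _))).
apply: (@le_trans _ _ (B * q ^+ n * (3 * B))).
  by rewrite ler_pM ?addr_ge0 ?modc_ge0//; lra.
by rewrite le_eqVlt; apply/orP; left; apply/eqP; ring.
Qed.

Lemma parseval_ge a f r n : has_taylor a f -> 0 <= r < 1 ->
  \sum_(k < n) (modc (a k) * r ^+ k) ^+ 2 <= II (fun t => modc (circ f r t) ^+ 2).
Proof.
move=> fa r01; apply: cvg_ge_cst (parseval_cvg fa r01) _.
exists n => // m /= nm; rewrite -!(big_mkord xpredT (fun k => (modc (a k) * r ^+ k) ^+ 2)).
by rewrite [leRHS](big_cat_nat (n := n))//= lerDl sumr_ge0// => k _; rewrite sqr_ge0.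
Qed.

Lemma h2_nsqE a f : has_taylor a f ->
  h2_nsq f = (\sum_(0 <= k <oo) ((modc (a k)) ^+ 2)%:E)%E.
Proof. by move=> fa; rewrite /h2_nsq (taylor_coefP fa). Qed.

Lemma h2_nsq_ge0 f : (0 <= h2_nsq f)%E.
Proof. by apply: nneseries_ge0 => k _ _; rewrite lee_fin sqr_ge0. Qed.

Lemma h2_partial a f n : has_taylor a f ->
  ((\sum_(k < n) modc (a k) ^+ 2)%:E <= h2_nsq f)%E.
Proof.
move=> fa; rewrite (h2_nsqE fa).
have := @nneseries_lim_ge R (fun k => (modc (a k) ^+ 2)%:E) xpredT 0 n.
rewrite big_mkord sumEFin; apply => k _ _.
by rewrite lee_fin sqr_ge0.
Qed.

Lemma h2_le_partial a f (M : \bar R) : has_taylor a f ->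
  (forall n, ((\sum_(k < n) modc (a k) ^+ 2)%:E <= M)%E) -> (h2_nsq f <= M)%E.
Proof.
move=> fa H; rewrite (h2_nsqE fa); apply: lime_le.
  by apply: is_cvg_nneseries => k _ _; rewrite lee_fin sqr_ge0.
by apply: nearW => n /=; rewrite big_mkord sumEFin.
Qed.

Lemma II_le_h2 f r : analytic_disk f -> 0 <= r < 1 ->
  ((II (fun t => modc (circ f r t) ^+ 2))%:E <= h2_nsq f)%E.
Proof.
move=> [a fa] r01; have := h2_nsq_ge0 f.
case hE : (h2_nsq f) => [s| |]//= _; last by rewrite leey.
rewrite lee_fin; apply: (cvg_le_cst (parseval_cvg fa r01)).
apply: nearW => n; rewrite -lee_fin -hE.
apply: le_trans (h2_partial n fa); rewrite lee_fin.
apply: ler_sum => k _; case/andP : r01 => r0 r1.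
rewrite lerXn2r ?nnegrE ?mulr_ge0 ?modc_ge0 ?exprn_ge0//.
by rewrite ler_piMr ?modc_ge0// exprn_ile1// ltW.
Qed.

(** With [II_le_h2] this identifies [h2_nsq f] with the supremum of the quadratic means on circles.
    A partial sum of length [n] loses at most a factor [r^(2 n)] on the circle of radius [r], and
    [le_from_scaled] removes it. *)
Lemma h2_le f (M : \bar R) : analytic_disk f ->
  (forall r, 0 <= r < 1 -> ((II (fun t => modc (circ f r t) ^+ 2))%:E <= M)%E) ->
  (h2_nsq f <= M)%E.
Proof.
move=> [a fa]; case: M => [M| |] H; [|by rewrite leey|]; last first.
  by have := H 0; rewrite lexx ltr01 => /(_ isT).
apply: (h2_le_partial fa) => n; rewrite lee_fin.
apply: (@le_from_scaled _ _ _ (2 * n)); first by apply: sumr_ge0 => k _; rewrite sqr_ge0.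
move=> r r01; have := H r r01; rewrite lee_fin; apply: le_trans.
apply: le_trans (parseval_ge n fa r01); rewrite mulr_suml.
apply: ler_sum => k _; rewrite exprMn -exprM mulnC ler_wpM2l ?sqr_ge0//.
case/andP : r01 => r0 r1; rewrite ler_wiXn2l// ?ltW//.
by rewrite leq_mul2r/= ltnW.
Qed.

Lemma h2_mono f g : analytic_disk f -> analytic_disk g ->
  (forall z, modc z < 1 -> modc (f z) <= modc (g z)) -> (h2_nsq f <= h2_nsq g)%E.
Proof.
move=> fa ga fg; apply: h2_le => // r r01; apply: le_trans (II_le_h2 ga r01).
rewrite lee_fin; apply: le_II; [exact: itg_circ|exact: itg_circ|].
move=> t; rewrite lerXn2r ?nnegrE ?modc_ge0// fg//.
by case/andP : r01 => r0 r1; rewrite modc_circ.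
Qed.

Lemma h2_bounded f (M : R) : analytic_disk f ->
  (forall z, modc z < 1 -> modc (f z) <= M) -> (h2_nsq f <= (M ^+ 2)%:E)%E.
Proof.
move=> fa fM; apply: h2_le => // r r01; rewrite lee_fin -[leRHS]II_cst.
have M0 : 0 <= M by rewrite (le_trans (modc_ge0 (f 0)))// fM// modc0.
apply: le_II; [exact: itg_circ|exact: itg_cst|].
move=> t; rewrite lerXn2r ?nnegrE ?modc_ge0// fM//.
by case/andP : r01 => r0 r1; rewrite modc_circ.
Qed.

Lemma H2_bounded f (M : R) : analytic_disk f ->
  (forall z, modc z < 1 -> modc (f z) <= M) -> H2 f.
Proof.
by move=> fa fM; split => //; rewrite (le_lt_trans (h2_bounded fa fM))// ltry.
Qed.

Lemma has_taylor0 a f : has_taylor a f -> a 0%N = f 0.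
Proof.
move=> fa; have m0 : modc (0 : R[i]) < 1 by rewrite modc0.
have /cvgc_lim <- := fa _ m0.
apply/esym/cvgc_lim; apply/cvgcP => e e0; exists 1%N => // n /=.
case: n => // n _; rewrite /series /= big_nat_recl//= expr0 mulr1 big1 ?addr0.
  by rewrite subrr modc0.
by move=> k _; rewrite expr0n /= mulr0.
Qed.

Lemma mean_value_sqr f r : analytic_disk f -> 0 <= r < 1 ->
  modc (f 0) ^+ 2 <= II (fun t => modc (circ f r t) ^+ 2).
Proof.
move=> [a fa] r01; rewrite -(has_taylor0 fa).
by have := parseval_ge 1 fa r01; rewrite big_ord1 expr0 mulr1.
Qed.

(** Cauchy-Schwarz between the coefficients and the powers of [u] beyond [n]: the reproducing kernel
    bound for a Taylor remainder. *)
Lemma H2_tail f n u : H2 f -> modc u < 1 ->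
  modc (f u - \sum_(k < n) taylor_coef f k * u ^+ k) ^+ 2 <=
  fine (h2_nsq f) * (modc u ^+ 2) ^+ n / (1 - modc u ^+ 2).
Proof.
move=> [fa fh] u1; set a := taylor_coef f; have ft : has_taylor a f by exact: analytic_taylor.
have hfin : h2_nsq f = (fine (h2_nsq f))%:E.
  by rewrite fineK// ge0_fin_numE// h2_nsq_ge0.
have u0 := modc_ge0 u.
have q01 : 0 <= modc u ^+ 2 < 1 by rewrite sqr_ge0 expr_lt1.
have q1 : 0 < 1 - modc u ^+ 2 by case/andP : q01 => _; rewrite subr_gt0.
have H := cvg_modc (f := fun m => \sum_(n <= k < m) a k * u ^+ k)
  (l := f u - \sum_(k < n) a k * u ^+ k).
apply: (@cvg_le_cst _ (fun m => modc (\sum_(n <= k < m) a k * u ^+ k) ^+ 2)).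
  have Hc : modc (\sum_(n <= k < m) a k * u ^+ k) @[m --> \oo] -->
      modc (f u - \sum_(k < n) a k * u ^+ k).
    apply: H; apply/cvgcP => e e0.
    have /cvgcP/(_ _ e0)[N _ HN] := ft _ u1.
    exists (maxn n N) => // m /=; rewrite geq_max => /andP[nm Nm].
    have := HN m Nm; rewrite /series /= (big_cat_nat (n := n) (p := m))//= big_mkord.
    by congr (modc _ < _); ring.
  under eq_cvg do rewrite expr2; rewrite expr2; exact: cvgM.
apply: nearW => m.
apply: (@le_trans _ _ ((\sum_(n <= k < m) modc (a k) * modc u ^+ k) ^+ 2)).
  rewrite lerXn2r ?nnegrE ?modc_ge0//.
    by apply: sumr_ge0 => k _; rewrite mulr_ge0 ?modc_ge0 ?exprn_ge0.
  rewrite (le_trans (modc_sum _ _ _))//; apply: ler_sum => k _.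
  by rewrite modcM modcX.
rewrite (le_trans (Cauchy_Schwarz _ _ _))//.
- by move=> k; exact: modc_ge0.
- by move=> k; rewrite exprn_ge0.
rewrite -mulrA ler_pM//.
- by apply: sumr_ge0 => k _; rewrite sqr_ge0.
- by apply: sumr_ge0 => k _; rewrite sqr_ge0.
- have := h2_partial m ft; rewrite hfin lee_fin; apply: le_trans.
  have [nm|mn] := leqP n m.
    rewrite -(big_mkord xpredT (fun k => modc (a k) ^+ 2)).
    rewrite [leRHS](big_cat_nat (n := n) (p := m))//=.
    by rewrite lerDr sumr_ge0// => k _; rewrite sqr_ge0.
  by rewrite big_geq ?sumr_ge0// 1?ltnW// => k _; rewrite sqr_ge0.
- under eq_bigr do rewrite -exprM mulnC exprM.
  exact: geo_le.
Qed.

(** Jensen's inequality says nothing when [w 0 = 0]; the zero at the origin is divided out, which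
    changes [|w|] on a circle only by a power of the radius. *)
Lemma factor_zero f : analytic_disk f -> nonzero_disk f ->
  exists k v, [/\ analytic_disk v, v 0 != 0 &
    forall z, modc z < 1 -> f z = z ^+ k * v z].
Proof.
move=> [a fa] [z0 [z01 fz0]].
have [k ak0 kmin] : exists2 k, a k != 0 & forall j, (j < k)%N -> a j = 0.
  have exk : exists k, a k != 0.
    apply/not_existsP => H; move/eqP : fz0; apply.
    have /cvgc_lim <- := fa _ z01; apply/cvgc_lim/cvgcP => e e0.
    exists 0%N => // n _ /=; rewrite /series /= big1 ?subrr ?modc0// => j _.
    by have /negP/negPn/eqP -> := H j; rewrite mul0r.
  exists (ex_minn exk); case: ex_minnP => // m am mm j jm.
  by apply/eqP; apply/negPn/negP => /mm; rewrite leqNgt jm.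
(* The value at 0 is the one that makes the quotient analytic, and it is nonzero by the choice of
   [k]. *)
pose v z := if z == 0 then a k else f z / z ^+ k.
have fv z : modc z < 1 -> f z = z ^+ k * v z.
  move=> z1; rewrite /v; case: eqVneq => [->|z0'].
    rewrite -(has_taylor0 fa) expr0n; case: k ak0 kmin {v} => [|k] ak0 kmin.
      by rewrite mul1r.
    by rewrite mul0r; exact: kmin.
  by rewrite mulrCA divff ?mulr1// expf_neq0.
exists k, v; split => //; last by rewrite /v eqxx.
exists (fun j => a (j + k)%N) => z z1.
have [->|zn0] := eqVneq z 0.
  rewrite /v eqxx; apply/cvgcP => e e0; exists 1%N => // n /=.
  case: n => // n _; rewrite /series /= big_nat_recl//= expr0 mulr1 big1 ?addr0.
    by rewrite add0n subrr modc0.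
  by move=> j _; rewrite expr0n /= mulr0.
have zk0 : z ^+ k != 0 by rewrite expf_neq0.
have mk0 : 0 < modc (z ^+ k) by rewrite modc_gt0.
apply/cvgcP => e e0; have e'0 : 0 < e * modc (z ^+ k) by rewrite mulr_gt0.
have /cvgcP/(_ _ e'0)[N _ HN] := fa _ z1.
exists N => // n /= Nn.
have := HN (n + k)%N (leq_trans Nn (leq_addr _ _)).
rewrite fv// => h; rewrite -(ltr_pM2r mk0) -modcM; move: h; congr (modc _ < _).
rewrite mulrBl (mulrC (v z)); congr (_ - _).
rewrite /series /= (@big_cat_nat _ _ _ k) ?leq_addl//=.
rewrite [X in X + _]big1_seq ?add0r; last first.
  by move=> j /andP[_]; rewrite mem_index_iota => /andP[_ /kmin ->]; rewrite mul0r.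
rewrite mulr_suml -{1}(add0n k) big_addn addnK.
by apply: eq_bigr => j _; rewrite exprD mulrA.
Qed.

End HardyNorm.

(** * Herglotz and Poisson kernels, outer functions, Harnack's inequality *)

Section Poisson.
Variable R : realType.
Implicit Types (z : R[i]) (t r : R) (g : R -> R) (f phi : R[i] -> R[i]).

(** The Herglotz kernel [(zeta + z) / (zeta - z)] at [zeta = ee t], since the inverse of [zeta] is
    its conjugate. Its real part [pois] is the Poisson kernel; its truncated expansion [hergn]
    reduces integrals to the orthogonality of the exponentials. *)
Definition herg z t : R[i] := (1 + z * conjc (ee t)) / (1 - z * conjc (ee t)).
Definition pois z t : R := Re (herg z t).
Definition hergn n z t : R[i] := 1 + 2 * \sum_(k < n) (z * conjc (ee t)) ^+ k.+1.

Lemma conjcX z n : conjc (z ^+ n) = conjc z ^+ n.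
Proof. exact: rmorphXn. Qed.

Lemma conjcM z w : conjc (z * w) = conjc z * conjc w.
Proof. exact: rmorphM. Qed.

Lemma modc_mulJee z t : modc (z * conjc (ee t)) = modc z.
Proof. by rewrite modcM modcJ modc_ee mulr1. Qed.

Lemma modc_1B z : 1 - modc z <= modc (1 - z).
Proof.
by rewrite lerBlDr -[leLHS]modc1 -{1}(subrK z 1); exact: modcD.
Qed.

Lemma one_sub_neq0 z : modc z < 1 -> 1 - z != 0.
Proof. by move=> z1; rewrite -modc_gt0 (lt_le_trans _ (modc_1B z))// subr_gt0. Qed.

Lemma herg_approx n z t : modc z < 1 ->
  modc (herg z t - hergn n z t) <= 2 / (1 - modc z) * modc z ^+ n.
Proof.
move=> z1; rewrite /herg /hergn; set s := z * _.
have sz : modc s = modc z by rewrite modc_mulJee.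
have s1 : 1 - s != 0 by rewrite one_sub_neq0// sz.
have G : (1 - s) * \sum_(k < n) s ^+ k.+1 = s - s ^+ n.+1.
  elim: n => [|n IH]; first by rewrite big_ord0 mulr0 expr1 subrr.
  by rewrite big_ord_recr /= mulrDr IH !exprS; ring.
have -> : (1 + s) / (1 - s) - (1 + 2 * \sum_(k < n) s ^+ k.+1) = 2 * s ^+ n.+1 / (1 - s).
  have -> : \sum_(k < n) s ^+ k.+1 = (s - s ^+ n.+1) / (1 - s) by rewrite -G mulrC mulKf.
  by field.
rewrite !modcM modcX modc_nat modcV sz exprS.
have m0 := modc_ge0 z; have m1 : 0 < 1 - modc z by rewrite subr_gt0.
rewrite -mulrA [leRHS]mulrAC -[leRHS]mulrA ler_wpM2l//.
rewrite ler_pM ?mulr_ge0 ?exprn_ge0 ?invr_ge0 ?modc_ge0//.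
  by rewrite ler_piMl ?exprn_ge0// ltW.
rewrite lef_pV2 ?posrE ?modc_gt0//.
by rewrite -sz modc_1B.
Qed.

Lemma herg_bounded z t : modc z < 1 -> modc (herg z t) <= 2 / (1 - modc z).
Proof.
move=> z1; rewrite /herg; set s := z * _.
have sz : modc s = modc z by rewrite modc_mulJee.
have m0 := modc_ge0 z; have m1 : 0 < 1 - modc z by rewrite subr_gt0.
rewrite modcM modcV ler_pM ?invr_ge0 ?modc_ge0//.
  by rewrite (le_trans (modcD _ _))// modc1 sz; lra.
rewrite lef_pV2 ?posrE// ?modc_gt0 ?one_sub_neq0 ?sz//.
by rewrite -sz modc_1B.
Qed.

Lemma cmf_herg z : modc z < 1 -> cmf (herg z).
Proof.
move=> z1; have m1 : 0 < 1 - modc z by rewrite subr_gt0.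
apply: (@cmf_cvg _ (fun n t => hergn n z t)).
  move=> n; apply: cmfD; first exact: cmf_cst.
  apply: cmfM; first exact: cmf_cst; apply: cmf_sum => k; apply: cmfX.
  by apply: cmfM; [exact: cmf_cst|apply: cmfJ; exact: cmf_ee].
move=> t; apply/cvgcP => e e0.
have q01 : 0 <= modc z < 1 by rewrite modc_ge0.
have e2 : 0 < e / 2 by rewrite divr_gt0.
have [N HN] := expr_small (2 / (1 - modc z)) q01 e2.
exists N => // n /= /HN hn; rewrite modc_distC.
rewrite (le_lt_trans (herg_approx n t z1))// (le_lt_trans hn)//.
by rewrite ltr_pdivrMr// ltr_pMr// ltr1n.
Qed.

Lemma poisE z t : modc z < 1 ->
  pois z t = (1 - modc z ^+ 2) / modc (1 - z * conjc (ee t)) ^+ 2.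
Proof.
move=> z1; rewrite /pois /herg -(modc_mulJee z t); set s := z * _.
have sz : modc s = modc z by rewrite modc_mulJee.
have s1 : 1 - s != 0 by rewrite one_sub_neq0// sz.
have D0 : modc (1 - s) ^+ 2 != 0 by rewrite expf_neq0// gt_eqF// modc_gt0.
have -> : (1 + s) / (1 - s) = ((modc (1 - s) ^+ 2)^-1)%:C * ((1 + s) * conjc (1 - s)).
  rewrite fmorphV /= -mulcJ invfM.
  have c0 : conjc (1 - s) != 0 by rewrite conjc_eq0.
  by rewrite mulrACA mulrC -!mulrA mulVf// mulr1 mulrC.
rewrite ReMr mulrC; congr (_ * _).
rewrite sqr_modc; case: s {sz s1 D0} => a b.
by simpc => /=; ring.
Qed.

Lemma pois_gt0 z t : modc z < 1 -> 0 < pois z t.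
Proof.
move=> z1; rewrite poisE// divr_gt0//.
  by rewrite subr_gt0 expr_lt1// modc_ge0.
by rewrite exprn_gt0// modc_gt0 one_sub_neq0// modc_mulJee.
Qed.

Lemma pois_le z t : modc z < 1 -> pois z t <= 2 / (1 - modc z).
Proof.
move=> z1; apply: le_trans (herg_bounded t z1).
exact: le_trans (ler_norm _) (Re_le_modc _).
Qed.

Lemma pois_ge z t : modc z < 1 -> (1 - modc z) / (1 + modc z) <= pois z t.
Proof.
move=> z1; have m0 := modc_ge0 z; have m1 : 0 < 1 - modc z by rewrite subr_gt0.
rewrite poisE// ler_pdivlMr; last first.
  by rewrite exprn_gt0// modc_gt0 one_sub_neq0// modc_mulJee.
have h : modc (1 - z * conjc (ee t)) <= 1 + modc z.
  by rewrite (le_trans (modcB _ _))// modc1 modc_mulJee.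
have h2 : modc (1 - z * conjc (ee t)) ^+ 2 <= (1 + modc z) ^+ 2.
  by rewrite lerXn2r ?nnegrE ?modc_ge0// addr_ge0.
have K0 : 0 <= (1 - modc z) / (1 + modc z) by rewrite divr_ge0 ?(ltW m1)// addr_ge0.
rewrite (le_trans (ler_wpM2l K0 h2))//.
rewrite expr2 mulrA divfK ?gt_eqF ?ltr_wpDr//.
by rewrite -subr_sqr expr1n.
Qed.

Lemma mfun_pois z : modc z < 1 -> mfun (pois z).
Proof. by move=> /cmf_herg[]. Qed.

Lemma pois_normE z t : modc z < 1 -> `|pois z t| = pois z t.
Proof. by move=> /(pois_gt0 t)/gtr0_norm. Qed.

Lemma itg_pois z : modc z < 1 -> itg (pois z).
Proof.
move=> z1; apply: (@itg_bd _ _ (2 / (1 - modc z))); first exact: mfun_pois.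
by move=> t; rewrite pois_normE// pois_le.
Qed.

Lemma itg_poisM z g : modc z < 1 -> itg g -> itg (fun t => pois z t * g t).
Proof.
move=> z1 gi; apply: (@itgM_bd _ _ _ (2 / (1 - modc z))) => //.
  exact: mfun_pois.
by move=> t; rewrite pois_normE// pois_le.
Qed.

Lemma citg_mulr (F : R -> R[i]) (B : R) g : cmf F -> (forall t, modc (F t) <= B) ->
  itg g -> citg (fun t => F t * (g t)%:C).
Proof.
move=> [F1 F2] FB gi; split.
- under eq_fun do rewrite mulrC ReMr mulrC.
  by apply: (itgM_bd F1 _ gi) => t; exact: le_trans (Re_le_modc _) (FB t).
- under eq_fun do rewrite mulrC ImMr mulrC.
  by apply: (itgM_bd F2 _ gi) => t; exact: le_trans (Im_le_modc _) (FB t).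
Qed.

(** An analytic function whose real part is the Poisson integral of [g]; the exponentials of its
    multiples are the outer functions used below. *)
Definition herglotz g z : R[i] := cI (fun t => herg z t * (g t)%:C).

Lemma citg_herg g z : itg g -> modc z < 1 -> citg (fun t => herg z t * (g t)%:C).
Proof.
move=> gi z1; apply: (citg_mulr (cmf_herg z1) _ gi) => t.
exact: herg_bounded.
Qed.

Lemma Re_herglotz g z : Re (herglotz g z) = II (fun t => pois z t * g t).
Proof.
by rewrite /herglotz Re_cI; apply: eq_II => t; rewrite mulrC ReMr mulrC.
Qed.

Lemma herglotz0 g : herglotz g 0 = (II g)%:C.
Proof.
rewrite /herglotz -cI_real; apply: eq_cI => t.
by rewrite /herg mul0r addr0 subr0 divr1 mul1r.
Qed.

(** With the truncated kernel the integral is a polynomial in [z], and the truncation error is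
    uniform on smaller disks. *)
Lemma analytic_herglotz g : itg g -> analytic_disk (herglotz g).
Proof.
move=> gi; apply: analytic_lim => r e r1 e0.
wlog r0 : r r1 / 0 <= r => [H|].
  have [/(H r r1)//|r0] := leP 0 r.
  have [h ha Hh] := H 0 ltr01 (lexx 0); exists h => // z zr.
  by apply: Hh; rewrite (le_trans zr)// ltW.
have G0 : 0 <= II (fun t => `|g t|) by exact: II_ge0.
have q01 : 0 <= r < 1 by rewrite r0.
have [N HN] := expr_small (2 / (1 - r) * II (fun t => `|g t|)) q01 e0.
pose c k := cI (fun t => conjc (ee t) ^+ k * (g t)%:C).
have ci k : citg (fun t => conjc (ee t) ^+ k * (g t)%:C).
  apply: (@citg_mulr _ 1) => // [|t]; first by apply: cmfX; apply: cmfJ; exact: cmf_ee.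
  by rewrite modcX modcJ modc_ee expr1n.
exists (fun z => c 0%N + \sum_(k < N) (2 * c k.+1) * z ^+ k.+1).
  apply: analyticD; first exact: analytic_cst.
  apply: analytic_sum => k; apply: analyticZ; apply: analyticX; exact: analytic_id.
move=> z zr; have z1 : modc z < 1 by rewrite (le_lt_trans zr).
have -> : c 0%N + \sum_(k < N) (2 * c k.+1) * z ^+ k.+1 =
    cI (fun t => hergn N z t * (g t)%:C).
  transitivity (cI (fun t => conjc (ee t) ^+ 0 * (g t)%:C +
      \sum_(k < N) (2 * z ^+ k.+1) * (conjc (ee t) ^+ k.+1 * (g t)%:C))).
    rewrite cID//; last by apply: citg_sum => k; apply: citgZ; exact: ci.
    congr (_ + _); rewrite cI_sum => [|k]; last by apply: citgZ; exact: ci.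
    by apply: eq_bigr => k _; rewrite cIZ//; rewrite /c; ring.
  apply: eq_cI => t; rewrite /hergn mulrDl expr0; congr (_ + _).
  rewrite mulr_sumr mulr_suml; apply: eq_bigr => k _.
  by rewrite exprMn; ring.
have hi : citg (fun t => hergn N z t * (g t)%:C).
  apply: (@citg_mulr _ (2 / (1 - modc z) + 2 / (1 - modc z))) => // [|t].
    apply: cmfD; first exact: cmf_cst.
    apply: cmfM; first exact: cmf_cst; apply: cmf_sum => k; apply: cmfX.
    by apply: cmfM; [exact: cmf_cst|apply: cmfJ; exact: cmf_ee].
  rewrite (le_trans (modc_triangle _ (herg z t)))// lerD ?herg_bounded// modc_distC.
  rewrite (le_trans (herg_approx N t z1))// ler_piMr ?divr_ge0 ?subr_ge0 ?(ltW z1)//.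
  by rewrite exprn_ile1 ?modc_ge0// ltW.
rewrite /herglotz -cIB//; last exact: citg_herg.
apply: le_trans (HN _ (leqnn _)); rewrite mulrAC -IIZ; last exact: itg_norm.
apply: modc_cI_le.
- by apply: (citgD (citg_herg gi z1)); have := citgZ (-1) hi; apply: eq_citg => t; rewrite mulN1r.
- by apply: itgZ; exact: itg_norm.
- move=> t; rewrite -mulrBl modcM modc_real ler_wpM2r//.
  rewrite (le_trans (herg_approx N t z1))// ler_pM ?exprn_ge0 ?modc_ge0//.
  + by rewrite divr_ge0// subr_ge0 ltW.
  + by rewrite ler_pM2l// lef_pV2 ?posrE ?subr_gt0// lerD2l lerN2.
  + by rewrite lerXn2r ?nnegrE ?modc_ge0.
Qed.

(** The real part of the truncated kernel is 1 plus the powers of [z * conjc (ee t)] and their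
    conjugates; orthogonality keeps one of these terms, present because [k <= n]. *)
Lemma cI_hergn_ee n k z : (k <= n)%N ->
  cI (fun t => (Re (hergn n z t))%:C * ee t ^+ k) = z ^+ k.
Proof.
move=> kn.
have E t : (Re (hergn n z t))%:C * ee t ^+ k = ee t ^+ k +
    \sum_(j < n) (z ^+ j.+1 * (ee t ^+ k * conjc (ee t ^+ j.+1)) +
                  conjc z ^+ j.+1 * (ee t ^+ (j.+1 + k))).
  have -> : (Re (hergn n z t))%:C = 1 + \sum_(j < n) ((z * conjc (ee t)) ^+ j.+1 +
       conjc ((z * conjc (ee t)) ^+ j.+1)).
    rewrite ReJ_add /hergn rmorphD rmorphM rmorph1 rmorph_nat rmorph_sum.
    rewrite big_split /=; set A := \sum_(i < n) _; set B := \sum_(i < n) _.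
    by field.
  rewrite mulrDl mul1r mulr_suml; congr (_ + _); apply: eq_bigr => j _.
  rewrite mulrDl; congr (_ + _).
    by rewrite exprMn conjcX; ring.
  by rewrite exprMn conjcM !conjcX conjcK exprD mulrA.
rewrite (eq_cI E).
have i1 m : citg (fun t => ee t ^+ m).
  apply: (@citg_bd _ _ 1); first by apply: cmfX; exact: cmf_ee.
  by move=> t; rewrite modcX modc_ee expr1n.
have i2 j : citg (fun t => z ^+ j.+1 * (ee t ^+ k * conjc (ee t ^+ j.+1))).
  exact: citg_eeX.
have i3 j : citg (fun t => conjc z ^+ j.+1 * (ee t ^+ (j.+1 + k))).
  by apply: citgZ; exact: i1.
rewrite cID//; last by apply: citg_sum => j; exact: citgD.
rewrite cI_sum => [|j]; last exact: citgD.
have T (j : nat) : cI (fun t => z ^+ j.+1 * (ee t ^+ k * conjc (ee t ^+ j.+1)) +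
     conjc z ^+ j.+1 * (ee t ^+ (j.+1 + k))) = z ^+ j.+1 * (k == j.+1)%:R.
  rewrite cID// cIZ; last by apply: eq_citg (citg_eeX 1 k j.+1) => t; rewrite mul1r.
  by rewrite cIZ// cI_eeXJ cI_eeX addSn mulr0 addr0.
rewrite (eq_bigr (fun j : 'I_n => z ^+ j.+1 * (k == j.+1)%:R)) => [|j _]; last exact: T.
rewrite cI_eeX.
case: k kn {E i2 i3 T} => [_|k kn].
  by rewrite expr0 big1 ?addr0// => j _; rewrite mulr0.
rewrite add0r (bigD1 (Ordinal kn))//= eqxx mulr1 big1 ?addr0// => j jk.
have -> : (k.+1 == j.+1) = false; last by rewrite mulr0.
apply/negbTE; rewrite eqSS; apply: contra jk => /eqP kj.
by apply/eqP/val_inj; rewrite /= kj.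
Qed.

Lemma cI_pois_ee k z : modc z < 1 ->
  cI (fun t => (pois z t)%:C * ee t ^+ k) = z ^+ k.
Proof.
move=> z1; apply/eqP; rewrite -subr_eq0 -modc_eq0 eq_le modc_ge0 andbT.
apply/ler_addgt0Pr => e e0; rewrite add0r.
have q01 : 0 <= modc z < 1 by rewrite modc_ge0.
have [N HN] := expr_small (2 / (1 - modc z)) q01 e0.
pose n := maxn N k; rewrite -(@cI_hergn_ee n k z) ?leq_maxr//.
have m1 : mfun (fun t => Re (hergn n z t)).
  suff [] : cmf (hergn n z) by [].
  apply: cmfD; first exact: cmf_cst.
  apply: cmfM; first exact: cmf_cst; apply: cmf_sum => j; apply: cmfX.
  by apply: cmfM; [exact: cmf_cst|apply: cmfJ; exact: cmf_ee].
have close t : `|pois z t - Re (hergn n z t)| <= e.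
  rewrite /pois -ReN -ReD (le_trans (Re_le_modc _))// (le_trans (herg_approx n t z1))//.
  by apply: HN; exact: leq_maxl.
have i1 : citg (fun t => (pois z t)%:C * ee t ^+ k).
  apply: (@citg_bd _ _ (2 / (1 - modc z))).
    by apply: cmfM; [apply: cmf_real; exact: mfun_pois|apply: cmfX; exact: cmf_ee].
  by move=> t; rewrite modcM modc_real modcX modc_ee expr1n mulr1 pois_normE// pois_le.
have i2 : citg (fun t => (Re (hergn n z t))%:C * ee t ^+ k).
  apply: (@citg_bd _ _ (2 / (1 - modc z) + e)).
    by apply: cmfM; [exact: cmf_real|apply: cmfX; exact: cmf_ee].
  move=> t; rewrite modcM modc_real modcX modc_ee expr1n mulr1.
  rewrite -[X in `|X|](subrK (pois z t)) addrC (le_trans (ler_normD _ _))//.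
  by rewrite lerD//; [rewrite pois_normE// pois_le|rewrite distrC].
rewrite -cIB//; apply: modc_cI_le_cst.
  by apply: (citgD i1); have := citgZ (-1) i2; apply: eq_citg => t; rewrite mulN1r.
move=> t; rewrite -mulrBl modcM modcX modc_ee expr1n mulr1 -rmorphB modc_real.
exact: close.
Qed.

Lemma II_pois z : modc z < 1 -> II (pois z) = 1.
Proof.
move=> z1; apply: complexI; rewrite -cI_real -[RHS](cI_pois_ee 0 z1).
by apply: eq_cI => t; rewrite expr0 mulr1.
Qed.

Lemma citg_pois (F : R -> R[i]) z (B : R) : modc z < 1 -> cmf F ->
  (forall t, modc (F t) <= B) -> citg (fun t => (pois z t)%:C * F t).
Proof.
move=> z1 mF FB; apply: (@citg_bd _ _ (2 / (1 - modc z) * B)).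
  by apply: cmfM => //; apply: cmf_real; exact: mfun_pois.
move=> t; rewrite modcM modc_real pois_normE// ler_pM ?modc_ge0 ?pois_le//.
by rewrite ltW// pois_gt0.
Qed.

Lemma poisson_formula f (rho : R) z : analytic_disk f -> 0 <= rho < 1 ->
  modc z < 1 -> f (rho%:C * z) = cI (fun t => (pois z t)%:C * circ f rho t).
Proof.
move=> fa r01 z1; have /andP[r0 r1] := r01; have [a ft] := fa.
have [B [q [B0 q01 H]]] := taylor_tail ft r01.
have mz : modc (rho%:C * z) <= rho.
  by rewrite modcM modc_real ger0_norm// ler_piMr// ltW.
apply/eqP; rewrite -subr_eq0 -modc_eq0 eq_le modc_ge0 andbT.
apply/ler_addgt0Pr => e e0; rewrite add0r.
have c0 : 0 <= 2 / (1 - modc z) by rewrite divr_ge0// subr_ge0 ltW.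
(* [f] is replaced by a Taylor polynomial twice: at the point itself, at cost 1, and under the
   integral, at the cost of the bound of the kernel. *)
pose K := 1 + 2 / (1 - modc z); have K0 : 0 < K by rewrite ltr_wpDr.
have eK : 0 < e / K by rewrite divr_gt0.
have [N HN] := expr_small B q01 eK.
have {}HN := HN _ (leqnn N).
pose S t := \sum_(k < N) a k * (rho%:C * ee t) ^+ k.
have close t : modc (circ f rho t - S t) <= e / K.
  by apply: le_trans HN; apply: H; rewrite modc_circ.
have [C C0 fC] := circ_bounded fa r01.
have mS : cmf S.
  apply: cmf_sum => k; apply: cmfM; first exact: cmf_cst.
  by apply: cmfX; apply: cmfM; [exact: cmf_cst|exact: cmf_ee].
have SB t : modc (S t) <= C + e / K.
  by rewrite (le_trans (modc_triangle _ (circ f rho t)))// lerD// modc_distC.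
have i1 := citg_pois z1 (cmf_circ fa r01) fC.
have i2 := citg_pois z1 mS SB.
have SE : cI (fun t => (pois z t)%:C * S t) = \sum_(k < N) a k * (rho%:C * z) ^+ k.
  transitivity (cI (fun t => \sum_(k < N) (a k * rho%:C ^+ k) * ((pois z t)%:C * ee t ^+ k))).
    apply: eq_cI => t; rewrite /S mulr_sumr; apply: eq_bigr => k _.
    by rewrite exprMn; ring.
  have ik k : citg (fun t => (pois z t)%:C * ee t ^+ k).
    apply: (@citg_pois _ _ 1 z1); first by apply: cmfX; exact: cmf_ee.
    by move=> t; rewrite modcX modc_ee expr1n.
  rewrite cI_sum => [|k]; last exact: citgZ.
  by apply: eq_bigr => k _; rewrite cIZ// cI_pois_ee// exprMn mulrA.
have -> : f (rho%:C * z) - cI (fun t => (pois z t)%:C * circ f rho t) =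
    (f (rho%:C * z) - \sum_(k < N) a k * (rho%:C * z) ^+ k) -
    cI (fun t => (pois z t)%:C * circ f rho t - (pois z t)%:C * S t).
  by rewrite cIB// SE; ring.
have -> : e = e / K + 2 / (1 - modc z) * (e / K).
  have -> : e / K + 2 / (1 - modc z) * (e / K) = K * (e / K) by rewrite /K; ring.
  by rewrite mulrCA divff ?mulr1// gt_eqF.
rewrite (le_trans (modcB _ _))// lerD//; first by apply: le_trans HN; exact: H.
apply: modc_cI_le_cst.
  by apply: (citgD i1); have := citgZ (-1) i2; apply: eq_citg => t; rewrite mulN1r.
move=> t; rewrite -mulrBr modcM modc_real pois_normE//.
by rewrite ler_pM ?modc_ge0 ?pois_le//; rewrite ltW// pois_gt0.
Qed.

(* Harnack's inequality for 1 - Re (c phi), |c| = 1. *)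
Lemma selfmap_compact phi r : analytic_selfmap phi -> r < 1 ->
  exists2 s : R, s < 1 & forall z, modc z <= r -> modc (phi z) <= s.
Proof.
move=> [pa p1]; wlog r0 : r / 0 <= r => [H|] r1.
  have [r0|r0] := leP 0 r; first exact: H.
  have [s s1 Hs] := H 0 (lexx 0) ltr01; exists s => // z zr.
  by apply: Hs; rewrite (le_trans zr)// ltW.
pose rho := (1 + r) / 2.
have rho1 : rho < 1 by rewrite ltr_pdivrMr// mul1r; lra.
have rho0 : 0 < rho by rewrite divr_gt0// ltr_wpDr.
have rrho : r < rho by rewrite ltr_pdivlMr//; lra.
have rho01 : 0 <= rho < 1 by rewrite ltW.
pose r' := r / rho; have /andP[r'0 r'1] : 0 <= r' < 1 by exact: div01.
(* The first factor bounds the mean of [u] from below, the second the Poisson kernel at points of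
   modulus at most [r']. *)
pose d := (1 - modc (phi 0)) * ((1 - r') / (1 + r')).
have p0 : modc (phi 0) < 1 by apply: p1; rewrite modc0.
have d0 : 0 < d by rewrite mulr_gt0 ?subr_gt0// divr_gt0 ?subr_gt0 ?ltr_wpDr.
exists (1 - d); first by rewrite ltrBlDr ltrDl.
move=> z' zr'.
pose z := z' / rho%:C.
have rC0 : rho%:C != 0 by rewrite -modc_gt0 modc_real normr_gt0 gt_eqF.
have z'E : z' = rho%:C * z by rewrite /z mulrCA divff ?mulr1.
have zr : modc z <= r'.
  rewrite /z modcM modcV modc_real gtr0_norm// ler_wpM2r// invr_ge0 ltW//.
have z1 : modc z < 1 by rewrite (le_lt_trans zr).
rewrite z'E.
have [->|w0] := eqVneq (phi (rho%:C * z)) 0.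
  rewrite modc0 subr_ge0 /d mulr_ile1 ?subr_ge0 ?(ltW p0) ?divr_ge0 ?subr_ge0 ?(ltW r'1) ?addr_ge0//.
    by rewrite lerBlDr lerDl modc_ge0.
  by rewrite ler_pdivrMr ?ltr_wpDr// mul1r; lra.
(* This rotation makes the value at the given point a nonnegative real; it depends on the point, but
   [d] does not. *)
pose c := conjc (phi (rho%:C * z)) / (modc (phi (rho%:C * z)))%:C.
have m0 : (modc (phi (rho%:C * z)))%:C != 0.
  by rewrite -modc_gt0 modc_real normr_gt0 modc_eq0.
have c1 : modc c = 1.
  by rewrite modcM modcV modcJ modc_real ger0_norm ?modc_ge0// divff// modc_eq0.
have cE : c * phi (rho%:C * z) = (modc (phi (rho%:C * z)))%:C.
  by rewrite /c mulrAC (mulrC (conjc _)) mulcJ rmorphXn expr2 -mulrA divff// mulr1.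
pose u t := 1 - Re (c * circ phi rho t).
have pc t : modc (circ phi rho t) <= 1.
  by rewrite ltW// p1// modc_circ// ltW.
have mc := cmf_circ pa rho01.
have mcc : cmf (fun t => c * circ phi rho t) by apply: cmfM => //; exact: cmf_cst.
have u0 t : 0 <= u t.
  rewrite /u subr_ge0 (le_trans (ler_norm _))// (le_trans (Re_le_modc _))//.
  by rewrite modcM c1 mul1r.
have ic w : modc w < 1 -> citg (fun t => (pois w t)%:C * circ phi rho t).
  by move=> w1; exact: citg_pois w1 mc pc.
have icc : itg (fun t => Re (c * circ phi rho t)).
  by apply: (@citg_bd _ _ 1 mcc _).1 => t; rewrite modcM c1 mul1r.
have iu : itg u by apply: itgB => //; exact: itg_cst.
have PE w : modc w < 1 -> II (fun t => pois w t * u t) = 1 - Re (c * phi (rho%:C * w)).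
  move=> w1; rewrite (poisson_formula pa rho01 w1) -cIZ; last exact: ic.
  rewrite Re_cI -(II_pois w1) -IIB; [|exact: itg_pois|exact: (citgZ c (ic w w1)).1].
  apply: eq_II => t; rewrite /u mulrBr mulr1; congr (_ - _).
  by rewrite mulrCA ReMr.
have L : (1 - r') / (1 + r') * II u <= II (fun t => pois z t * u t).
  rewrite -IIZ//; apply: le_II; [exact: itgZ|exact: itg_poisM|] => t.
  rewrite ler_wpM2r// (le_trans _ (pois_ge t z1))//.
  have mz := modc_ge0 z.
  rewrite ler_pM ?subr_ge0 ?invr_ge0 ?addr_ge0 ?(ltW r'1)//; first by lra.
  by rewrite lef_pV2 ?posrE ?ltr_wpDr//; lra.
have I0 : 1 - modc (phi 0) <= II u.
  have -> : II u = 1 - Re (c * phi (rho%:C * 0)).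
    rewrite -PE ?modc0//; apply: eq_II => t.
    by rewrite /pois /herg mul0r addr0 subr0 divr1 mul1r.
  rewrite mulr0 lerD2l lerN2 (le_trans (ler_norm _))// (le_trans (Re_le_modc _))//.
  by rewrite modcM c1 mul1r.
move: L; rewrite PE// cE /= => L.
have : d <= (1 - r') / (1 + r') * II u.
  rewrite /d mulrC ler_wpM2l// divr_ge0 ?subr_ge0 ?addr_ge0 ?(ltW r'1)//.
by move: L; move: (_ * II u) => X; lra.
Qed.

End Poisson.

(** * Radial limits of Poisson integrals at Lebesgue points *)

Section Fatou.
Variable R : realType.
Implicit Types (b : R -> R) (t s h : R).
Local Notation mu := (@lebesgue_measure R).
Local Notation D := (`[0%R, 1%R]%classic : set R).

(** With [y = x / 2], [sin x = 2 sin y cos y >= 2 y (cos y)^2 >= y], because [cos x >= 0] means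
    [2 (cos y)^2 >= 1]. *)
Lemma sin_ge_half (x : R) : 0 <= x <= pi / 2 -> x / 2 <= sin x.
Proof.
move=> /andP[x0 xp]; pose y := x / 2.
have y0 : 0 <= y by rewrite divr_ge0.
have yp : y <= pi / 2 / 2 by rewrite ler_pM2r ?invr_gt0.
have pp : 0 < pi :> R by exact: pi_gt0.
have cmono c : 0 <= c <= y -> cos y <= cos c.
  move=> /andP[c0 cy]; rewrite leNgt; apply/negP => h.
  have [|d /[!in_itv]/= /andP[d0 dy]] := @MVT_segment R cos (fun x => - sin x) c y cy.
    by apply: continuous_subspaceT; exact: continuous_cos.
  move=> E; have : sin d < 0.
    rewrite ltNge; apply/negP => sd; move: h; rewrite -subr_lt0 -opprB oppr_lt0 E ltNge.
    by rewrite mulNr oppr_le0 mulr_ge0// subr_ge0.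
  rewrite ltNge sin_ge0_pi// (le_trans c0 d0) /=.
  by rewrite (le_trans dy)// (le_trans yp)//; lra.
have sy : y * cos y <= sin y.
  have [|c /[!in_itv]/= c0y] := @MVT_segment R sin cos 0 y y0.
    by apply: continuous_subspaceT; exact: continuous_sin.
  rewrite sin0 !subr0 => ->; rewrite mulrC ler_wpM2r//; exact: cmono.
have c0 : 0 <= cos y.
  by apply: cos_ge0_pihalf; apply/andP; split; lra.
have c2 : 1 <= 2 * cos y ^+ 2.
  have E : cos x = cos y ^+ 2 *+ 2 - 1.
    by rewrite -cos_mulr2n -mulr_natr /y divfK ?pnatr_eq0.
  have : 0 <= cos x by apply: cos_ge0_pihalf; apply/andP; split; lra.
  by rewrite E mulr2n; lra.
have -> : sin x = 2 * (sin y * cos y).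
  by rewrite [in LHS](_ : x = y + y) ?sinD; [ring|rewrite /y -splitr].
have -> : x / 2 = y by [].
have := ler_wpM2r c0 sy; have := ler_wpM2l y0 c2; nra.
Qed.

(** For [t] and [s] in [[0, 1]] the difference [x = t - s] may approach 1 or -1, where [sin (pi x)]
    vanishes again; the factor [1 - |x|] accounts for that. *)
Lemma sin_pi_ge (x : R) : `|x| <= 1 -> (`|x| * (1 - `|x|)) <= `|sin (pi * x)|.
Proof.
wlog x0 : x / 0 <= x => [H|].
  have [/H//|x0] := leP 0 x; rewrite -normrN => x1.
  by rewrite -[X in _ <= X]normrN -sinN -mulrN; apply: H => //; rewrite oppr_ge0 ltW.
rewrite (ger0_norm x0) => x1.
have p2 : 2 <= pi :> R by exact: pi_ge2.
have K (y : R) : 0 <= y -> y <= 2^-1 -> y <= sin (pi * y).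
  move=> y0 y1.
  have : 0 <= pi * y <= pi / 2.
    by rewrite mulr_ge0 ?pi_ge0//= ler_pM2l ?pi_gt0.
  by move=> /sin_ge_half; apply: le_trans; nra.
rewrite (le_trans _ (ler_norm _))//.
have [h|h] := leP x 2^-1; first by have := K x x0 h; nra.
have -> : sin (pi * x) = sin (pi * (1 - x)).
  by rewrite mulrBr mulr1 -[in RHS]opprB sinN sinB cospi sinpi; ring.
have := K (1 - x); nra.
Qed.

Lemma modc_1B_ee (r x : R) :
  modc (1 - r%:C * ee x) ^+ 2 = (1 - r) ^+ 2 + 4 * r * sin (pi * x) ^+ 2.
Proof.
have c : cos (2 * pi * x) = 1 - 2 * sin (pi * x) ^+ 2.
  have -> : cos (2 * pi * x) = cos (pi * x) ^+ 2 *+ 2 - 1.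
    by rewrite -cos_mulr2n; congr cos; rewrite -[RHS]mulr_natl mulrA.
  by have := cos2Dsin2 (pi * x); rewrite mulr2n; lra.
have h : sin (2 * pi * x) ^+ 2 = 1 - (1 - 2 * sin (pi * x) ^+ 2) ^+ 2.
  by have := cos2Dsin2 (2 * pi * x); rewrite c; lra.
rewrite sqr_modc !ReD !ImD !ReN !ImN ReMr ImMr /= c.
by rewrite add0r sqrrN exprMn h; ring.
Qed.

Lemma eeB t s : ee t * conjc (ee s) = ee (t - s).
Proof. by rewrite /ee conj_expi -expiD; congr expi; ring. Qed.

Lemma pois_radial (r t s : R) : 0 <= r < 1 ->
  pois (r%:C * ee t) s = (1 - r ^+ 2) / ((1 - r) ^+ 2 + 4 * r * sin (pi * (t - s)) ^+ 2).
Proof.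
move=> /andP[r0 r1]; rewrite poisE ?modc_circ//.
by rewrite -mulrA eeB modc_1B_ee.
Qed.

(** The height of the peak and the quadratic decay away from it. The distance [d] keeps [t - s] off
    1 and -1, where the kernel peaks again by periodicity. *)
Lemma pois_radial_le (r t s d : R) : 2^-1 <= r < 1 -> 0 < d ->
  `|t - s| <= 1 - d ->
  pois (r%:C * ee t) s <= 2 / (1 - r) /\
  pois (r%:C * ee t) s * (d * `|t - s|) ^+ 2 <= 1 - r.
Proof.
move=> /andP[r0 r1] d0 xd.
have r00 : 0 <= r by rewrite (le_trans _ r0)// invr_ge0.
have r01 : 0 <= r < 1 by rewrite r00.
split; first by have := @pois_le R (r%:C * ee t) s; rewrite modc_circ//; exact.
set x := t - s in xd *.
have h1 : 0 < 1 - r by rewrite subr_gt0.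
have x0 := normr_ge0 x.
have S : (d * `|x|) ^+ 2 <= sin (pi * x) ^+ 2.
  rewrite -[X in _ <= X](real_normK (num_real _)) lerXn2r ?nnegrE ?mulr_ge0 ?(ltW d0)//.
  rewrite (le_trans _ (@sin_pi_ge x _))//; last by lra.
  by rewrite mulrC ler_wpM2l//; lra.
have Q0 : 0 <= (d * `|x|) ^+ 2 by rewrite sqr_ge0.
move: S Q0; rewrite pois_radial// -/x; move: (sin _ ^+ 2) (_ ^+ 2) => S Q QS Q0.
have D0 : 0 < (1 - r) ^+ 2 + 4 * r * S.
  by rewrite ltr_wpDr ?exprn_gt0// !mulr_ge0// (le_trans Q0).
rewrite mulrAC ler_pdivrMr//.
have a1 : r * Q <= r * S by rewrite ler_wpM2l.
have a2 : 0 <= (1 - r) ^+ 2 by rewrite sqr_ge0.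
have a3 : (1 + r) * Q <= (1 - r) ^+ 2 + 4 * r * S by nra.
have -> : (1 - r ^+ 2) * Q = (1 - r) * ((1 + r) * Q) by ring.
by rewrite ler_pM2l.
Qed.

Lemma mfun_dist_lt t h : mfun (fun s => (`|t - s| < h)%R%:R : R).
Proof.
rewrite (_ : (fun s => _) = \1_(ball t h)); last first.
  apply/funext => s; rewrite indicE.
  have [h1|h1] := boolP (`|t - s| < h); first by rewrite mem_set.
  by rewrite memNset//; apply/negP.
apply: measurable_indic; exact: (@measurable_ball R t h).
Qed.

(** The Lebesgue point property as a bound on the oscillation over intervals contained in [[0, 1]],
    the form that the dyadic decomposition of the kernel consumes. *)
Lemma lebesgue_pt_II b t (e : R) : mfun b -> itg b -> 0 < t < 1 ->
  lebesgue_pt (b \_ D) t -> 0 < e ->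
  exists2 d, 0 < d & forall h, 0 < h <= d ->
    II (fun s => (`|t - s| < h)%R%:R * `|b s - b t|) <= 2 * h * e.
Proof.
move=> mb ib /andP[t0 t1] /fine_cvgP[[d1 /= d10 fin] /cvgrPdist_lt/(_ _)] H e0.
have [d2 /= d20 {}H] := H _ e0.
pose d := Num.min (Num.min d1 d2) (Num.min t (1 - t)) / 2.
have m0 : 0 < Num.min (Num.min d1 d2) (Num.min t (1 - t)).
  by rewrite !lt_min d10 d20 t0 subr_gt0 t1.
have d0 : 0 < d by rewrite divr_gt0.
exists d => // h /andP[h0 hd].
have [hd1 hd2 ht h1t] : [/\ h < d1, h < d2, h < t & h < 1 - t].
  have : h < Num.min (Num.min d1 d2) (Num.min t (1 - t)).
    by rewrite (le_lt_trans hd)// ltr_pdivrMr// ltr_pMr// ltr1n.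
  by rewrite !lt_min => /andP[/andP[? ?] /andP[? ?]].
have bD s : ball t h s -> D s.
  rewrite /ball /= in_itv/= ltr_norml => /andP[? ?]; apply/andP; split; lra.
have Dt : D t by rewrite /= in_itv/= !ltW.
have hh (x : R) : h < x -> ball_ [eta Num.Def.normr] 0 x h.
  by move=> hx; rewrite /ball_ /= sub0r normrN gtr0_norm.
have F := fin h (hh _ hd1) h0; have G := H h (hh _ hd2) h0.
have : (davg (b \_ D) t h <= e%:E)%E.
  rewrite -(fineK F) lee_fin; move: G; rewrite /= sub0r normrN => G.
  by rewrite (le_trans (ler_norm _))// ltW.
rewrite /davg /iavg (lebesgue_measure_ball _ (ltW h0)) inver mulrn_eq0 /= (gt_eqF h0).
rewrite lee_pdivrMl ?mulrn_wgt0// -EFinM.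
have -> : h *+ 2 * e = 2 * h * e by rewrite -mulr_natl; ring.
rewrite -lee_fin; apply: le_trans.
have mI := mfun_dist_lt t h.
rewrite EFin_II; last first.
  apply: (@itgM_bd _ _ _ 1 mI) => [s|].
    by rewrite ger0_norm ?ler0n// lern1; case: (_ < _).
  by apply: itg_norm; apply: itgB => //; exact: itg_cst.
have -> : (\int[mu]_(s in D) ((`|t - s| < h)%R%:R * `|b s - b t|)%:E =
   \int[mu]_(s in D) (((fun s => `|b s - b t|%:E) \_ (ball t h)) s))%E.
  apply: eq_integral => s _; rewrite patchE; case: ifPn => [|].
    by rewrite inE /ball /= => ->; rewrite mul1r.
  by rewrite notin_setE /ball /= => /negP/negbTE ->; rewrite mul0r.
rewrite -(@integral_mkcondr _ (measurableTypeR R) _ mu).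
rewrite (_ : D `&` ball t h = ball t h); last first.
  by apply/seteqP; split => s /= => [[]//|]; split => //; exact: bD.
rewrite le_eqVlt; apply/orP; left; apply/eqP; apply: eq_integral => s.
rewrite inE => /bD Ds; rewrite /= /shift /= !patchE !mem_set//.
Qed.

Lemma dyadic_index (eta d : R) : 0 < eta <= d ->
  exists J : nat, eta * 2 ^+ J <= d /\ d < 2 * (eta * 2 ^+ J).
Proof.
move=> /andP[e0 ed].
have exn : exists n, d < eta * 2 ^+ n.
  have q01 : (0 <= 2^-1 :> R) && (2^-1 < 1 :> R) by rewrite invr_ge0 ler0n invf_lt1// ltr1n.
  have e2 : 0 < eta / 2 by rewrite divr_gt0.
  have [N HN] := expr_small d q01 e2; exists N.
  have := HN _ (leqnn _); rewrite exprVn ler_pdivrMr ?exprn_gt0// => h.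
  rewrite (le_lt_trans h)// ltr_pM2r ?exprn_gt0//.
  by rewrite ltr_pdivrMr// ltr_pMr// ltr1n.
case: (ex_minnP exn) => -[|n] Hn min; first by move: Hn; rewrite expr0 mulr1 ltNge ed.
exists n; split; last by rewrite mulrCA -exprS.
by rewrite leNgt; apply/negP => /min; rewrite ltnn.
Qed.

(** With [eta = 1 - r], the kernel is at most a multiple of [4^-j / eta] on the shell between
    [eta 2^(j-1)] and [eta 2^j]; the factor 4 in the constant pays for the inner radius being half
    the outer one. The last term covers what lies beyond [eta 2^J]. *)
Lemma pois_dyadic (r t s d : R) (J : nat) : 2^-1 <= r < 1 -> 0 < d <= 2^-1 ->
  `|t - s| <= 1 - d ->
  pois (r%:C * ee t) s <=
  \sum_(j < J.+1) 4 / (d ^+ 2 * (1 - r)) * 4^-1 ^+ j *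
                  (`|t - s| < (1 - r) * 2 ^+ j)%R%:R
  + (1 - r) / (d * ((1 - r) * 2 ^+ J)) ^+ 2.
Proof.
move=> r1 /andP[d0 d1] xd; have [P1 P2] := pois_radial_le r1 d0 xd.
move: r1 => /andP[r0 r1]; set eta := 1 - r in P1 P2 *.
have e0 : 0 < eta by rewrite subr_gt0.
set P := pois _ _ in P1 P2 *; set x := `|t - s| in P2 *.
have x0 : 0 <= x by exact: normr_ge0.
pose T j := 4 / (d ^+ 2 * eta) * 4^-1 ^+ j * (x < eta * 2 ^+ j)%R%:R.
have C0 : 0 < 4 / (d ^+ 2 * eta) by rewrite divr_gt0// mulr_gt0// exprn_gt0.
have T0 j : 0 <= T j.
  by rewrite /T mulr_ge0 ?ler0n// mulr_ge0 ?(ltW C0)// exprn_ge0// invr_ge0.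
have L0 : 0 <= eta / (d * (eta * 2 ^+ J)) ^+ 2 by rewrite divr_ge0 ?sqr_ge0// ltW.
have S j : (j <= J)%N -> P <= T j -> P <= \sum_(j < J.+1) T j + eta / (d * (eta * 2 ^+ J)) ^+ 2.
  move=> jJ PT; rewrite (le_trans PT)// (bigD1 (Ordinal (jJ : (j < J.+1)%N)))//= -addrA lerDl.
  by rewrite addr_ge0// sumr_ge0.
have [hx|hx] := ltP x (eta * 2 ^+ J); last first.
  apply: (@le_trans _ _ (eta / (d * (eta * 2 ^+ J)) ^+ 2)); last first.
    by rewrite lerDr sumr_ge0// => j _; exact: T0.
  rewrite ler_pdivlMr ?exprn_gt0 ?mulr_gt0 ?exprn_gt0//; apply: le_trans P2.
  rewrite ler_wpM2l//.
    by rewrite ltW// pois_gt0// modc_circ// (le_trans _ r0)// invr_ge0.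
  rewrite lerXn2r ?nnegrE ?mulr_ge0 ?exprn_ge0 ?(ltW e0) ?(ltW d0)//.
  by rewrite ler_pM2l.
have exj : exists j, x < eta * 2 ^+ j by exists J.
case: (ex_minnP exj) => -[|j] Hj min.
  apply: (S 0%N) => //; rewrite /T Hj mulr1 expr0 mulr1 (le_trans P1)//.
  rewrite invfM mulrA ler_pM2r ?invr_gt0// ler_pdivlMr ?exprn_gt0//.
  by nra.
apply: (S j.+1); first exact: min.
rewrite /T Hj mulr1.
have hj : eta * 2 ^+ j <= x by rewrite leNgt; apply/negP => /min; rewrite ltnn.
have A0 : 0 < (d * (eta * 2 ^+ j)) ^+ 2 by rewrite exprn_gt0// !mulr_gt0// exprn_gt0.
rewrite -(ler_pM2r A0).
have -> : 4 / (d ^+ 2 * eta) * 4^-1 ^+ j.+1 * (d * (eta * 2 ^+ j)) ^+ 2 = eta.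
  have -> : (d * (eta * 2 ^+ j)) ^+ 2 = d ^+ 2 * eta ^+ 2 * 4 ^+ j.
    by rewrite !exprMn -exprM mulnC exprM (_ : 2 ^+ 2 = 4 :> R) ?mulrA//; ring.
  rewrite [4^-1 ^+ _]exprS exprVn; have : 4 ^+ j != 0 :> R by rewrite expf_neq0.
  move: (4 ^+ j) => q q0; field.
  by rewrite q0 (gt_eqF d0) (gt_eqF e0).
apply: le_trans P2; rewrite ler_wpM2l//.
  by rewrite ltW// pois_gt0// modc_circ// (le_trans _ r0)// invr_ge0.
rewrite lerXn2r ?nnegrE ?mulr_ge0 ?exprn_ge0 ?(ltW e0) ?(ltW d0)//.
by rewrite ler_pM2l.
Qed.

Lemma le_II_D (f g : R -> R) : itg f -> itg g ->
  (forall s, D s -> f s <= g s) -> II f <= II g.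
Proof. by move=> fi gi fg; apply: le_Rintegral => //; exact: mD. Qed.

(** On an interval of radius [eta 2^j] the oscillation integral is [O(eta 2^j e')]; the coefficient
    [4^-j / eta] turns this into the summable [2^-j e']. The part far from [t] is [O(eta)]. *)
Lemma poisson_cvg_pt b t (B : R) : mfun b -> (forall s, `|b s| <= B) ->
  0 < t < 1 -> lebesgue_pt (b \_ D) t ->
  II (fun s => pois (r%:C * ee t) s * b s) @[r --> 1^'-] --> b t.
Proof.
move=> mb bB t01 lb; have /andP[t0 t1] := t01.
have ib : itg b := itg_bd mb bB.
have B0 : 0 <= B by rewrite (le_trans (normr_ge0 (b 0))).
(* This ensures [|t - s| <= 1 - d] for every [s] in [[0, 1]]. *)
pose d := Num.min t (1 - t).
have d0 : 0 < d by rewrite lt_min t0 subr_gt0.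
have d1 : 0 < d <= 2^-1.
  rewrite d0 /d ge_min; have [h|h] := leP t 2^-1 => //=.
  by lra.
pose C := 4 / d ^+ 2; have C0 : 0 < C by rewrite divr_gt0// exprn_gt0.
apply/cvgrPdist_le => e e0.
(* The shells contribute at most [2 C e'] times a geometric sum bounded by 2, that is [e / 2]. *)
pose e' := e / (8 * C); have e'0 : 0 < e' by rewrite divr_gt0// mulr_gt0.
have [h h0 Hh] := lebesgue_pt_II mb ib t01 lb e'0.
(* The far term is at most [eta c2], since [h < 2 (eta 2^J)] and the oscillation is at most
   [2 B]. *)
pose c2 := 8 / (d ^+ 2 * h ^+ 2) * B.
have c20 : 0 <= c2 by rewrite !mulr_ge0// invr_ge0 mulr_ge0// sqr_ge0.
pose eta0 := Num.min (Num.min 2^-1 h) (e / (2 * (c2 + 1))).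
have eta00 : 0 < eta0.
  by rewrite !lt_min invr_gt0 ltr0n h0 /= divr_gt0// mulr_gt0// ltr_wpDl.
near=> r.
have r1 : r < 1 by near: r; exact: nbhs_left_lt.
have r0 : 1 - eta0 < r by near: r; apply: nbhs_left_gt; rewrite ltrBlDr ltrDl.
pose eta := 1 - r; have eta1 : eta < eta0 by rewrite /eta; lra.
have etapos : 0 < eta by rewrite subr_gt0.
move: eta1; rewrite /eta0 !lt_min => /andP[/andP[eta1 etah] etae].
have rr : 2^-1 <= r < 1 by rewrite r1 andbT; rewrite /eta in eta1; lra.
have r00 : 0 <= r by case/andP : rr => rr _; rewrite (le_trans _ rr)// invr_ge0.
have mz : modc (r%:C * ee t) < 1 by rewrite modc_circ.
have [|J [J1 J2]] := @dyadic_index eta h; first by rewrite etapos ltW.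
have iP : itg (fun s => pois (r%:C * ee t) s * b s) by exact: itg_poisM.
have iPt : itg (fun s => pois (r%:C * ee t) s * b t).
  by apply: itg_poisM => //; exact: itg_cst.
have -> : b t = II (fun s => pois (r%:C * ee t) s * b t).
  rewrite (_ : II _ = II (fun s => b t * pois (r%:C * ee t) s)); last first.
    by apply: eq_II => s; rewrite mulrC.
  by rewrite IIZ ?II_pois ?mulr1//; exact: itg_pois.
rewrite distrC -IIB//.
have idb : itg (fun s => `|b s - b t|) by apply: itg_norm; apply: itgB => //; exact: itg_cst.
pose T j s := C / eta * 4^-1 ^+ j * ((`|t - s| < eta * 2 ^+ j)%R%:R * `|b s - b t|).
have iI j : itg (fun s => (`|t - s| < eta * 2 ^+ j)%R%:R * `|b s - b t|).
  apply: (@itgM_bd _ _ _ 1) => // [|s].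
    exact: mfun_dist_lt.
  by rewrite ger0_norm ?ler0n// lern1; case: (_ < _).
have iT j : itg (T j) by apply: itgZ; exact: iI.
have L0 : 0 <= eta / (d * (eta * 2 ^+ J)) ^+ 2 by rewrite divr_ge0 ?sqr_ge0// ltW.
rewrite (le_trans (norm_II (itgB iP iPt)))//.
apply: (@le_trans _ _ (II (fun s => \sum_(j < J.+1) T j s +
    eta / (d * (eta * 2 ^+ J)) ^+ 2 * (2 * B)))).
  apply: le_II_D; first by apply: itg_norm; exact: itgB.
    by apply: itgD; [exact: itg_sum|exact: itg_cst].
  move=> s; rewrite /= in_itv/= => /andP[s0 s1].
  have xd : `|t - s| <= 1 - d.
    have : d <= t by rewrite ge_min lexx.
    have : d <= 1 - t by rewrite ge_min lexx orbT.
    by rewrite ler_norml => ? ?; apply/andP; split; lra.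
  rewrite -mulrBr normrM pois_normE//.
  rewrite (le_trans (ler_wpM2r (normr_ge0 _) (pois_dyadic J rr d1 xd)))//.
  rewrite mulrDl lerD//.
    rewrite mulr_suml; apply: ler_sum => j _; rewrite /T -/eta.
    rewrite (_ : 4 / (d ^+ 2 * eta) = C / eta); last by rewrite /C invfM mulrA.
    by rewrite -!mulrA.
  rewrite ler_wpM2l// (le_trans (ler_normB _ _))// mulr2n mulrDl mul1r lerD//.
rewrite IID; [|exact: itg_sum|exact: itg_cst].
rewrite II_sum// II_cst (splitr e) lerD//.
  apply: (@le_trans _ _ (\sum_(j < J.+1) 2 * C * e' * 2^-1 ^+ j)).
    apply: ler_sum => j _; rewrite /T IIZ//.
    have hj : 0 < eta * 2 ^+ j <= h.
      rewrite mulr_gt0 ?exprn_gt0//= (le_trans _ J1)// ler_pM2l// ler_weXn2l ?ler1n//.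
      by rewrite -ltnS.
    have K0 : 0 <= C / eta * 4^-1 ^+ j by rewrite mulr_ge0 ?(divr_ge0 (ltW C0) (ltW etapos))// exprn_ge0// invr_ge0.
    rewrite (le_trans (ler_wpM2l K0 (Hh _ hj)))// le_eqVlt; apply/orP; left; apply/eqP.
    have -> : 4^-1 ^+ j = 2^-1 ^+ j / 2 ^+ j :> R.
      by rewrite -exprVn -exprMn; congr (_ ^+ _); field.
    have : 2 ^+ j != 0 :> R by rewrite expf_neq0.
    move: (2 ^+ j) (2^-1 ^+ j) => p q p0; field.
    by rewrite p0 (gt_eqF etapos).
  rewrite -mulr_sumr.
  have q01 : (0 <= 2^-1 :> R) && (2^-1 < 1 :> R) by rewrite invr_ge0 ler0n invf_lt1// ltr1n.
  have G := geo_le 0 J.+1 q01; rewrite big_mkord expr0 in G.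
  have E0 : 0 <= 2 * C * e' by exact: mulr_ge0 (mulr_ge0 (ler0n _ 2) (ltW C0)) (ltW e'0).
  rewrite (le_trans (ler_wpM2l E0 G))// le_eqVlt; apply/orP; left; apply/eqP.
  by rewrite /e'; field; rewrite (gt_eqF C0).
have h4 : h ^+ 2 <= 4 * (eta * 2 ^+ J) ^+ 2.
  have -> : 4 * (eta * 2 ^+ J) ^+ 2 = (2 * (eta * 2 ^+ J)) ^+ 2 by ring.
  by rewrite lerXn2r ?nnegrE ?(ltW h0)// ?mulr_ge0 ?exprn_ge0 ?(ltW etapos)// ltW.
apply: (@le_trans _ _ (eta * c2)).
  rewrite /c2 exprMn; have d20 : 0 < d ^+ 2 by rewrite exprn_gt0.
  have m0 : 0 < (eta * 2 ^+ J) ^+ 2 by rewrite exprn_gt0// mulr_gt0// exprn_gt0.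
  have h20 : 0 < h ^+ 2 by rewrite exprn_gt0.
  have K : (d ^+ 2 * (eta * 2 ^+ J) ^+ 2)^-1 * 2 <= 8 / (d ^+ 2 * h ^+ 2).
    rewrite ler_pdivlMr ?mulr_gt0// -mulrA ler_pdivrMl ?mulr_gt0//.
    by move: (d ^+ 2) (h ^+ 2) (_ ^+ 2) d20 m0 h20 h4 => a b' c a0 c0 b0 h5; nra.
  by rewrite -mulrA ler_pM2l// mulrA ler_wpM2r.
move: etae; rewrite ltr_pdivlMr ?mulr_gt0 ?ltr_wpDl// => etae.
by rewrite ler_pdivlMr//; nra.
Unshelve. all: by end_near. Qed.

Lemma poisson_cvg b (B : R) : mfun b -> (forall s, `|b s| <= B) ->
  {ae mu, forall t, D t ->
    II (fun s => pois (r%:C * ee t) s * b s) @[r --> 1^'-] --> b t}.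
Proof.
move=> mb bB; have ib : itg b := itg_bd mb bB.
have L : {ae mu, forall t, lebesgue_pt (b \_ D) t}.
  apply: lebesgue_differentiation; apply: integrable_locally => //.
have E (x : R) : {ae mu, forall t : R, t <> x}.
  exists [set x]; split => //; first exact: lebesgue_measure_set1.
  by move=> t /= /contrapT.
have := ae_and L (ae_and (E 0) (E 1)); apply: ae_imp => t [lt [tn0 tn1]].
rewrite /= in_itv/= => /andP[t0 t1]; apply: (poisson_cvg_pt mb bB) => //.
by rewrite !lt_neqAle t0 t1 !andbT eq_sym; apply/andP; split; apply/eqP.
Qed.

End Fatou.

(** * The boundary function of a self-map and the logarithmic condition *)

Section Boundary.
Variable R : realType.
Implicit Types (f phi : R[i] -> R[i]) (a : nat -> R[i]) (r rho c : R).
Local Notation mu := (@lebesgue_measure R).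
Local Notation D := (`[0%R, 1%R]%classic : set R).

Lemma cvgcM (u v : nat -> R[i]) (l m : R[i]) : u k @[k --> \oo] --> l ->
  v k @[k --> \oo] --> m -> u k * v k @[k --> \oo] --> l * m.
Proof.
move=> /cvgcP ul /cvgcP vm; apply/cvgcP => e e0.
pose K := modc l + 1; have K0 : 0 < K by rewrite ltr_wpDl ?modc_ge0.
pose M := modc m + 1; have M0 : 0 < M by rewrite ltr_wpDl ?modc_ge0.
have e1 : 0 < e / 2 / M by rewrite !divr_gt0.
have e2 : 0 < e / 2 / K by rewrite !divr_gt0.
have [N1 _ H1] := ul 1 ltr01; have [N2 _ H2] := ul _ e1; have [N3 _ H3] := vm _ e2.
exists (maxn N1 (maxn N2 N3)) => // k /=; rewrite !geq_max => /and3P[k1 k2 k3].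
have a1 := H1 _ k1; have a2 := H2 _ k2; have a3 := H3 _ k3.
have -> : u k * v k - l * m = u k * (v k - m) + (u k - l) * m by ring.
rewrite (le_lt_trans (modcD _ _))// !modcM.
have b1 : modc (u k) <= K.
  by rewrite (le_trans (modc_triangle _ l))// lerD2l ltW.
have b2 : modc (u k) * modc (v k - m) <= e / 2.
  rewrite (le_trans (ler_pM (modc_ge0 _) (modc_ge0 _) b1 (ltW a3)))//.
  by rewrite mulrCA divff ?mulr1// gt_eqF.
have b3 : modc (u k - l) * modc m < e / 2.
  rewrite (@le_lt_trans _ _ (e / 2 / M * modc m))//.
    by rewrite ler_wpM2r ?modc_ge0// ltW.
  rewrite mulrAC ltr_pdivrMr// ltr_pM2l ?divr_gt0//.
  by rewrite ltrDl.
by rewrite [ltRHS](splitr e) ler_ltD.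
Qed.

Lemma cvgcX (u : nat -> R[i]) (l : R[i]) n : u k @[k --> \oo] --> l ->
  u k ^+ n @[k --> \oo] --> l ^+ n.
Proof.
move=> ul; elim: n => [|n IH]; first exact: cvg_cst.
have := cvgcM ul IH; rewrite -exprS.
by apply: cvg_trans; apply: near_eq_cvg; apply: nearW => k; rewrite exprS.
Qed.

Lemma has_taylor_scale a f c : 0 <= c <= 1 -> has_taylor a f ->
  has_taylor (fun k => a k * c%:C ^+ k) (fun z => f (c%:C * z)).
Proof.
move=> /andP[c0 c1] fa z z1.
have cz : modc (c%:C * z) < 1.
  by rewrite modcM modc_real ger0_norm// (le_lt_trans _ z1)// ler_piMl// modc_ge0.
apply: cvg_trans (fa _ cz); apply: near_eq_cvg; apply: nearW => n.
by rewrite /series /=; apply: eq_bigr => k _; rewrite exprMn mulrA.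
Qed.

Lemma has_taylorZD a b f g (c : R[i]) : has_taylor a f -> has_taylor b g ->
  has_taylor (fun k => a k + c * b k) (fun z => f z + c * g z).
Proof.
move=> fa gb z z1.
have h1 := fa z z1; have h2 := gb z z1.
have : series (fun k => a k * z ^+ k) n + c * series (fun k => b k * z ^+ k) n @[n --> \oo]
    --> f z + c * g z.
  apply: (@cvgD _ _ _ _ _ _ (fun n => c * series (fun k => b k * z ^+ k) n)); first exact: h1.
  exact: (@cvgcM (fun=> c) _ c _ (@cvg_cst _ _ _ _ _) h2).
apply: cvg_trans; apply: near_eq_cvg; apply: nearW => n.
rewrite /series /= mulr_sumr -big_split; apply: eq_bigr => k _ /=.
by rewrite mulrDl mulrA.
Qed.

Lemma has_taylorB a b f g : has_taylor a f -> has_taylor b g ->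
  has_taylor (fun k => a k - b k) (fun z => f z - g z).
Proof.
move=> fa gb; have := @has_taylorZD _ _ _ _ (-1) fa gb.
by congr has_taylor; apply/funext => k; rewrite mulN1r.
Qed.

Lemma analytic_radial f z (e : R) : analytic_disk f -> modc z < 1 -> 0 < e ->
  exists2 d, 0 < d & forall c, 0 <= c <= 1 -> 1 - d <= c -> modc (f (c%:C * z) - f z) <= e.
Proof.
move=> /analyticP fa z1 e0; have e4 : 0 < e / 4 by rewrite divr_gt0.
have [p Hp] := fa _ _ z1 e4.
pose K := \sum_(k < size p) modc p`_k * k%:R.
have K0 : 0 <= K by apply: sumr_ge0 => k _; rewrite mulr_ge0 ?modc_ge0.
have K1 : 0 < 2 * (K + 1) by rewrite mulr_gt0// ltr_wpDl.
have d0 : 0 < e / (2 * (K + 1)) by rewrite divr_gt0.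
exists (e / (2 * (K + 1))) => // c /andP[c0 c1] dc.
have zz : modc (c%:C * z) <= modc z.
  by rewrite modcM modc_real ger0_norm// ler_piMl// modc_ge0.
have -> : f (c%:C * z) - f z = (f (c%:C * z) - p.[c%:C * z]) - (f z - p.[z]) + (p.[c%:C * z] - p.[z]) by ring.
rewrite (le_trans (modcD _ _))//.
have h1 : modc (f (c%:C * z) - p.[c%:C * z] - (f z - p.[z])) <= e / 4 + e / 4.
  by rewrite (le_trans (modcB _ _))// lerD ?Hp.
have h2 : modc (p.[c%:C * z] - p.[z]) <= K * (1 - c).
  rewrite !horner_coef -sumrB (le_trans (modc_sum _ _ _))// /K mulr_suml.
  apply: ler_sum => k _; rewrite exprMn -mulrBr modcM -mulrA ler_wpM2l ?modc_ge0//.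
  rewrite -[X in _ - X]mul1r -mulrBl modcM modcX.
  rewrite -rmorphXn /= -[1%R]/((1 : R)%:C) -rmorphB /= modc_real distrC.
  have ck : c ^+ k <= 1 by rewrite exprn_ile1.
  rewrite ger0_norm ?subr_ge0// (@le_trans _ _ (1 - c ^+ k))//.
    by rewrite ler_piMr ?subr_ge0// exprn_ile1// ?modc_ge0// ltW.
  have := @bernoulli_ge R (1 - c) k; rewrite subr_ge0 c1 lerBlDr lerDl c0 => /(_ isT).
  rewrite (_ : 1 - (1 - c) = c); last by ring.
  by lra.
have h3 : K * (1 - c) <= e / 2.
  have : 1 - c <= e / (2 * (K + 1)) by lra.
  rewrite ler_pdivlMr// => h; rewrite ler_pdivlMr//.
  have : 0 <= 1 - c by rewrite subr_ge0.
  nra.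
by rewrite (le_trans (lerD h1 (le_trans h2 h3)))//; lra.
Qed.

Definition nrm f r : R := II (fun t => modc (circ f r t) ^+ 2).

Lemma nrm_mono f r rho : analytic_disk f -> 0 <= r <= rho -> rho < 1 ->
  nrm f r <= nrm f rho.
Proof.
move=> [a fa] /andP[r0 rr] r1.
have r01 : 0 <= r < 1 by rewrite r0 (le_lt_trans rr).
have rho01 : 0 <= rho < 1 by rewrite (le_trans r0).
apply: (cvg_le_cst (parseval_cvg fa r01)); apply: nearW => n.
apply: le_trans (parseval_ge n fa rho01); apply: ler_sum => k _.
rewrite lerXn2r ?nnegrE ?mulr_ge0 ?modc_ge0 ?exprn_ge0//; first by rewrite (le_trans r0).
by rewrite ler_wpM2l ?modc_ge0// lerXn2r// nnegrE (le_trans r0).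
Qed.

(** On coefficients this is [(1 - q)^2 <= 1 - q^2] for [q = c^k] in [[0, 1]]. Since the means
    increase and, for a self-map, stay bounded, the restrictions to circles are Cauchy in mean
    square. *)
Lemma nrm_sub f r rho : analytic_disk f -> 0 <= r <= rho -> 0 < rho < 1 ->
  II (fun t => modc (circ f rho t - circ f r t) ^+ 2) <= nrm f rho - nrm f r.
Proof.
move=> [a fa] /andP[r0 rr] /andP[rho0 rho1].
have r01 : 0 <= r < 1 by rewrite r0 (le_lt_trans rr).
have rho01 : 0 <= rho < 1 by rewrite ltW.
pose c := r / rho.
have c01 : 0 <= c <= 1 by rewrite divr_ge0 ?(ltW rho0)//= ler_pdivrMr// mul1r.
have cr : c * rho = r by rewrite /c divfK// gt_eqF.
have ga := has_taylorB fa (has_taylor_scale c01 fa).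
have -> : II (fun t => modc (circ f rho t - circ f r t) ^+ 2) =
    nrm (fun z => f z - f (c%:C * z)) rho.
  by apply: eq_II => t; rewrite /circ mulrA -rmorphM /= cr.
apply: (cvg_le_cst (parseval_cvg ga rho01)).
have P1 := parseval_cvg fa r01.
have P2 := parseval_cvg fa rho01.
suff H n : \sum_(k < n) (modc (a k - a k * c%:C ^+ k) * rho ^+ k) ^+ 2 <= nrm f rho - nrm f r.
  by apply: nearW.
have Pc : \sum_(k < m) (modc (a k) * rho ^+ k) ^+ 2 -
    \sum_(k < m) (modc (a k) * r ^+ k) ^+ 2 @[m --> \oo] --> nrm f rho - nrm f r.
  exact: cvgB P2 P1.
apply: (cvg_ge_cst Pc).
exists n => // m /= nm; rewrite -sumrB.
have T k : (modc (a k - a k * c%:C ^+ k) * rho ^+ k) ^+ 2 <=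
    (modc (a k) * rho ^+ k) ^+ 2 - (modc (a k) * r ^+ k) ^+ 2.
  have ck : 0 <= 1 - c ^+ k by case/andP : c01 => ? ?; rewrite subr_ge0 exprn_ile1.
  have -> : a k - a k * c%:C ^+ k = a k * (1 - c ^+ k)%:C.
    by rewrite rmorphB /= rmorph1 rmorphXn /= mulrBr mulr1.
  rewrite modcM modc_real ger0_norm//.
  have -> : r ^+ k = c ^+ k * rho ^+ k by rewrite -exprMn cr.
  have ck0 : 0 <= c ^+ k by case/andP : c01 => ? ?; rewrite exprn_ge0.
  move: (modc (a k)) (rho ^+ k) (c ^+ k) ck ck0 => A p q q1 q0.
  have -> : (A * p) ^+ 2 - (A * (q * p)) ^+ 2 =
      (A * (1 - q) * p) ^+ 2 + 2 * (A * p) ^+ 2 * (q * (1 - q)) by ring.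
  by rewrite lerDl mulr_ge0 ?(mulr_ge0 q0 q1)// mulr_ge0 ?sqr_ge0.
have T0 k : 0 <= (modc (a k) * rho ^+ k) ^+ 2 - (modc (a k) * r ^+ k) ^+ 2.
  by apply: le_trans (T k); rewrite sqr_ge0.
rewrite -(big_mkord xpredT (fun k => (modc (a k - a k * c%:C ^+ k) * rho ^+ k) ^+ 2)).
rewrite -(big_mkord xpredT (fun k => (modc (a k) * rho ^+ k) ^+ 2 - (modc (a k) * r ^+ k) ^+ 2)).
rewrite [leRHS](big_cat_nat (n := n))//=.
rewrite (@le_trans _ _ (\sum_(0 <= k < n) ((modc (a k) * rho ^+ k) ^+ 2 - (modc (a k) * r ^+ k) ^+ 2)))//.
  by apply: ler_sum => k _; exact: T.
by rewrite lerDl sumr_ge0.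
Qed.

Lemma selfmap_circ phi r t : analytic_selfmap phi -> 0 <= r < 1 ->
  modc (circ phi r t) < 1.
Proof. by move=> [_ p1] /andP[r0 r1]; apply: p1; rewrite modc_circ. Qed.

(** The mean at [r_ k] is within [4^-k] of its supremum, so consecutive restrictions are within
    [2^-k] in mean square, hence in mean; the summability gives convergence almost everywhere. *)
Lemma fast_radii phi : analytic_selfmap phi -> exists r_ : nat -> R,
  [/\ forall k, 0 < r_ k < 1, r_ k @[k --> \oo] --> (1 : R) &
      forall k, II (fun t => modc (circ phi (r_ k.+1) t - circ phi (r_ k) t)) <= 2^-1 ^+ k].
Proof.
move=> ps; have [pa p1] := ps.
pose E := [set nrm phi r | r in [set r | 0 < r < 1]].
have Eb r : 0 < r < 1 -> nrm phi r <= 1.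
  move=> /andP[r0 r1]; have r01 : 0 <= r < 1 by rewrite ltW.
  rewrite -[leRHS]II_cst; apply: le_II; [exact: itg_circ|exact: itg_cst|] => t.
  by rewrite expr_le1 ?modc_ge0// ltW// selfmap_circ.
have hE : has_sup E.
  split; last by exists 1 => _ [r /= r01 <-]; exact: Eb.
  by exists (nrm phi 2^-1), 2^-1 => //=; rewrite invr_gt0 ltr0n invf_lt1// ltr1n.
have Eu r : 0 < r < 1 -> nrm phi r <= sup E.
  by move=> r01; apply: (sup_upper_bound hE); exists r.
have /choice[r_ Hr] : forall k, exists r, [/\ 0 < r < 1, 1 - k.+2%:R^-1 <= r &
    sup E - 4^-1 ^+ k <= nrm phi r].
  move=> k; have k0 : 0 < 4^-1 ^+ k :> R by rewrite exprn_gt0// invr_gt0.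
  have [_ [r /= /andP[r0 r1] <-] Hr] := sup_adherent k0 hE.
  have k1 : 1 - k.+2%:R^-1 < 1 :> R by rewrite ltrBlDr ltrDl invr_gt0.
  (* The maximum forces convergence to 1 and keeps the mean close to the supremum by monotonicity.
     The radii need not increase with [k], whence two cases below. *)
  exists (Num.max r (1 - k.+2%:R^-1)); split.
  - by rewrite lt_max r0 /= gt_max r1.
  - by rewrite le_max lexx orbT.
  - rewrite (le_trans (ltW Hr))// nrm_mono//.
      by rewrite (ltW r0) le_max lexx.
    by rewrite gt_max r1.
exists r_; split => [k||k]; first by have [] := Hr k.
  apply/cvgrPdist_le => e /invn_small[N HN]; exists N => // k /= Nk.
  have [/andP[_ h1] h2 _] := Hr k; rewrite ger0_norm ?subr_ge0 ?(ltW h1)//.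
  by move: (HN k.+1 (leqW Nk)) h2; move: (k.+2%:R^-1) => x; lra.
have [/andP[a0 a1] _ a2] := Hr k; have [/andP[b0 b1] _ b2] := Hr k.+1.
have ia := cmf_circ pa (_ : 0 <= r_ k < 1); have ib := cmf_circ pa (_ : 0 <= r_ k.+1 < 1).
have {}ia : cmf (circ phi (r_ k)) by apply: ia; rewrite ltW.
have {}ib : cmf (circ phi (r_ k.+1)) by apply: ib; rewrite ltW.
pose G t := circ phi (r_ k.+1) t - circ phi (r_ k) t.
have mG : cmf G.
  apply: cmfD => //; have := cmfM (cmf_cst (-1)) ia.
  by congr cmf; apply/funext => t; rewrite mulN1r.
have GB t : modc (G t) <= 2.
  rewrite (le_trans (modcB _ _))// -[leRHS](_ : 1 + 1 = 2 :> R)// lerD// ltW// selfmap_circ// ltW//.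
have G2 : II (fun t => modc (G t) ^+ 2) <= 4^-1 ^+ k.
  have k41 : 4^-1 ^+ k.+1 <= 4^-1 ^+ k :> R.
    by rewrite ler_wiXn2l ?invr_ge0// invf_le1// ler1n.
  have u1 : nrm phi (r_ k) <= sup E by apply: Eu; rewrite a0.
  have u2 : nrm phi (r_ k.+1) <= sup E by apply: Eu; rewrite b0.
  have [h|h] := leP (r_ k) (r_ k.+1).
    have := @nrm_sub phi (r_ k) (r_ k.+1) pa; rewrite (ltW a0) h b0 b1 => /(_ isT isT).
    by rewrite -/(G _) => h1; rewrite (le_trans h1)//; lra.
  have := @nrm_sub phi (r_ k.+1) (r_ k) pa; rewrite (ltW b0) (ltW h) a0 a1 => /(_ isT isT).
  rewrite (_ : II _ = II (fun t => modc (G t) ^+ 2)); last first.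
    by apply: eq_II => t; rewrite modc_distC.
  by move=> h1; rewrite (le_trans h1)//; lra.
have iG : itg (fun t => modc (G t)).
  by apply: (@itg_bd _ _ 2) => [|t]; [exact: mfun_modc|rewrite ger0_norm ?modc_ge0].
have iG2 : itg (fun t => modc (G t) ^+ 2).
  apply: (@itg_bd _ _ (2 ^+ 2)) => [|t]; first exact: mfun_sqr_modc.
  by rewrite normrX ger0_norm ?modc_ge0// lerXn2r ?nnegrE ?modc_ge0.
pose p : R := 2^-1 ^+ k.
have p0 : 0 < p by rewrite exprn_gt0// invr_gt0.
have pE : 4^-1 ^+ k = p ^+ 2 :> R.
  by rewrite /p -exprM mulnC exprM; congr (_ ^+ _); field.
apply: (@le_trans _ _ (II (fun t => p / 2 + (2 * p)^-1 * modc (G t) ^+ 2))).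
  apply: le_II => //; first by apply: itgD; [exact: itg_cst|exact: itgZ].
  (* AM-GM *)
  move=> t; rewrite -/(G t); have := sqr_ge0 (modc (G t) - p) => h.
  rewrite -(ler_pM2l (_ : 0 < 2 * p)) ?mulr_gt0//.
  have -> : 2 * p * (p / 2 + (2 * p)^-1 * modc (G t) ^+ 2) = p ^+ 2 + modc (G t) ^+ 2.
    by field; rewrite gt_eqF.
  by nra.
rewrite IID ?II_cst ?IIZ//; [|exact: itg_cst|exact: itgZ].
have : (2 * p)^-1 * II (fun t => modc (G t) ^+ 2) <= (2 * p)^-1 * p ^+ 2.
  by rewrite ler_wpM2l -?pE// invr_ge0 mulr_ge0// ltW.
have -> : (2 * p)^-1 * p ^+ 2 = p / 2 by field; rewrite gt_eqF.
by rewrite -/p; lra.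
Qed.

(* The boundary function is only bounded by 2 everywhere (by 1 almost
   everywhere): its real and imaginary parts are upper limits. *)
Lemma boundary_function phi : analytic_selfmap phi ->
  exists b : R -> R[i], [/\ cmf b, forall t, modc (b t) <= 2,
    {ae mu, forall t, D t -> phi (r%:C * ee t) @[r --> 1^'-] --> b t} &
    forall n z, modc z < 1 ->
      phi z ^+ n = cI (fun t => (pois z t)%:C * b t ^+ n)].
Proof.
move=> ps; have [pa p1] := ps; have [r_ [r01 r1 rL]] := fast_radii ps.
have r01' k : 0 <= r_ k < 1 by have /andP[/ltW -> ->] := r01 k.
pose u k t := circ phi (r_ k) t.
have mu_ k : cmf (u k) by exact: cmf_circ.
have uB k t : modc (u k t) <= 1 by rewrite ltW// selfmap_circ.
have uRB k t : `|Re (u k t)| <= 1 by exact: le_trans (Re_le_modc _) (uB k t).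
have uIB k t : `|Im (u k t)| <= 1 by exact: le_trans (Im_le_modc _) (uB k t).
have U (v : nat -> R -> R) : (forall k t, `|v k t| <= 1) ->
    (forall t, has_ubound (range (v ^~ t))) * (forall t, has_lbound (range (v ^~ t))).
  move=> vB; split => t; [exists 1 | exists (-1)] => _ [k _ <-];
    by have := vB k t; rewrite ler_norml => /andP[].
have LB (v : nat -> R -> R) t : (forall k t, `|v k t| <= 1) ->
    `|limn_sup (v ^~ t)| <= 1.
  move=> vB; have [ub lb] := U v vB.
  have cs := cvg_sups_inf (ub t) (lb t).
  have sB k : `|sups (v ^~ t) k| <= 1.
    rewrite ler_norml; apply/andP; split.
      apply: (@le_trans _ _ (v k t)); first by have := vB k t; rewrite ler_norml => /andP[].
      by apply: ub_le_sup; [exact/has_ubound_sdrop/ub|exists k => /=].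
    apply: ge_sup; first by exists (v k t), k => /=.
    by move=> _ [m /= _ <-]; have := vB m t; rewrite ler_norml => /andP[].
  rewrite /limn_sup; have /cvg_lim -> // := cs.
  rewrite ler_norml; apply/andP; split.
  - by apply: (cvg_ge_cst cs); apply: nearW => k; have := sB k; rewrite ler_norml => /andP[].
  - by apply: (cvg_le_cst cs); apply: nearW => k; have := sB k; rewrite ler_norml => /andP[].
pose bR (t : R) : R := limn_sup (fun k => Re (u k t)).
pose bI (t : R) : R := limn_sup (fun k => Im (u k t)).
have bRB t : `|bR t| <= 1 by exact: (LB (fun k t => Re (u k t))).
have bIB t : `|bI t| <= 1 by exact: (LB (fun k t => Im (u k t))).
have mR : mfun bR.
  have [ub lb] := U (fun k t => Re (u k t)) uRB.
  by apply: measurable_fun_limn_sup => // k; exact: (mu_ k).1.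
have mI : mfun bI.
  have [ub lb] := U (fun k t => Im (u k t)) uIB.
  by apply: measurable_fun_limn_sup => // k; exact: (mu_ k).2.
pose b t : R[i] := bR t +i* bI t.
have mb : cmf b by [].
have bB t : modc (b t) <= 2.
  by apply: (le_trans (modc_le_ReIm _)); have := bRB t; have := bIB t; rewrite /=; lra.
have ub_cvg : {ae mu, forall t, D t -> u k t @[k --> \oo] --> b t}.
  pose g k t := modc (u k.+1 t - u k t).
  have mg k : mfun (g k).
    apply: mfun_modc; apply: cmfD => //; have := cmfM (cmf_cst (-1)) (mu_ k).
    by congr cmf; apply/funext => t; rewrite mulN1r.
  have gB k t : `|g k t| <= 2.
    rewrite ger0_norm ?modc_ge0// (le_trans (modcB _ _))//.
    by rewrite -[leRHS](_ : 1 + 1 = 2 :> R)// lerD.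
  have ig k : itg (g k) := itg_bd (mg k) (gB k).
  (* The total variation of [k |-> u k t] has integral at most [\sum_k 2^-k], so it is finite almost
     everywhere, and there [u k t] is a Cauchy sequence. *)
  pose S t := (\sum_(0 <= k <oo) (g k t)%:E)%E.
  have mgE k : @measurable_fun _ _ (measurableTypeR R) _ D (EFin \o g k).
    by apply/measurable_EFinP; exact: (measurable_funTS (mg k)).
  have g0 k t : (0 <= (g k t)%:E)%E by rewrite lee_fin modc_ge0.
  have iS : mu.-integrable D S.
    apply/integrableP; split.
      apply: (@ge0_emeasurable_sum _ (measurableTypeR R) _ D (fun k => EFin \o g k) xpredT).
      - by move=> k t _ _; exact: g0.
      - by move=> k _; exact: mgE.
    have -> : (\int[mu]_(t in D) `|S t| = \int[mu]_(t in D) S t)%E.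
      by apply: eq_integral => t _; rewrite gee0_abs// nneseries_ge0.
    rewrite (@integral_nneseries _ (measurableTypeR R) _ mu D (@mD R) (fun k => EFin \o g k))//;
      last by move=> k t _; exact: g0.
    apply: (@le_lt_trans _ _ 2%:E); last by rewrite ltry.
    apply: lime_le.
      by apply: is_cvg_nneseries => k _ _; apply: integral_ge0 => t _; exact: g0.
    apply: nearW => n; rewrite (eq_bigr (fun k => (II (g k))%:E)) => [|k _]; last first.
      by rewrite EFin_II.
    rewrite sumEFin lee_fin (@le_trans _ _ (\sum_(0 <= k < n) 2^-1 ^+ k))//.
      by apply: ler_sum => k _; exact: rL.
    have q01 : (0 <= 2^-1 :> R) && (2^-1 < 1 :> R) by rewrite invr_ge0 ler0n invf_lt1// ltr1n.
    have := geo_le 0 n q01; rewrite expr0 mul1r => h; rewrite (le_trans h)//.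
    by rewrite (_ : 1 - 2^-1 = 2^-1) ?invrK//; field.
  apply: ae_imp (integrable_ae (@mD R) iS) => t h Dt; have {}h := h Dt.
  suff [l ul] : exists l : R[i], u k t @[k --> \oo] --> l.
    have -> : b t = l.
      rewrite /b /bR /bI; have [_ ->] := cvg_limn_inf_sup (cvg_Re ul).
      by have [_ ->] := cvg_limn_inf_sup (cvg_Im ul); case: l {ul}.
    exact: ul.
  apply: complex_cauchy => e e0.
  pose s n := \sum_(0 <= k < n) g k t.
  have s_nd : {homo s : n m / (n <= m)%N >-> n <= m}.
    move=> n m nm; rewrite /s (big_cat_nat (n := n) (p := m))//= lerDl sumr_ge0// => k _.
    exact: modc_ge0.
  have s_cvg : s n @[n --> \oo] --> fine (S t).
    have c : (\sum_(0 <= k < n) (g k t)%:E)%E @[n --> \oo] --> S t.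
      by apply: is_cvg_nneseries => k _ _; exact: g0.
    rewrite -(fineK h) in c; move/fine_cvgP : c => [_ c].
    apply: cvg_trans c; apply: near_eq_cvg; apply: nearW => n /=.
    by rewrite sumEFin.
  have e2 : 0 < e / 2 by rewrite divr_gt0.
  have /cvgrPdist_le/(_ _ e2)[N _ HN] := s_cvg.
  have T n m : (n <= m)%N -> modc (u m t - u n t) <= s m - s n.
    move=> nm; rewrite -(subnK nm); elim: (m - n)%N => [|k IH].
      by rewrite add0n !subrr modc0.
    rewrite addSn /s big_nat_recr//= -/(s _) addrAC.
    have -> : u (k + n).+1 t - u n t = (u (k + n)%N t - u n t) + (u (k + n).+1 t - u (k + n)%N t) by ring.
    by rewrite (le_trans (modcD _ _))// lerD.
  have sn n m : (N <= n)%N -> (n <= m)%N -> s m - s n <= e.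
    move=> Nn nm; have := HN n Nn; have := HN m (leq_trans Nn nm).
    by rewrite !ler_norml => /andP[a1 a2] /andP[a3 a4]; lra.
  exists N => n m Nn Nm; have [nm|mn] := leqP n m.
    by rewrite modc_distC (le_trans (T _ _ nm))// sn.
  by rewrite (le_trans (T _ _ (ltnW mn)))// sn// ltnW.
(* Poisson's formula on the circles of radius [r_ k], passed to the limit by dominated
   convergence. *)
have rep n z : modc z < 1 -> phi z ^+ n = cI (fun t => (pois z t)%:C * b t ^+ n).
  move=> z1; have na := analyticX n pa.
  have C1 : (phi ((r_ k)%:C * z)) ^+ n @[k --> \oo] --> phi z ^+ n.
    apply/cvgcP => e e0; have e2 : 0 < e / 2 by rewrite divr_gt0.
    have [d d0 Hd] := analytic_radial na z1 e2.
    have /cvgrPdist_le/(_ _ d0) := r1; apply: filterS => k hk.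
    have /andP[rk0 rk1] := r01 k.
    rewrite (@le_lt_trans _ _ (e / 2))//; last by rewrite ltr_pdivrMr// ltr_pMr// ltr1n.
    apply: Hd; first by rewrite !ltW.
    by move: hk; rewrite ler_norml => /andP[]; lra.
  have B2 : 0 <= 2 / (1 - modc z) by rewrite divr_ge0// subr_ge0 ltW.
  pose V k t : R[i] := (pois z t)%:C * u k t ^+ n.
  pose W t : R[i] := (pois z t)%:C * b t ^+ n.
  have mV k : cmf (V k).
    by apply: cmfM; [apply: cmf_real; exact: mfun_pois|exact: cmfX].
  have mW : cmf W.
    by apply: cmfM; [apply: cmf_real; exact: mfun_pois|exact: cmfX].
  have VB k t : modc (V k t) <= 2 / (1 - modc z).
    rewrite modcM modc_real pois_normE// modcX (le_trans _ (pois_le t z1))//.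
    by rewrite ler_piMr ?(ltW (pois_gt0 t z1))// exprn_ile1 ?modc_ge0.
  have VW : {ae mu, forall t, D t -> V k t @[k --> \oo] --> W t}.
    apply: ae_imp ub_cvg => t h Dt; have {}h := h Dt.
    have {}h := @cvgcX (fun k => u k t) (b t) n h.
    have c : (fun=> (pois z t)%:C) k @[k --> \oo] --> (pois z t)%:C by exact: cvg_cst.
    exact: (@cvgcM _ _ _ _ c h).
  have C2 : cI (V k) @[k --> \oo] --> cI W.
    apply: cvgc_ReIm.
    - have [|||||_] := @II_dct R (fun k t => Re (V k t)) (fun t => Re (W t)) (fun=> 2 / (1 - modc z)) => //.
      + by move=> k; exact: (mV k).1.
      + exact: mW.1.
      + exact: itg_cst.
      + by move=> k t; exact: le_trans (Re_le_modc _) (VB k t).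
      + by apply: ae_imp VW => t h Dt; apply: cvg_Re; exact: h.
    - have [|||||_] := @II_dct R (fun k t => Im (V k t)) (fun t => Im (W t)) (fun=> 2 / (1 - modc z)) => //.
      + by move=> k; exact: (mV k).2.
      + exact: mW.2.
      + exact: itg_cst.
      + by move=> k t; exact: le_trans (Im_le_modc _) (VB k t).
      + by apply: ae_imp VW => t h Dt; apply: cvg_Im; exact: h.
  have E : (fun k => phi ((r_ k)%:C * z) ^+ n) = (fun k => cI (V k)).
    apply/funext => k.
    by have := @poisson_formula R (fun z => phi z ^+ n) (r_ k) z na (r01' k) z1.
  have L1 := @cvgc_lim R nat \oo _ _ _ C1; have L2 := @cvgc_lim R nat \oo _ _ _ C2.
  by rewrite -[LHS]L1 -[RHS]L2 E.
exists b; split => //.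
(* Up to here the limit exists only along the radii [r_ k]; as [phi] is the Poisson integral of [b],
   Fatou's theorem gives the full radial limit. *)
have PR := poisson_cvg mR bRB; have PI := poisson_cvg mI bIB.
apply: ae_imp (ae_and PR PI) => t [h1 h2] Dt.
have {}h1 := h1 Dt; have {}h2 := h2 Dt.
have E r : 0 <= r < 1 -> phi (r%:C * ee t) =
    II (fun s => pois (r%:C * ee t) s * bR s) +i* II (fun s => pois (r%:C * ee t) s * bI s).
  move=> /andP[r0 r1']; have := rep 1%N (r%:C * ee t); rewrite modc_circ// => /(_ r1').
  rewrite expr1 => ->; apply: eqc; rewrite /cI; apply: eq_II => s.
  - by rewrite expr1 ReMr.
  - by rewrite expr1 ImMr.
have near01 : \forall r \near (1 : R)^'-, 0 <= r < 1.
  near=> r; apply/andP; split.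
    by near: r; apply: nbhs_left_ge; exact: ltr01.
  by near: r; exact: nbhs_left_lt.
apply: cvgc_ReIm.
- apply: cvg_trans h1; apply: near_eq_cvg; near=> r.
  by rewrite (E r)//; near: r; exact: near01.
- apply: cvg_trans h2; apply: near_eq_cvg; near=> r.
  by rewrite (E r)//; near: r; exact: near01.
Unshelve. all: by end_near. Qed.

Lemma log_inv_1m_ge0 (x : R) : 0 <= x -> (0 <= log_inv_1m x)%E.
Proof.
move=> x0; rewrite /log_inv_1m; case: ifPn => // x1.
by rewrite lee_fin ln_ge0// invf_ge1 ?subr_gt0// lerBlDr lerDl.
Qed.

(** The integral of a nonnegative function is a supremum over the simple functions below it, so
    monotonicity holds without measurability. *)
Lemma ge0_le_integralW (f g : R -> \bar R) : (forall t, D t -> (0 <= f t)%E) ->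
  (forall t, D t -> (f t <= g t)%E) ->
  (\int[mu]_(t in D) f t <= \int[mu]_(t in D) g t)%E.
Proof.
move=> f0 fg; have g0 t : D t -> (0 <= g t)%E by move=> Dt; rewrite (le_trans (f0 t Dt)) ?fg.
rewrite !ge0_integralE//; apply: le_ereal_sup => _ [h /= hf <-].
exists h => // x; apply: le_trans (hf x) _.
by apply: lee_restrict => t Dt; exact: fg.
Qed.

Lemma measurable_log_inv (b : R -> R[i]) : cmf b ->
  @measurable_fun _ _ (measurableTypeR R) _ setT (fun t => log_inv_1m (modc (b t))).
Proof.
move=> mb; have mm := mfun_modc mb.
rewrite (_ : (fun t => _) =
  (fun t => if modc (b t) < 1 then (- ln (1 - modc (b t)))%:E else +oo%E)); last first.
  apply/funext => t; rewrite /log_inv_1m; case: ifPn => // b1.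
  by rewrite lnV// posrE subr_gt0.
apply: measurable_fun_ifT => //=.
- apply: measurable_fun_ltr; first exact: mm.
  exact: measurable_cst.
- apply/measurable_EFinP; apply: measurableT_comp => //.
  apply: (@measurableT_comp _ _ _ _ _ _ (@ln R)); first exact: measurable_ln.
  by apply: measurable_funB; [exact: measurable_cst|exact: mm].
Qed.

(* The integrand of [log_condition] is not known to be Borel measurable, so the
   comparison goes through measurable minorants and majorants. *)
Lemma log_conditionP phi (b : R -> R[i]) : cmf b ->
  {ae mu, forall t, D t -> phi (r%:C * ee t) @[r --> 1^'-] --> b t} ->
  log_condition phi <-> (\int[mu]_(t in D) log_inv_1m (modc (b t)) < +oo)%E.
Proof.
move=> mb [N [mN N0 PN]].
pose f t := log_inv_1m (modc (radial_limit phi (ee t))).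
pose g t := log_inv_1m (modc (b t)).
have fg t : D t -> ~ N t -> f t = g t.
  move=> Dt Nt; rewrite /f /g /radial_limit.
  have h : phi (r%:C * ee t) @[r --> 1^'-] --> b t.
    by apply: contrapT => h; apply: Nt; apply: PN => /= /(_ Dt).
  by have /cvgc_lim -> := h.
have f0 t : (0 <= f t)%E by apply: log_inv_1m_ge0; exact: modc_ge0.
have g0 t : (0 <= g t)%E by apply: log_inv_1m_ge0; exact: modc_ge0.
have mg : @measurable_fun _ _ (measurableTypeR R) _ setT g := measurable_log_inv mb.
have mNC : @measurable _ (measurableTypeR R) (~` N) by exact: measurableC.
have mg1 : @measurable_fun _ _ (measurableTypeR R) _ setT (g \_ (~` N)).
  by apply/(measurable_restrictT _ mNC); exact: measurable_funTS.
(* Adding [+oo] on the null set makes [g + k] a measurable majorant of [f] everywhere; [g] cut to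
   the complement of [N] is a measurable minorant. *)
pose k : R -> \bar R := (cst +oo%E) \_ N.
have mk : @measurable_fun _ _ (measurableTypeR R) _ setT k.
  by apply/(measurable_restrictT _ mN); exact: measurable_cst.
have k0 t : (0 <= k t)%E by rewrite /k patchE; case: ifPn => _; [exact: leey|exact: lexx].
have aeN (Q : R -> Prop) : (forall t, ~ N t -> Q t) -> {ae mu, forall t, Q t}.
  by move=> H; exists N; split => // t nQ; apply: contrapT => /H.
rewrite /log_condition; split => h.
- rewrite (@ae_eq_integral _ (measurableTypeR R) _ mu D (g \_ (~` N)) g (@mD R)).
  + apply: le_lt_trans h; apply: ge0_le_integralW => t Dt; rewrite patchE; case: ifPn => //.
    * by rewrite inE => Nt; rewrite -(fg t Dt Nt).
    * by move=> _; exact: f0.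
  + exact: measurable_funTS.
  + exact: measurable_funTS.
  + by apply: aeN => t Nt _; rewrite patchE mem_set.
- apply: (@le_lt_trans _ _ (\int[mu]_(t in D) (g t + k t))%E).
    apply: ge0_le_integralW => t Dt; first exact: f0.
    have [Nt|Nt] := pselect (N t).
      by rewrite /k patchE mem_set// addey ?leey// gt_eqF// (lt_le_trans _ (g0 t)) ?ltNyr.
    by rewrite -[log_inv_1m _]/(f t) (fg t Dt Nt) leeDl.
  rewrite (@ae_eq_integral _ (measurableTypeR R) _ mu D g (fun t => g t + k t)%E (@mD R))//.
  + by apply: emeasurable_funD; exact: measurable_funTS.
  + exact: measurable_funTS.
  + by apply: aeN => t Nt _; rewrite /k patchE memNset// adde0.
Qed.

End Boundary.

(** * From geometric decay of [||w phi^(4^i)||^2] to the logarithmic condition *)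

Section LogIntegral.
Variable R : realType.
Implicit Types (w v phi : R[i] -> R[i]) (u : R -> R) (r x s : R).
Local Notation mu := (@lebesgue_measure R).
Local Notation D := (`[0%R, 1%R]%classic : set R).

Lemma II_pois_le z u (U : R) : modc z < 1 -> itg u -> (forall t, u t <= U) ->
  II (fun t => pois z t * u t) <= U.
Proof.
move=> z1 iu uU.
have -> : U = II (fun t => U * pois z t).
  by rewrite IIZ ?II_pois ?mulr1//; exact: itg_pois.
apply: le_II; [exact: itg_poisM|apply: itgZ; exact: itg_pois|] => t.
by rewrite [leRHS]mulrC ler_wpM2l// ltW// pois_gt0.
Qed.

(* Multiply w by the outer function exp (herglotz u / 2) and let the radius of
   the circle on which the latter is evaluated tend to 1. *)
Lemma jensen_exp w r u (U : R) : analytic_disk w -> 0 <= r < 1 -> mfun u ->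
  (forall t, `|u t| <= U) ->
  modc (w 0) ^+ 2 * expR (II u) <= II (fun t => modc (circ w r t) ^+ 2 * expR (u t)).
Proof.
move=> wa r01 mu_ uU; have /andP[r0 r1] := r01.
have iu : itg u := itg_bd mu_ uU.
have uU' t : u t <= U by exact: le_trans (ler_norm _) (uU t).
have ha := analytic_herglotz iu; set H := herglotz u in ha.
pose rho n : R := 1 - (1 - r) / n.+2%:R.
have d0 : 0 < 1 - r by rewrite subr_gt0.
have rho1 n : rho n < 1 by rewrite ltrBlDr ltrDl divr_gt0.
have rrho n : r < rho n.
  rewrite ltrBrDl -ltrBrDr ltr_pdivrMr// ltr_pMr// ltr1n//.
have rho0 n : 0 < rho n by rewrite (le_lt_trans r0).
have rho01 n : 0 <= rho n < 1 by rewrite (ltW (rho0 n)) rho1.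
have rho_cvg : rho n @[n --> \oo] --> (1 : R).
  apply/cvgrPdist_le => e e0; have e1 : 0 < e / (1 - r) by rewrite divr_gt0.
  have [N HN] := invn_small e1; exists N => // n /= Nn.
  have -> : 1 - rho n = (1 - r) / n.+2%:R by rewrite /rho; ring.
  rewrite ger0_norm ?divr_ge0 ?(ltW d0)// mulrC -ler_pdivlMr//.
  exact: (HN n.+1 (leqW Nn)).
have [B B0 wB] := circ_bounded wa r01.
pose f n t := modc (circ w r t) ^+ 2 * expR (Re (circ H (rho n) t)).
pose f0 t := modc (circ w r t) ^+ 2 * expR (u t).
have mw := mfun_sqr_modc (cmf_circ wa r01).
have mf n : mfun (f n).
  apply: measurable_funM => //.
  by apply: (@measurableT_comp _ _ _ _ _ _ expR) => //; exact: (cmf_circ ha (rho01 n)).1.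
have mf0 : mfun f0.
  by apply: measurable_funM => //; apply: (@measurableT_comp _ _ _ _ _ _ expR).
have ReH n t : Re (circ H (rho n) t) <= U.
  by rewrite Re_herglotz II_pois_le// modc_circ// ltW.
have fB n t : `|f n t| <= B ^+ 2 * expR U.
  rewrite /f ger0_norm ?(mulr_ge0 (sqr_ge0 _) (expR_ge0 _))//.
  apply: ler_pM; [exact: sqr_ge0|exact: expR_ge0| |by rewrite ler_expR; exact: ReH].
  by rewrite lerXn2r ?nnegrE ?modc_ge0.
have [_ C] : itg f0 /\ II (f n) @[n --> \oo] --> II f0.
  apply: (@II_dct _ f f0 (fun=> B ^+ 2 * expR U)) => //; first exact: itg_cst.
  apply: ae_imp (poisson_cvg mu_ uU) => t h Dt.
  have {}h := h Dt.
  have c1 : II (fun s => pois ((rho n)%:C * ee t) s * u s) @[n --> \oo] --> u t.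
    by move/cvg_at_leftP : h; apply; split.
  apply: cvgM; first exact: cvg_cst.
  apply: (@cvg_comp _ _ _ (fun n => Re (circ H (rho n) t)) expR _ (nbhs (u t))); last exact: continuous_expR.
  apply: cvg_trans c1; apply: near_eq_cvg; apply: nearW => n.
  by rewrite /circ Re_herglotz.
apply: (cvg_ge_cst C); apply: nearW => n.
pose c := r / rho n.
have c01 : 0 <= c <= 1 by rewrite divr_ge0 ?(ltW (rho0 n))//= ler_pdivrMr// mul1r ltW.
(* On the circle of radius [rho n], [|G|^2] is [|w|^2] on the circle of radius [r] times
   [exp (Re H)]; at 0 it is the left-hand side. The mean value inequality for [G] is thus the claim
   for the approximation [Re H] of [u]. *)
pose G z := w (c%:C * z) * cexp ((2^-1)%:C * H z).
have Ga : analytic_disk G.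
  apply: analyticM; first exact: analytic_scale c01 wa.
  by apply: analytic_cexp; exact: analyticZ _ ha.
have E (x : R) (a b : R[i]) : Re b = x ->
    modc (a * cexp ((2^-1)%:C * b)) ^+ 2 = modc a ^+ 2 * expR x.
  move=> bx; rewrite modcM modc_cexp ReMr bx exprMn -expRM_natl mulrA.
  by rewrite divff ?mul1r// pnatr_eq0.
have := mean_value_sqr Ga (rho01 n).
rewrite /G mulr0 (E (II u))//; last by rewrite /H herglotz0.
congr (_ <= _); apply: eq_II => t; rewrite /circ (E _ _ _ erefl) /f; congr (modc (w _) ^+ 2 * _).
by rewrite mulrA -rmorphM /= /c divfK// gt_eqF.
Qed.

(** Bernoulli's inequality with the full exponent [4^i] would only give 0; half of it gives [1/2],
    and squaring gives [1/4]. *)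
Lemma pow_lacunary_ge (x : R) i : (0 < i)%N -> 1 - 4^-1 ^+ i <= x -> 4^-1 <= x ^+ (4 ^ i).
Proof.
case: i => // i _ hx; pose h : R := 4^-1 ^+ i.+1.
have h0 : 0 <= h by rewrite exprn_ge0// invr_ge0.
have h1 : h <= 1 by rewrite exprn_ile1 ?invr_ge0// invf_le1// ler1n.
have B := @bernoulli_ge R h (2 * 4 ^ i); rewrite h0 h1 in B.
have {}B := B isT.
have E : (2 * 4 ^ i)%:R * h = 2^-1.
  rewrite /h exprS natrM natrX exprVn.
  have : 4 ^+ i != 0 :> R by rewrite expf_neq0.
  by move: (4 ^+ i) => p p0; field.
have y0 : 2^-1 <= (1 - h) ^+ (2 * 4 ^ i).
  by apply: le_trans B; rewrite E; lra.
have x0 : 0 <= 1 - h by rewrite subr_ge0.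
have x1 : (1 - h) ^+ (2 * 4 ^ i) <= x ^+ (2 * 4 ^ i).
  by rewrite lerXn2r// nnegrE (le_trans x0).
rewrite (_ : (4 ^ i.+1 = (2 * 4 ^ i) * 2)%N); last by rewrite expnS mulnAC.
rewrite exprM; have := le_trans y0 x1; move: (x ^+ _) => y hy.
have -> : 4^-1 = 2^-1 ^+ 2 :> R by field.
by rewrite lerXn2r// nnegrE ?invr_ge0// (le_trans _ hy)// invr_ge0.
Qed.

(** A partial sum of the lacunary series [G]: its logarithm is bounded on circles, as Jensen's
    inequality requires. *)
Definition lac s n x : R := 1 + \sum_(i < n) s ^+ i * x ^+ (4 ^ i).

Lemma lac_ge1 s n x : 0 <= s -> 0 <= x -> 1 <= lac s n x.
Proof.
by move=> s0 x0; rewrite lerDl sumr_ge0// => i _; rewrite mulr_ge0 ?exprn_ge0.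
Qed.

(** For the least [m] with [4^-m < 1 - x], the term of index [m - 1] is at least [s^(m-1) / 4],
    while [- ln (1 - x) <= m ln 4]. The last hypothesis ensures that this term belongs to the
    partial sum. *)
Lemma ln_lac s n x : 1 < s -> 0 <= x < 1 -> 4^-1 ^+ n < 1 - x ->
  - ln (1 - x) <= ln 4 / ln s * ln (lac s n x) + (ln 4 / ln s * ln 4 + ln 4).
Proof.
move=> s1 /andP[x0 x1] hn.
have s0 : 0 < s by rewrite (lt_trans ltr01).
have ls : 0 < ln s by rewrite ln_gt0.
have l4 : 0 < ln 4 :> R by rewrite ln_gt0// ltr1n.
have A0 : 0 < ln 4 / ln s by rewrite divr_gt0.
have G1 := lac_ge1 n (ltW s0) x0.
have lG : 0 <= ln (lac s n x) by rewrite ln_ge0.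
have exn : exists m, 4^-1 ^+ m < 1 - x by exists n.
case: (ex_minnP exn) => -[|i] Hi min.
  by move: Hi; rewrite expr0 ltrBrDr gtrDl ltNge x0.
have b1 : - ln (1 - x) <= i.+1%:R * ln 4.
  rewrite lerNl -mulrN -lnV ?posrE// mulr_natl -lnXn ?invr_gt0//.
  by rewrite ler_ln ?posrE ?exprn_gt0 ?invr_gt0 ?subr_gt0// ltW.
case: i Hi min b1 => [|i] Hi min b1.
  rewrite (le_trans b1)// mul1r addrA lerDr.
  by rewrite addr_ge0 ?(mulr_ge0 (ltW A0) lG) ?(mulr_ge0 (ltW A0) (ltW l4)).
have hx : 1 - 4^-1 ^+ i.+1 <= x.
  have : 1 - x <= 4^-1 ^+ i.+1 by rewrite leNgt; apply/negP => /min; rewrite ltnn.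
  by lra.
have P := pow_lacunary_ge (ltn0Sn i) hx.
have im : (i.+1 < n)%N by apply: min.
have Gs : s ^+ i.+1 * 4^-1 <= lac s n x.
  rewrite /lac (bigD1 (Ordinal im))//= addrCA.
  apply: (@le_trans _ _ (s ^+ i.+1 * x ^+ (4 ^ i.+1))).
    by rewrite ler_pM2l ?exprn_gt0.
  by rewrite lerDl addr_ge0// sumr_ge0// => j _; rewrite mulr_ge0 ?exprn_ge0// ltW.
have b2 : i.+1%:R * ln s - ln 4 <= ln (lac s n x).
  rewrite -lnV ?posrE// mulr_natl -lnXn// -lnM ?posrE ?exprn_gt0 ?invr_gt0//.
  by rewrite ler_ln ?posrE ?mulr_gt0 ?exprn_gt0 ?invr_gt0// (lt_le_trans _ G1).
have b3 : i.+1%:R * ln 4 <= ln 4 / ln s * (ln (lac s n x) + ln 4).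
  have -> : i.+1%:R * ln 4 = ln 4 / ln s * (i.+1%:R * ln s).
    by rewrite mulrACA mulrC mulrA [_ * i.+1%:R]mulrC -!mulrA mulVf ?mulr1// gt_eqF.
  by rewrite ler_pM2l//; lra.
rewrite (le_trans b1)// -[i.+2%:R]natr1 mulrDl mul1r addrA lerD2r.
by rewrite (le_trans b3)// mulrDr.
Qed.

Lemma ln_lac_circ phi r s n : analytic_selfmap phi -> 0 <= r < 1 -> 1 < s ->
  let u t := ln (lac s n (modc (circ phi r t) ^+ 2)) in
  mfun u /\ forall t, `|u t| <= ln (1 + \sum_(i < n) s ^+ i).
Proof.
move=> ps r01 s1 u; have [pa _] := ps.
have s0 : 0 < s by rewrite (lt_trans ltr01).
pose x t := modc (circ phi r t) ^+ 2.
have x0 t : 0 <= x t by rewrite sqr_ge0.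
have x1 t : x t <= 1 by rewrite expr_le1 ?modc_ge0// ltW// selfmap_circ.
have mx : mfun x by apply: mfun_sqr_modc; exact: cmf_circ.
have G1 t : 1 <= lac s n (x t) by apply: lac_ge1 => //; exact: ltW.
have G0 t : 0 < lac s n (x t) by rewrite (lt_le_trans ltr01).
have Gs t : lac s n (x t) <= 1 + \sum_(i < n) s ^+ i.
  rewrite lerD2l; apply: ler_sum => i _; rewrite ler_piMr ?exprn_ge0 ?(ltW s0)//.
  by rewrite exprn_ile1.
split.
  apply: (@measurableT_comp _ _ _ _ _ _ (@ln R)) => //.
  apply: measurable_funD; first exact: measurable_cst.
  apply: measurable_sum => i; apply: measurable_funM; first exact: measurable_cst.
  exact: measurable_funX.
move=> t; rewrite /u -/(x t) ger0_norm ?ln_ge0// ler_ln ?posrE//.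
exact: lt_le_trans ltr01 (le_trans (G1 t) (Gs t)).
Qed.

Lemma cvg_log_inv (x : nat -> R) (l : R) : (forall n, 0 <= x n < 1) ->
  x n @[n --> \oo] --> l ->
  (- ln (1 - x n))%:E @[n --> \oo] --> log_inv_1m l.
Proof.
move=> x01 xl; rewrite /log_inv_1m; case: ifPn => [l1|].
  have p : 0 < 1 - l by rewrite subr_gt0.
  rewrite lnV ?posrE//; apply: cvg_EFin; first exact: nearW.
  apply: cvgN; apply: (@cvg_comp _ _ _ (fun n => 1 - x n) (@ln R) _ (nbhs (1 - l))).
    by apply: cvgB => //; exact: cvg_cst.
  exact: continuous_ln.
rewrite -leNgt => l1; apply/cvgeyPge => A.
have e0 : 0 < expR (- A) by exact: expR_gt0.
have /cvgrPdist_le/(_ _ e0) := xl; apply: filterS => n hn.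
have /andP[x0 x1] := x01 n.
have p : 0 < 1 - x n by rewrite subr_gt0.
rewrite lee_fin lerNr -[leRHS](expRK (- A)) ler_ln ?posrE//.
by move: hn; rewrite ler_norml => /andP[_]; lra.
Qed.

Lemma log_condition_of_decay w phi (C q : R) : analytic_selfmap phi -> H2 w ->
  nonzero_disk w -> 0 <= C -> 0 <= q < 1 ->
  (forall i, (h2_nsq (fun z => w z * phi z ^+ (4 ^ i))%R <= (C * q ^+ i)%:E)%E) ->
  log_condition phi.
Proof.
move=> ps [wa wh] wn C0 /andP[q0 q1] Hi; have [pa p1] := ps.
(* A positive rate is needed to define [s], which is chosen so that [s > 1] while
   [s q' = (1 + q') / 2 < 1]. *)
pose q' := Num.max q 2^-1.
have q'0 : 0 < q' by rewrite lt_max invr_gt0 ltr0n orbT.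
have q'1 : q' < 1 by rewrite gt_max q1 invf_lt1// ltr1n.
pose s := (1 + q') / (2 * q').
have sq : s * q' = (1 + q') / 2 by rewrite /s; field; rewrite gt_eqF.
have s1 : 1 < s by rewrite ltr_pdivlMr ?mulr_gt0//; lra.
have s0 : 0 < s by rewrite (lt_trans ltr01).
have sig : 0 <= s * q' < 1.
  by rewrite sq divr_ge0 ?addr_ge0 ?(ltW q'0)//= ltr_pdivrMr//; lra.
have [k [v [va v0 wv]]] := factor_zero wa wn.
pose W := fine (h2_nsq w).
have WE : h2_nsq w = W%:E by rewrite fineK// ge0_fin_numE// h2_nsq_ge0.
have v00 : 0 < modc (v 0) ^+ 2 by rewrite exprn_gt0// modc_gt0.
(* On circles of radius at least [1/2], [|v|^2 <= 4^k |w|^2]. The bracket bounds the integral of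
   [|w|^2 G(|phi|^2)] by [||w||^2] and a geometric series of ratio [s q']. *)
pose S := 4 ^+ k * (W + C / (1 - s * q')).
pose L := ln (S / modc (v 0) ^+ 2).
have main r n : 2^-1 <= r < 1 ->
    II (fun t => ln (lac s n (modc (circ phi r t) ^+ 2))) <= L.
  move=> /andP[r2 r1]; have r0 : 0 < r by rewrite (lt_le_trans _ r2)// invr_gt0.
  have r01 : 0 <= r < 1 by rewrite ltW.
  pose x t := modc (circ phi r t) ^+ 2.
  have x0 t : 0 <= x t by rewrite sqr_ge0.
  have x1 t : x t <= 1 by rewrite expr_le1 ?modc_ge0// ltW// selfmap_circ.
  have G1 t : 1 <= lac s n (x t) by apply: lac_ge1 => //; exact: ltW.
  have G0 t : 0 < lac s n (x t) by rewrite (lt_le_trans ltr01).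
  have [mu_ uU] := ln_lac_circ n ps r01 s1.
  set u := fun t => _ in mu_; set U := ln _ in uU.
  have J := jensen_exp va r01 mu_ uU.
  have iw i : itg (fun t => modc (circ (fun z => w z * phi z ^+ (4 ^ i)) r t) ^+ 2).
    by apply: itg_circ; [exact: (analyticM wa (analyticX _ pa))|exact: r01].
  have iw0 : itg (fun t => modc (circ w r t) ^+ 2) by exact: itg_circ.
  have E t : modc (circ w r t) ^+ 2 * lac s n (x t) = modc (circ w r t) ^+ 2 +
     \sum_(i < n) s ^+ i * modc (circ (fun z => w z * phi z ^+ (4 ^ i)) r t) ^+ 2.
    rewrite /lac mulrDr mulr1 mulr_sumr; congr (_ + _); apply: eq_bigr => i _.
    rewrite mulrCA; congr (_ * _); rewrite /x [in RHS]/circ modcM modcX [in RHS]exprMn.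
    by congr (_ * _); rewrite exprAC.
  have B1 : II (fun t => modc (circ v r t) ^+ 2 * expR (u t)) <= S.
    apply: (@le_trans _ _ (II (fun t => 4 ^+ k * (modc (circ w r t) ^+ 2 +
       \sum_(i < n) s ^+ i * modc (circ (fun z => w z * phi z ^+ (4 ^ i)) r t) ^+ 2)))).
      have iR : itg (fun t => modc (circ w r t) ^+ 2 +
         \sum_(i < n) s ^+ i * modc (circ (fun z => w z * phi z ^+ (4 ^ i)) r t) ^+ 2).
        by apply: itgD => //; apply: itg_sum => i; exact: itgZ.
      have [B B0 vB] := circ_bounded va r01.
      apply: le_II; last first.
      - move=> t; have -> : expR (u t) = lac s n (x t) by apply: lnK; rewrite posrE; exact: G0.
        rewrite -E mulrA; apply: (ler_wpM2r (ltW (G0 t))).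
        rewrite /circ wv ?modc_circ ?(ltW r0)// modcM modcX modc_circ ?(ltW r0)//.
        rewrite exprMn mulrA ler_peMl ?sqr_ge0// -exprM mulnC exprM -exprMn.
        rewrite exprn_ege1//.
        have : 2^-1 ^+ 2 <= r ^+ 2 by rewrite lerXn2r ?nnegrE ?invr_ge0// ltW.
        by lra.
      - exact: itgZ.
      - apply: (@itg_bd _ _ (B ^+ 2 * expR U)).
          apply: measurable_funM; first by apply: mfun_sqr_modc; exact: cmf_circ.
          by apply: (@measurableT_comp _ _ _ _ _ _ expR).
        move=> t; rewrite ger0_norm; last exact: (mulr_ge0 (sqr_ge0 _) (expR_ge0 _)).
        apply: ler_pM; [exact: sqr_ge0|exact: expR_ge0| |].
          by rewrite lerXn2r ?nnegrE ?modc_ge0.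
        by rewrite ler_expR (le_trans (ler_norm _))// uU.
    rewrite IIZ; last by apply: itgD => //; apply: itg_sum => i; exact: itgZ.
    rewrite ler_wpM2l ?exprn_ge0// IID//; last by apply: itg_sum => i; exact: itgZ.
    rewrite lerD//; first by rewrite -lee_fin -WE; exact: II_le_h2.
    rewrite II_sum => [|i]; last exact: itgZ.
    have geo := geo_le 0 n sig; rewrite expr0 mul1r big_mkord in geo.
    rewrite (le_trans _ (ler_wpM2l C0 geo))// mulr_sumr; apply: ler_sum => i _.
    rewrite IIZ; last exact: iw.
    rewrite [(s * q') ^+ i]exprMn mulrCA; apply: ler_wpM2l; first exact: exprn_ge0 (ltW s0).
    rewrite -lee_fin; apply: le_trans (II_le_h2 _ r01) _.
      exact: (analyticM wa (analyticX _ pa)).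
    apply: le_trans (Hi i) _; rewrite lee_fin ler_wpM2l// lerXn2r ?nnegrE ?(ltW q'0)//.
    by rewrite le_max lexx.
  have J2 := le_trans J B1.
  rewrite -[leLHS]expRK ler_ln ?posrE ?expR_gt0//.
    by rewrite ler_pdivlMr// mulrC.
  by rewrite divr_gt0// (lt_le_trans _ J2)// mulr_gt0// expR_gt0.
have [b [mb bB bl _]] := boundary_function ps.
apply/(log_conditionP mb bl).
pose A := ln 4 / ln s.
have A0 : 0 < A by rewrite divr_gt0// ln_gt0// ltr1n.
pose L' := ln 2 + (A * L + (A * ln 4 + ln 4)).
pose rho m : R := 1 - m.+2%:R^-1.
have rho1 m : 2^-1 <= rho m < 1.
  rewrite ltrBlDr ltrDl invr_gt0 ltr0Sn andbT.
  have : m.+2%:R^-1 <= 2^-1 :> R by rewrite lef_pV2 ?posrE// ler_nat.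
  by rewrite /rho; move: (m.+2%:R^-1) => y; lra.
have rho01 m : 0 <= rho m < 1.
  by have /andP[h ->] := rho1 m; rewrite (le_trans _ h)// invr_ge0.
pose F m t : \bar R := (- ln (1 - modc (circ phi (rho m) t)))%:E.
have F0 m t : (0 <= F m t)%E.
  rewrite lee_fin oppr_ge0 ln_le0// lerBlDr lerDl modc_ge0//.
have mFr m : mfun (fun t => - ln (1 - modc (circ phi (rho m) t))).
  apply: measurableT_comp => //; apply: (@measurableT_comp _ _ _ _ _ _ (@ln R)) => //.
  by apply: measurable_funB; [exact: measurable_cst|apply: mfun_modc; exact: cmf_circ].
have mF m : @measurable_fun _ _ (measurableTypeR R) _ D (F m).
  by apply/measurable_EFinP; exact: (measurable_funTS (mFr m)).
(* On a fixed circle [|phi| <= sr < 1], so some [n], depending on [m], meets the hypothesis of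
   [ln_lac] at every point; the bound [L] does not depend on [n], so [L'] serves all circles. *)
have FL m : (\int[mu]_(t in D) F m t <= L'%:E)%E.
  have /andP[rm0 rm1] := rho01 m.
  have [sr sr1 Hs] := selfmap_compact ps rm1.
  pose y t := modc (circ phi (rho m) t).
  have y0 t : 0 <= y t by exact: modc_ge0.
  have ys t : y t <= sr by apply: Hs; rewrite modc_circ.
  have sr0 : 0 <= sr by rewrite (le_trans (y0 0)).
  have sr2 : 0 < 1 - sr ^+ 2 by rewrite subr_gt0 expr_lt1.
  have [n hn] : exists n, 4^-1 ^+ n < 1 - sr ^+ 2.
    have q01 : (0 <= 4^-1 :> R) && (4^-1 < 1 :> R) by rewrite invr_ge0 ler0n invf_lt1// ltr1n.
    have e2 : 0 < (1 - sr ^+ 2) / 2 by rewrite divr_gt0.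
    have [N HN] := expr_small 1 q01 e2; exists N.
    have := HN _ (leqnn _); rewrite mul1r => h; rewrite (le_lt_trans h)//.
    by rewrite ltr_pdivrMr// ltr_pMr// ltr1n.
  have [mu_ uU] := ln_lac_circ n ps (rho01 m) s1.
  set u := fun t => _ in mu_; set U := ln _ in uU.
  have iu : itg u := itg_bd mu_ uU.
  have iF : itg (fun t => - ln (1 - y t)).
    apply: (@itg_bd _ _ (- ln (1 - sr))) => [|t]; first exact: mFr.
    have yt := ys t; have yt0 := y0 t.
    rewrite ger0_norm; last by rewrite oppr_ge0 ln_le0// lerBlDr lerDl.
    by rewrite lerN2 ler_ln ?posrE ?subr_gt0// ?lerD2l ?lerN2// (le_lt_trans yt).
  rewrite -EFin_II// lee_fin.
  have iA : itg (fun t => A * u t + (A * ln 4 + ln 4)).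
    by apply: itgD; [exact: itgZ|exact: itg_cst].
  apply: (@le_trans _ _ (II (fun t => ln 2 + (A * u t + (A * ln 4 + ln 4))))).
    apply: le_II => //; first by apply: itgD => //; exact: itg_cst.
    move=> t; have yt := ys t; have yt0 := y0 t.
    have yt1 : y t < 1 by rewrite (le_lt_trans yt).
    have x01 : 0 <= y t ^+ 2 < 1 by rewrite sqr_ge0 expr_lt1.
    have hx : 4^-1 ^+ n < 1 - y t ^+ 2.
      by rewrite (lt_le_trans hn)// lerD2l lerN2 lerXn2r// nnegrE.
    have := ln_lac s1 x01 hx; rewrite -/A -/(u t) => h.
    (* The passage from [|phi|^2] to [|phi|]: [1 - y^2 <= 2 (1 - y)], whence the [ln 2] in [L']. *)
    have : ln (1 - y t ^+ 2) <= ln 2 + ln (1 - y t).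
      have p : 0 < 1 - y t by rewrite subr_gt0.
      rewrite -lnM ?posrE// ler_ln ?posrE ?mulr_gt0//; first by nra.
      by case/andP : x01 => _; rewrite subr_gt0.
    by lra.
  rewrite IID//; last exact: itg_cst.
  rewrite IID; [|exact: itgZ|exact: itg_cst].
  rewrite !II_cst IIZ// /L' lerD2l lerD2r ler_wpM2l ?(ltW A0)//.
  exact: main (rho1 m).
apply: (@le_lt_trans _ _ L'%:E); last by rewrite ltry.
have Fat := @fatou _ (measurableTypeR R) _ mu D (@mD R) F mF (fun m t _ => F0 m t).
apply: (@le_trans _ _ (limn_einf (fun m => \int[mu]_(t in D) F m t)%E)); last first.
  rewrite limn_einf_lim; apply: lime_le; first exact: is_cvg_einfs.
  apply: nearW => m; apply: le_trans (FL m); apply: ereal_inf_lbound.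
  by exists m => /=.
apply: le_trans Fat; apply: ae_ge0_le_integral.
- exact: mD.
- by move=> t _; apply: log_inv_1m_ge0; exact: modc_ge0.
- by apply: measurable_funTS; exact: measurable_log_inv.
- move=> t _; rewrite limn_einf_lim; apply: lime_ge; first exact: is_cvg_einfs.
  by apply: nearW => m; apply: le_ereal_inf_tmp => _ [j _ <-]; exact: F0.
- rewrite /limn_einf; apply: measurableT_comp => //.
  by apply: measurable_fun_limn_esup => m; apply: measurableT_comp => //; exact: mF.
apply: ae_imp bl => t h Dt; have {}h := h Dt.
have rho_cvg : rho n @[n --> \oo] --> (1 : R).
  apply/cvgrPdist_le => e /invn_small[N HN]; exists N => // n /= Nn.
  have -> : 1 - rho n = n.+2%:R^-1 by rewrite /rho; ring.
  by rewrite ger0_norm ?invr_ge0//; exact: (HN n.+1 (leqW Nn)).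
have c : modc (circ phi (rho n) t) @[n --> \oo] --> modc (b t).
  have {}h : modc (phi (r%:C * ee t)) @[r --> 1^'-] --> modc (b t) by exact: cvg_modc h.
  by apply: ((cvg_at_leftP _ _ _).1 h); split => // n; case/andP : (rho01 n).
have x01 n : 0 <= modc (circ phi (rho n) t) < 1 by rewrite modc_ge0 selfmap_circ.
have [-> _] := cvg_limn_einf_sup (cvg_log_inv x01 c).
by [].
Qed.

End LogIntegral.

(** * Unitary changes of basis and finite rank approximation *)

Section FiniteRank.
Variable R : realType.
Implicit Types (f g w phi : R[i] -> R[i]) (n M : nat) (T F : op R).
Local Open Scope sesquilinear_scope.

(** The first [k] rows of [U] orthonormalize a basis of the left kernel of [c], whose dimension is
    at least [M - n] by rank-nullity; the other rows complete them. *)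
Lemma unitary_kernel M n (c : 'M[R[i]]_(M, n)) :
  exists (U : 'M[R[i]]_M) (k : nat), [/\ U *m U ^t* = 1%:M, U ^t* *m U = 1%:M,
    (M <= k + n)%N & forall (i : 'I_M) l, (i < k)%N -> \sum_j U i j * c j l = 0].
Proof.
(* The completed family has a sum of two ranks as its number of rows, equal to [M] only
   propositionally; the row count is generalized before substitution. *)
have gen m (S : 'M[R[i]]_(m, M)) k : m = M -> S \is unitarymx -> (M <= k + n)%N ->
    (forall (i : 'I_m) l, (i < k)%N -> \sum_j S i j * c j l = 0) ->
    exists (U : 'M[R[i]]_M) (k : nat), [/\ U *m U ^t* = 1%:M, U ^t* *m U = 1%:M,
    (M <= k + n)%N & forall (i : 'I_M) l, (i < k)%N -> \sum_j U i j * c j l = 0].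
  move=> e; subst m => /unitarymxP uS Mk HS; exists S, k; split => //.
  exact: mulmx1C.
apply: (gen _ (schmidt_complete (kermx c)) (\rank (kermx c))).
- exact: add_rank_ortho.
- exact: schmidt_complete_unitarymx.
- by rewrite mxrank_ker addnC -leq_subLR leq_sub2l// rank_leq_col.
move=> i l ik; have -> : i = lshift _ (Ordinal ik) by apply: val_inj.
have : (schmidt (row_base (kermx c)) <= kermx c)%MS.
  by rewrite (eqmx_schmidt_free (row_base_free _)) eq_row_base.
move/sub_kermxP/matrixP/(_ (Ordinal ik) l); rewrite !mxE => E; rewrite -[RHS]E.
by apply: eq_bigr => j _; rewrite /schmidt_complete col_mxEu.
Qed.

Lemma unitary_row M (U : 'M[R[i]]_M) i : U *m U ^t* = 1%:M ->
  \sum_j modc (U i j) ^+ 2 = 1.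
Proof.
move=> /matrixP/(_ i i); rewrite !mxE eqxx => h.
have : ((\sum_j modc (U i j) ^+ 2)%:C = 1%:C :> R[i])%C.
  rewrite rmorph_sum -[RHS]h; apply: eq_bigr => j _; by rewrite !mxE; apply/esym; exact: mulcJ.
by case.
Qed.

Lemma unitary_sum M (U : 'M[R[i]]_M) (a : 'I_M -> R[i]) : U ^t* *m U = 1%:M ->
  \sum_k modc (\sum_j U k j * a j) ^+ 2 = \sum_j modc (a j) ^+ 2.
Proof.
move=> UU; pose v : 'cV[R[i]]_M := \col_j a j.
have E : (U *m v) ^t* *m (U *m v) = v ^t* *m v.
  by rewrite trmx_mul map_mxM -mulmxA [_ ^t* *m (U *m v)]mulmxA UU mul1mx.
have nE (x : 'cV[R[i]]_M) : (x ^t* *m x) 0 0 = (\sum_k modc (x k 0) ^+ 2)%:C.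
  rewrite mxE rmorph_sum; apply: eq_bigr => k _; by rewrite !mxE mulrC; exact: mulcJ.
move/matrixP : E => /(_ 0 0); rewrite !nE => -[] E.
transitivity (\sum_k modc ((U *m v) k 0) ^+ 2).
  by apply: eq_bigr => k _; rewrite mxE; under [in RHS]eq_bigr do rewrite mxE.
by rewrite E; apply: eq_bigr => k _; rewrite mxE.
Qed.

Lemma has_taylor_zero : has_taylor (fun _ : nat => 0 : R[i]) (fun=> 0).
Proof.
move=> z _; apply/cvgcP => e e0; apply: nearW => n.
by rewrite /series /= big1 ?subrr ?modc0// => k _; rewrite mul0r.
Qed.

Lemma has_taylor_lincomb (I : Type) (s : seq I) (a : I -> nat -> R[i]) (f : I -> R[i] -> R[i])
    (c : I -> R[i]) : (forall i, has_taylor (a i) (f i)) ->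
  has_taylor (fun k => \sum_(i <- s) c i * a i k) (fun z => \sum_(i <- s) c i * f i z).
Proof.
move=> fa; elim: s => [|i s IH].
  rewrite (_ : (fun k => _) = (fun=> 0)); last by apply/funext => k; rewrite big_nil.
  rewrite (_ : (fun z => _) = (fun=> 0)); last by apply/funext => k; rewrite big_nil.
  exact: has_taylor_zero.
have := @has_taylorZD _ _ _ _ _ (c i) IH (fa i).
by congr has_taylor; apply/funext => k; rewrite big_cons addrC.
Qed.

(** The invariance of the Hilbert-Schmidt sum, obtained by applying [U] to the vector of [l]-th
    Taylor coefficients for each [l]. *)
Lemma unitary_h2 M (U : 'M[R[i]]_M) (f : 'I_M -> R[i] -> R[i]) :
  U ^t* *m U = 1%:M -> (forall j, analytic_disk (f j)) ->
  (\sum_k h2_nsq (fun z => \sum_j U k j * f j z)%R = \sum_j h2_nsq (f j))%E.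
Proof.
move=> UU fa; have fa' j := analytic_taylor (fa j).
pose a j := taylor_coef (f j).
have E k := @has_taylor_lincomb _ (index_enum _) _ _ (U k) fa'.
transitivity (\sum_k \sum_(0 <= l <oo) (modc (\sum_j U k j * a j l) ^+ 2)%:E)%E.
  by apply: eq_bigr => k _; exact: (h2_nsqE (E k)).
rewrite -nneseries_sum => [|k l _]; last by rewrite lee_fin sqr_ge0.
rewrite -nneseries_sum => [|k l _]; last by rewrite lee_fin sqr_ge0.
apply: eq_eseriesr => l _; rewrite !sumEFin; congr (_%:E).
exact: (unitary_sum (fun j => a j l) UU).
Qed.

Lemma has_taylor_monomials (x : nat -> R[i]) M :
  has_taylor (fun l => if (l < M)%N then x l else 0) (fun z => \sum_(l < M) x l * z ^+ l).
Proof.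
move=> z z1; apply/cvgcP => e e0; exists M => // n /= Mn.
rewrite /series /= (big_cat_nat (n := M))//= [X in _ + X - _]big_nat_cond [X in _ + X - _]big1 ?addr0; last first.
  by move=> k /andP[/andP[Mk _] _]; rewrite ltnNge Mk mul0r.
by rewrite big_mkord (eq_bigr (fun l : 'I_M => x l * z ^+ l)) ?subrr ?modc0// => l _; rewrite ltn_ord.
Qed.

Lemma h2_monomials_le (x : nat -> R[i]) M :
  (h2_nsq (fun z => \sum_(l < M) x l * z ^+ l)%R <= (\sum_(l < M) modc (x l) ^+ 2)%:E)%E.
Proof.
apply: (h2_le_partial (@has_taylor_monomials x M)) => n; rewrite lee_fin.
pose y l := modc (if (l < M)%N then x l else 0) ^+ 2.
have y0 l : 0 <= y l by exact: sqr_ge0.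
apply: (@le_trans _ _ (\sum_(0 <= l < n + M) y l)).
  by rewrite (big_cat_nat (n := n))//= ?leq_addr// big_mkord lerDl sumr_ge0.
rewrite (big_cat_nat (n := M))//= ?leq_addl// [X in _ + X]big_nat_cond.
rewrite [X in _ + X]big1 ?addr0.
  by rewrite big_mkord; apply: ler_sum => l _; rewrite /y ltn_ord.
by move=> l /andP[/andP[Ml _] _]; rewrite /y ltnNge Ml modc0 expr0n.
Qed.

Lemma H2_monomials (x : nat -> R[i]) M : H2 (fun z => \sum_(l < M) x l * z ^+ l).
Proof.
split; first by exists (fun l => if (l < M)%N then x l else 0); exact: has_taylor_monomials.
by rewrite (le_lt_trans (h2_monomials_le x M))// ltry.
Qed.

Lemma H2_exp n : H2 (fun z : R[i] => z ^+ n).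
Proof.
apply: (@H2_bounded _ _ 1); first exact: (analyticX n (analytic_id _)).
by move=> z z1; rewrite modcX exprn_ile1 ?modc_ge0// ltW.
Qed.

Lemma H2_0 : H2 (fun=> 0 : R[i]).
Proof. by apply: (@H2_bounded _ _ 0) => [|z _]; [exact: analytic_cst|rewrite modc0]. Qed.

(** Linearity comes as [F (f + c g) = F f + c F g] for functions in [H2]; the empty sum uses
    [F 0 = F 0 + F 0]. *)
Lemma finite_rank_monomials n F (x : nat -> R[i]) M : finite_rank_le n F ->
  F (fun z => \sum_(l < M) x l * z ^+ l) =
  (fun z => \sum_(l < M) x l * F (fun u => u ^+ l) z).
Proof.
move=> [lF _]; elim: M => [|M IH].
  have := lF _ _ 1 H2_0 H2_0.
  have -> : (fun=> 0 + 1 * 0 : R[i]) = (fun=> 0) :> (R[i] -> R[i]) by apply/funext => z; rewrite mulr0 addr0.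
  move=> E; apply/funext => z; rewrite big_ord0.
  have -> : (fun z : R[i] => \sum_(l < 0) x l * z ^+ l) = (fun=> 0).
    by apply/funext => u; rewrite big_ord0.
  have := congr1 (@^~ z) E; rewrite /= mul1r => /eqP.
  by rewrite -subr_eq0 opprD addrA subrr sub0r oppr_eq0 => /eqP.
rewrite (_ : (fun z => \sum_(l < M.+1) x l * z ^+ l) =
  (fun z => (\sum_(l < M) x l * z ^+ l) + x M * z ^+ M)); last first.
  by apply/funext => z; rewrite big_ord_recr.
rewrite lF; [|exact: H2_monomials|exact: H2_exp].
by rewrite IH; apply/funext => z; rewrite big_ord_recr.
Qed.

Lemma sum_threshold (B : R) k M :
  \sum_(i < M) (if (i < k)%N then 0 else B) = (M - k)%:R * B.
Proof.
elim: M => [|M IH]; first by rewrite big_ord0 mul0r.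
rewrite big_ord_recr /= IH; case: ltnP => [Mk|kM].
  by rewrite addr0 (eqP (ltnW Mk : (M - k == 0)%N)) (eqP (Mk : (M.+1 - k == 0)%N)).
by rewrite subSn// -natr1 mulrDl mul1r.
Qed.

(* Sum ||T e_j||^2 over the monomials and over a unitarily rotated basis most of
   whose elements lie in the kernel of F. *)
Lemma finite_rank_trace w phi n M F (a B : R) :
  analytic_disk w -> analytic_disk phi -> finite_rank_le n F -> 0 <= a -> 0 <= B ->
  (forall f, H2 f -> (h2_nsq f <= 1)%E -> (h2_nsq (wcomp w phi f) <= B%:E)%E) ->
  (forall f, H2 f -> (h2_nsq f <= 1)%E ->
     (h2_nsq (fun z => wcomp w phi f z - F f z)%R <= a%:E)%E) ->
  (\sum_(j < M) h2_nsq (fun z => w z * phi z ^+ j)%R <= (M%:R * a + n%:R * B)%:E)%E.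
Proof.
move=> wa pa rF a0 B0 HB Ha; have [_ [g [gH gF]]] := rF.
have [c cP] := choice (fun j => gF _ (H2_exp j)).
have [U [k [UU1 UU2 Mk Uc]]] := unitary_kernel (\matrix_(j < M, i < n) c j i).
have wpa (j : 'I_M) : analytic_disk (fun z => w z * phi z ^+ j).
  exact: (analyticM wa (analyticX j pa)).
rewrite -(unitary_h2 UU2 wpa).
apply: (@le_trans _ _ (\sum_(i < M) (a + (if (i < k)%N then 0 else B))%:E)%E); last first.
  rewrite sumEFin lee_fin big_split /= sum_threshold sumr_const card_ord -[a *+ M]mulr_natl.
  by rewrite lerD2l ler_wpM2r// ler_nat leq_subLR.
apply: lee_sum => i _.
(* Row [i] of [U] as a sequence on [nat], extended by 0; [u] is the corresponding unit vector among
   the polynomials of degree less than [M]. *)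
pose x l := oapp (U i) 0 (insub l).
have xE (j : 'I_M) : x j = U i j by rewrite /x valK.
pose u z : R[i] := \sum_(l < M) x l * z ^+ l.
have uH : H2 u := H2_monomials x M.
have u1 : (h2_nsq u <= 1)%E.
  rewrite (le_trans (h2_monomials_le x M))// lee_fin.
  by under eq_bigr do rewrite xE; rewrite unitary_row.
have TE : (fun z => \sum_j U i j * (w z * phi z ^+ j)) = wcomp w phi u.
  apply/funext => z; rewrite /wcomp /u mulr_sumr; apply: eq_bigr => j _.
  by rewrite xE mulrCA.
rewrite TE; case: ifPn => ik; last first.
  by apply: le_trans (HB _ uH u1) _; rewrite lee_fin lerDr.
(* For [i < k], row [i] annihilates the matrix [c] of coordinates of [F z^j] in the family [g]. *)
have Fu z : F u z = 0.
  rewrite /u (finite_rank_monomials x M rF).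
  under eq_bigr => j _ do rewrite xE cP mulr_sumr.
  rewrite exchange_big /= big1// => l _.
  have E : \sum_j U i j * c j l = 0.
    by rewrite -[RHS](Uc i l ik); apply: eq_bigr => j _; rewrite mxE.
  by under eq_bigr do rewrite mulrA; rewrite -mulr_suml E mul0r.
rewrite addr0; apply: le_trans (Ha _ uH u1).
rewrite (_ : (fun z => wcomp w phi u z - F u z) = wcomp w phi u)//.
by apply/funext => z; rewrite Fu subr0.
Qed.

End FiniteRank.

(** * Decay from the Hilbert-Schmidt and Schatten conditions *)

Section Necessity.
Variable R : realType.
Implicit Types (f g w phi : R[i] -> R[i]) (n M : nat) (T F : op R).

(** By monotonicity [(n + 1) u_n] is at most the sum of the first [n + 1] terms. *)
Lemma nonincreasing_summable (u : nat -> \bar R) : (forall n, (0 <= u n)%E) ->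
  (forall m n, (m <= n)%N -> (u n <= u m)%E) -> (\sum_(0 <= n <oo) u n < +oo)%E ->
  exists2 S : R, 0 <= S & forall n, (u n <= (S / n.+1%:R)%:E)%E.
Proof.
move=> u0 um uS; have S0 : (0 <= \sum_(0 <= n <oo) u n)%E by exact: nneseries_ge0.
have SE : (\sum_(0 <= n <oo) u n = (fine (\sum_(0 <= n <oo) u n))%:E)%E.
  by rewrite fineK// ge0_fin_numE.
have uP n : (\sum_(0 <= k < n) u k <= \sum_(0 <= n <oo) u n)%E.
  exact: nneseries_lim_ge.
exists (fine (\sum_(0 <= n <oo) u n)%E); first exact: fine_ge0.
move: (fine _) SE => S SE n.
have un : u n \is a fin_num.
  rewrite ge0_fin_numE// (le_lt_trans _ uS)// (le_trans _ (uP n.+1))//.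
  by rewrite big_nat_recr//= leeDr// sume_ge0.
rewrite -(fineK un) lee_fin ler_pdivlMr// -lee_fin -SE (le_trans _ (uP n.+1))//.
have -> : fine (u n) * n.+1%:R = \sum_(k < n.+1) fine (u n).
  by rewrite sumr_const card_ord mulr_natr.
rewrite big_mkord -sumEFin; apply: lee_sum => k _.
by rewrite fineK// um// -ltnS.
Qed.

Lemma h2_wcomp_mono w phi m n : analytic_disk w -> analytic_selfmap phi -> (m <= n)%N ->
  (h2_nsq (fun z => w z * phi z ^+ n)%R <= h2_nsq (fun z => w z * phi z ^+ m)%R)%E.
Proof.
move=> wa [pa p1] mn; apply: h2_mono.
- exact: (analyticM wa (analyticX n pa)).
- exact: (analyticM wa (analyticX m pa)).
move=> z z1; rewrite !modcM !modcX ler_wpM2l ?modc_ge0//.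
by rewrite ler_wiXn2l ?modc_ge0// ltW// p1.
Qed.

Lemma hilbert_schmidt_log w phi : analytic_selfmap phi -> H2 w -> nonzero_disk w ->
  hilbert_schmidt (wcomp w phi) -> log_condition phi.
Proof.
move=> ps wH wn [_ hs]; have [wa _] := wH.
have [S S0 HS] := @nonincreasing_summable (fun n => h2_nsq (fun z => w z * phi z ^+ n)%R)
  (fun n => h2_nsq_ge0 _) (fun m n => h2_wcomp_mono wa ps) hs.
have q01 : (0 <= 4^-1 :> R) && (4^-1 < 1 :> R) by rewrite invr_ge0 ler0n invf_lt1// ltr1n.
apply: (@log_condition_of_decay _ w phi S 4^-1 ps wH wn S0 q01) => i.
apply: le_trans (HS (4 ^ i)%N) _; rewrite lee_fin ler_wpM2l// exprVn -natrX.
by rewrite lef_pV2 ?posrE ?ltr0n ?expn_gt0// ler_nat.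
Qed.

Lemma finite_rank_leS n F : finite_rank_le n F -> finite_rank_le n.+1 F.
Proof.
move=> [lF [g [gH gF]]]; split => //.
exists (fun i => oapp g (fun=> 0) (unlift ord0 i)); split.
  by move=> i; case: (unlift ord0 i) => [j|] /=; [exact: gH|exact: H2_0].
move=> f /gF[c cE]; exists (fun i => oapp c 0 (unlift ord0 i)).
rewrite cE; apply/funext => z; rewrite big_ord_recl unlift_none /= mul0r add0r.
by apply: eq_bigr => j _; rewrite liftK.
Qed.

Lemma sing_sq_mono T m n : (m <= n)%N -> (sing_sq T n <= sing_sq T m)%E.
Proof.
move=> mn; apply: ereal_inf_le_tmp => _ [F /= rF <-]; exists F => //=.
rewrite -(subnK mn); elim: (n - m)%N => [//|k IH]; exact: finite_rank_leS.
Qed.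

Lemma opnorm_sq_ge0 T : (0 <= opnorm_sq T)%E.
Proof.
apply: (@le_trans _ _ (h2_nsq (T (fun=> 0)))); first exact: h2_nsq_ge0.
apply: ereal_sup_ubound; exists (fun=> 0) => //; split; first exact: H2_0.
have := @h2_bounded R (fun=> 0) 0 (@analytic_cst R 0) _; rewrite expr0n /= => h.
by apply: le_trans (h _) _ => // z _; rewrite modc0.
Qed.

Lemma sing_sq_ge0 T n : (0 <= sing_sq T n)%E.
Proof. by apply: le_ereal_inf_tmp => _ [F _ <-]; exact: opnorm_sq_ge0. Qed.

Lemma sing_sq_approx T n (e : R) : (sing_sq T n < e%:E)%E ->
  exists2 F, finite_rank_le n F & forall f, H2 f -> (h2_nsq f <= 1)%E ->
    (h2_nsq (fun z => T f z - F f z)%R <= e%:E)%E.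
Proof.
move=> /ereal_inf_lt[_ [F rF <-] h]; exists F => // f fH f1.
by apply: le_trans (ltW h); apply: ereal_sup_ubound; exists f.
Qed.

(** The summable sequence [s_n^p] is nonincreasing, hence [O(1 / n)]; along [n = 2^i] this is
    geometric decay of [s_n^2], with ratio [2^(- 2 / p)]. *)
Lemma schatten_decay (p : R) T : 0 < p -> schatten p T -> exists (C q : R),
  [/\ 0 <= C, 0 <= q < 1 & forall i, (sing_sq T (2 ^ i) <= (C * q ^+ i)%:E)%E].
Proof.
move=> p0 [_ hs]; have p20 : 0 < p / 2 by rewrite divr_gt0.
have fin n : sing_sq T n \is a fin_num.
  rewrite ge0_fin_numE ?sing_sq_ge0// (le_lt_trans (sing_sq_mono T (leq0n n)))//.
  rewrite (@lty_poweRy _ _ (p / 2)) ?gt_eqF// (le_lt_trans _ hs)//.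
  rewrite (le_trans _ (nneseries_lim_ge 1%N _))//; last by move=> k _ _; exact: poweR_ge0.
  by rewrite big_nat1.
pose a n := fine (sing_sq T n).
have a0 n : 0 <= a n by rewrite fine_ge0 ?sing_sq_ge0.
have aE n : sing_sq T n = (a n)%:E by rewrite fineK.
have um m n : (m <= n)%N -> (sing_sq T n `^ (p / 2) <= sing_sq T m `^ (p / 2))%E.
  move=> mn; apply: (gt0_ler_poweR (ltW p20)) (sing_sq_mono T mn);
  by rewrite in_itv /= leey andbT; exact: sing_sq_ge0.
have [S S0 HS] := @nonincreasing_summable (fun n => sing_sq T n `^ (p / 2))%E
  (fun n => poweR_ge0 _ _) um hs.
have p2 : 0 < 2 / p by rewrite divr_gt0.
exists (S `^ (2 / p)), (2^-1 `^ (2 / p)); split; first exact: powR_ge0.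
  have E1 : 1 = 1 `^ (2 / p) :> R by rewrite powR1.
  rewrite powR_ge0 /= [X in _ < X]E1.
  by rewrite (gt0_ltr_powR p2) ?nnegrE ?invr_ge0// invf_lt1// ltr1n.
move=> i; have := HS (2 ^ i)%N; rewrite aE poweR_EFin !lee_fin => h.
have {}h : a (2 ^ i)%N `^ (p / 2) <= S * 2^-1 ^+ i.
  apply: le_trans h _; rewrite ler_wpM2l// exprVn -natrX.
  by rewrite lef_pV2 ?posrE ?ltr0n ?expn_gt0// ler_nat.
have -> : a (2 ^ i)%N = (a (2 ^ i)%N `^ (p / 2)) `^ (2 / p).
  rewrite -powRrM (_ : p / 2 * (2 / p) = 1) ?powRr1//.
  by field; rewrite gt_eqF.
have i0 : 0 <= 2^-1 ^+ i :> R by rewrite exprn_ge0// invr_ge0.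
rewrite (le_trans (ge0_ler_powR (ltW p2) _ _ h)) ?nnegrE ?powR_ge0 ?mulr_ge0//.
rewrite powRM// -[_ ^+ i]powR_mulrn ?invr_ge0// -powRrM.
by rewrite -[_ ^+ i]powR_mulrn ?powR_ge0// -powRrM [i%:R * _]mulrC.
Qed.

Lemma schatten_log (p : R) w phi : analytic_selfmap phi -> Hinf w -> nonzero_disk w ->
  0 < p -> schatten p (wcomp w phi) -> log_condition phi.
Proof.
move=> ps [wa [W wW]] wn p0 hs; have wH := H2_bounded wa wW; have [pa p1] := ps.
have [C [q [C0 q01 HC]]] := schatten_decay p0 hs; have /andP[q0 q1] := q01.
have s0 : (sing_sq (wcomp w phi) 0 < +oo)%E.
  rewrite (@lty_poweRy _ _ (p / 2)) ?mulf_neq0 ?gt_eqF ?invr_gt0//.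
  rewrite (le_lt_trans _ hs.2)// (le_trans _ (nneseries_lim_ge 1%N _))//.
    by rewrite big_nat1.
  by move=> k _ _; exact: poweR_ge0.
(* A bound for [||T||^2]: an approximant of rank 0 vanishes on [H2]. Adding 1 gives the strict
   inequality that extracts an approximant from the infimum. *)
pose B := fine (sing_sq (wcomp w phi) 0) + 1.
have [B0 sB] : 0 <= B /\ (sing_sq (wcomp w phi) 0 < B%:E)%E.
  rewrite addr_ge0 ?fine_ge0 ?sing_sq_ge0//; split => //.
  rewrite -[X in (X < _)%E]fineK ?ge0_fin_numE ?sing_sq_ge0//.
  by rewrite lte_fin ltrDl.
have HB f : H2 f -> (h2_nsq f <= 1)%E -> (h2_nsq (wcomp w phi f) <= B%:E)%E.
  have [F [_ [g [_ gF]]] HF] := sing_sq_approx sB; move=> fH f1.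
  apply: le_trans (HF f fH f1).
  rewrite (_ : (fun z => _ - _) = wcomp w phi f)//; apply/funext => z.
  by have [c ->] := gF f fH; rewrite big_ord0 subr0.
pose Q := Num.max q 2^-1.
have Q0 : 0 < Q by rewrite lt_max invr_gt0 ltr0n orbT.
have Q01 : 0 <= Q < 1 by rewrite (ltW Q0) gt_max q1 invf_lt1// ltr1n.
have K0 : 0 <= C + 1 + B by exact: addr_ge0 (addr_ge0 C0 ler01) B0.
apply: (log_condition_of_decay ps wH wn K0 Q01) => i.
(* It is both the slack above the infimum defining the singular number and the ratio [2^i / 4^i] in
   front of [B]; the three contributions [C q^i], [e] and [e B] explain the constant [C + 1 + B]. *)
pose e : R := 2^-1 ^+ i.
have e0 : 0 < e by rewrite exprn_gt0// invr_gt0.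
have le_a : (sing_sq (wcomp w phi) (2 ^ i) < (C * q ^+ i + e)%:E)%E.
  by rewrite (le_lt_trans (HC i))// lte_fin ltrDl.
have [F rF HF] := sing_sq_approx le_a.
have a0 : 0 <= C * q ^+ i + e by rewrite addr_ge0 ?mulr_ge0 ?exprn_ge0// ltW.
have tr := finite_rank_trace (4 ^ i) wa pa rF a0 B0 HB HF.
have {}tr : (\sum_(j < 4 ^ i) h2_nsq (fun z => w z * phi z ^+ (4 ^ i))%R <=
    ((4 ^ i)%:R * (C * q ^+ i + e) + (2 ^ i)%:R * B)%:E)%E.
  apply: le_trans tr; apply: lee_sum => j _; apply: h2_wcomp_mono => //.
  exact: ltnW.
have hfin : h2_nsq (fun z => w z * phi z ^+ (4 ^ i))%R \is a fin_num.
  rewrite ge0_fin_numE ?h2_nsq_ge0// (le_lt_trans (h2_wcomp_mono wa ps (leq0n _)))//.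
  have W0 z : modc z < 1 -> modc (w z * phi z ^+ 0) <= W by move=> z1; rewrite mulr1 wW.
  by apply: le_lt_trans (h2_bounded (analyticM wa (analyticX 0 pa)) W0) _; rewrite ltry.
move: tr; rewrite -(fineK hfin); move: (fine _) => h.
rewrite sumEFin !lee_fin sumr_const card_ord -[h *+ _]mulr_natl => tr.
have p4 : 0 < (4 ^ i)%:R :> R by rewrite ltr0n expn_gt0.
have {}tr : h <= C * q ^+ i + e + e * B.
  rewrite -(ler_pM2l p4) (le_trans tr)// [in leRHS]mulrDr lerD2l mulrA ler_wpM2r//.
  rewrite /e !natrX exprVn -[4](_ : 2 * 2 = _ :> R); last by ring.
  by rewrite exprMn mulfK ?expf_neq0.
apply: (le_trans tr).
have eQ : e <= Q ^+ i by rewrite lerXn2r ?nnegrE ?invr_ge0 ?(ltW Q0)// le_max lexx orbT.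
have qQ : q ^+ i <= Q ^+ i by rewrite lerXn2r ?nnegrE ?(ltW Q0)// le_max lexx.
have h1 : C * q ^+ i <= C * Q ^+ i by rewrite ler_wpM2l.
have h2 : e * B <= Q ^+ i * B by rewrite ler_wpM2r.
by lra.
Qed.

End Necessity.

(** * Construction of the weight from the logarithmic condition *)

Section OuterWeight.
Variable R : realType.
Implicit Types (f g w phi : R[i] -> R[i]) (h : R -> R).
Local Notation mu := (@lebesgue_measure R).
Local Notation D := (`[0%R, 1%R]%classic : set R).

Lemma itg_fine (e : R -> \bar R) :
  @measurable_fun _ _ (measurableTypeR R) _ setT e -> (forall t, (0 <= e t)%E) ->
  (\int[mu]_(t in D) e t < +oo)%E ->
  [/\ mfun (fun t => fine (e t)), itg (fun t => fine (e t)) &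
      {ae mu, forall t, D t -> e t \is a fin_num}].
Proof.
move=> me e0 ie.
have mfe : mfun (fun t => fine (e t)).
  apply: (@measurableT_comp _ _ _ (measurableTypeR R) _ _ fine); last exact: me.
  exact: fine_measurable.
have ei : @integrable _ (measurableTypeR R) _ mu D e.
  apply/integrableP; split; first exact: measurable_funTS.
  by under eq_integral do rewrite gee0_abs//.
split => //; last exact: (@integrable_ae _ (measurableTypeR R) _ mu D (@mD R) e ei).
apply: (le_integrable (@mD R) _ _ ei).
  by apply/measurable_EFinP; exact: measurable_funTS.
move=> t _ /=; rewrite gee0_abs// ger0_norm ?fine_ge0//.
by have := e0 t; case: (e t) => //=.
Qed.

Lemma nneseries_le_partial (u : nat -> R) (M : R) : (forall k, 0 <= u k) ->
  (forall n, \sum_(k < n) u k <= M) -> (\sum_(0 <= k <oo) (u k)%:E <= M%:E)%E.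
Proof.
move=> u0 uM; apply: lime_le; first by apply: is_cvg_nneseries => k _ _; rewrite lee_fin.
by apply: nearW => n /=; rewrite big_mkord sumEFin lee_fin.
Qed.

Lemma truncation_small h : mfun h -> (forall t, 0 <= h t) -> itg h ->
  forall e, 0 < e -> exists x : R, II (fun t => Num.max 0 (h t - x)) <= e.
Proof.
move=> mh h0 ih e e0.
pose f n t := Num.max 0 (h t - n%:R).
have mf n : mfun (f n).
  apply: measurable_maxr; first exact: measurable_cst.
  by apply: measurable_funB; [exact: mh|exact: measurable_cst].
have [_ C] : itg (fun=> 0 : R) /\ II (f n) @[n --> \oo] --> II (fun=> 0 : R).
  apply: (@II_dct _ f (fun=> 0) h mf) => //; first exact: measurable_cst.
    move=> n t; rewrite ger0_norm ?le_max ?lexx// ge_max h0/=.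
    by rewrite lerBlDr lerDl.
  apply: aeW => t _; apply/cvgrPdist_le => d d0; exists (Num.truncn (h t)).+1 => // n /= hn.
  rewrite /f max_l ?subrr ?normr0 ?(ltW d0)// subr_le0.
  apply: ltW; apply: lt_le_trans (_ : (Num.truncn (h t)).+1%:R <= _); last by rewrite ler_nat.
  exact: truncnS_gt.
move/cvgrPdist_le : C => /(_ _ e0)[N _ /(_ N (leqnn _))] /=.
rewrite II_cst sub0r normrN => H; exists N%:R.
by apply: le_trans (ler_norm _) H.
Qed.

(* de la Vallee-Poussin: g = \sum_N (h - x N)^+ with x N so large that the N-th
   term has integral at most 2^-N. *)
Lemma superlinear_majorant h : mfun h -> (forall t, 0 <= h t) -> itg h ->
  exists g : R -> R, [/\ itg g, forall t, 0 <= g t & forall m : nat, exists X : R,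
    {ae mu, forall t, D t -> m%:R * h t - X <= g t}].
Proof.
move=> mh h0 ih.
have p N : 0 < 2^-1 ^+ N :> R by rewrite exprn_gt0// invr_gt0.
have [x xP] := choice (fun N => truncation_small mh h0 ih (p N)).
pose k N t := Num.max 0 (h t - x N).
have k0 N t : 0 <= k N t by rewrite le_max lexx.
have mk N : mfun (k N).
  apply: measurable_maxr; first exact: measurable_cst.
  by apply: measurable_funB; [exact: mh|exact: measurable_cst].
have ik N : itg (k N).
  apply: (@itg_le _ _ (fun t => h t + `|x N|) (mk N)).
    by apply: itgD => //; exact: itg_cst.
  move=> t; rewrite ger0_norm// ge_max addr_ge0//= lerD2l.
  by rewrite -normrN ler_norm.
pose e t := (\sum_(0 <= N <oo) (k N t)%:E)%E.
have me : @measurable_fun _ _ (measurableTypeR R) _ setT e.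
  apply: ge0_emeasurable_sum => [N t _ _|N _]; first by rewrite lee_fin.
  by apply/measurable_EFinP; exact: mk.
have e0 t : (0 <= e t)%E by apply: nneseries_ge0 => N _ _; rewrite lee_fin.
have ie : (\int[mu]_(t in D) e t < +oo)%E.
  rewrite (@integral_nneseries _ (measurableTypeR R) _ mu D (@mD R)); last 2 first.
  - by move=> N; apply/measurable_EFinP; exact: (measurable_funTS (mk N)).
  - by move=> N t _; rewrite lee_fin.
  under eq_eseriesr => N _ do rewrite -(EFin_II (ik N)).
  apply: (@le_lt_trans _ _ 2%:E); last by rewrite ltry.
  apply: nneseries_le_partial => [N|n]; first exact: II_ge0.
  apply: (@le_trans _ _ (\sum_(0 <= N < n) 2^-1 ^+ N)).
    by rewrite big_mkord; apply: ler_sum => N _; exact: xP.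
  have q01 : (0 <= 2^-1 :> R) && (2^-1 < 1 :> R) by rewrite invr_ge0 ler0n invf_lt1// ltr1n.
  apply: le_trans (geo_le 0 n q01) _; rewrite expr0 div1r.
  by rewrite (_ : 1 - 2^-1 = 2^-1 :> R) ?invrK//; field.
have [_ ig ae_fin] := itg_fine me e0 ie.
exists (fun t => fine (e t)); split => // [t|m]; first exact: fine_ge0.
(* The first [m] terms alone give [m h - \sum_(N < m) x N]. *)
exists (\sum_(N < m) x N); apply: ae_imp ae_fin => t et Dt; have {}et := et Dt.
apply: (@le_trans _ _ (\sum_(N < m) k N t)).
  rewrite mulr_natl -[m in h t *+ m]card_ord -sumr_const -sumrB; apply: ler_sum => N _.
  by rewrite le_max lexx orbT.
rewrite -lee_fin fineK// -sumEFin -(big_mkord xpredT (fun N => (k N t)%:E)).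
by apply: nneseries_lim_ge => N _ _; rewrite lee_fin.
Qed.

(** The convex function [- ln (1 - x)] lies above its tangent at [y]. *)
Lemma ln_tangent (x y : R) : x < 1 -> y < 1 ->
  - ln (1 - y) + (x - y) / (1 - y) <= - ln (1 - x).
Proof.
move=> x1 y1; have px : 0 < 1 - x by rewrite subr_gt0.
have py : 0 < 1 - y by rewrite subr_gt0.
have c : -1 < (1 - x) / (1 - y) - 1 by rewrite ltrDr divr_gt0.
have := le_ln1Dx c; rewrite addrC subrK ln_div ?posrE//.
have -> : (1 - x) / (1 - y) - 1 = - ((x - y) / (1 - y)).
  by field; rewrite gt_eqF.
by lra.
Qed.

(* The weight is the outer function exp (- herglotz g) for a superlinear
   majorant g of h = - log (1 - |phi^*|); Jensen's inequality for the Poisson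
   kernel compares h with - log (1 - |phi|) inside the disk. *)
Lemma log_weight phi : analytic_selfmap phi -> log_condition phi ->
  exists w, [/\ analytic_disk w, nonzero_disk w & forall m, exists2 C : R, 0 <= C &
    forall z, modc z < 1 -> modc (w z) <= C * (1 - modc (phi z)) ^+ m].
Proof.
move=> ps lc; have [pa p1] := ps; have [b [mb bB bl bP]] := boundary_function ps.
have {}lc := (log_conditionP mb bl).1 lc.
pose e t := log_inv_1m (modc (b t)).
have e0 t : (0 <= e t)%E by apply: log_inv_1m_ge0; exact: modc_ge0.
have [mh ih fin] := itg_fine (measurable_log_inv mb) e0 lc.
set h := fun t => fine (log_inv_1m (modc (b t))) in mh ih.
have h0 t : 0 <= h t by exact: fine_ge0 (e0 t).
have [g [ig g0 gP]] := superlinear_majorant mh h0 ih.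
have imb : itg (fun t => modc (b t)).
  apply: (@itg_bd _ _ 2); first exact: mfun_modc.
  by move=> t; rewrite ger0_norm ?modc_ge0.
(* The tangent at [y = |phi z|] is integrated against the Poisson kernel, a probability density; its
   linear part contributes a nonnegative amount since [y] is at most the Poisson integral of
   [|b|]. *)
have key z : modc z < 1 -> - ln (1 - modc (phi z)) <= II (fun t => pois z t * h t).
  move=> z1; set y := modc (phi z); have y1 : y < 1 := p1 _ z1.
  have py : 0 < 1 - y by rewrite subr_gt0.
  pose c := - ln (1 - y) - y / (1 - y).
  have i1 : itg (fun t => c * pois z t) by apply: itgZ; exact: itg_pois.
  have i2 : itg (fun t => (1 - y)^-1 * (pois z t * modc (b t))).
    by apply: itgZ; exact: itg_poisM.
  have yb : y <= II (fun t => pois z t * modc (b t)).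
    rewrite /y -[phi z]expr1 (bP 1%N z z1); apply: modc_cI_le.
    - by apply: (citg_pois z1 _ bB); exact: mb.
    - exact: itg_poisM.
    - by move=> t; rewrite expr1 modcM modc_real pois_normE.
  have I : II (fun t => c * pois z t + (1 - y)^-1 * (pois z t * modc (b t))) <=
           II (fun t => pois z t * h t).
    apply: II_ae_le; [exact: itgD|exact: itg_poisM|].
    (* Finiteness excludes [|b t| >= 1], where [h] has the default value 0 instead of [+oo]. *)
    apply: ae_imp fin => t ft Dt; have := ft Dt; rewrite /h /log_inv_1m.
    case: ifPn => //= b1 _; rewrite lnV ?posrE ?subr_gt0//.
    have pz := pois_gt0 t z1.
    have -> : c * pois z t + (1 - y)^-1 * (pois z t * modc (b t)) =
       pois z t * (- ln (1 - y) + (modc (b t) - y) / (1 - y)).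
      by rewrite /c; field; rewrite gt_eqF.
    by rewrite ler_wpM2l ?(ltW pz)// ln_tangent.
  apply: le_trans I; rewrite IID// !IIZ//; [|exact: itg_poisM|exact: itg_pois].
  rewrite II_pois// mulr1 /c -addrA lerDl addrC subr_ge0 mulrC.
  by rewrite ler_wpM2l// invr_ge0 ltW.
pose w z := cexp ((-1)%:C * herglotz g z).
have wE z : modc (w z) = expR (- II (fun t => pois z t * g t)).
  by rewrite modc_cexp ReMr Re_herglotz mulN1r.
exists w; split.
- by apply: analytic_cexp; apply: analyticZ; exact: analytic_herglotz.
- by exists 0; split; [rewrite modc0|exact: cexp_neq0].
move=> m; have [X HX] := gP m; exists (expR X) => [|z z1]; first exact: expR_ge0.
have py : 0 < 1 - modc (phi z) by rewrite subr_gt0 p1.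
rewrite wE -[_ ^+ m](lnK (_ : _ \in Num.pos)) ?posrE ?exprn_gt0// -expRD ler_expR lnXn//.
have I : II (fun t => m%:R * (pois z t * h t) - X * pois z t) <= II (fun t => pois z t * g t).
  apply: II_ae_le.
  - by apply: itgB; apply: itgZ; [exact: itg_poisM|exact: itg_pois].
  - exact: itg_poisM.
  apply: ae_imp HX => t Ht Dt.
  have -> : m%:R * (pois z t * h t) - X * pois z t = pois z t * (m%:R * h t - X) by ring.
  by rewrite ler_wpM2l ?(ltW (pois_gt0 t z1))// Ht.
move: I; rewrite IIB ?IIZ ?II_pois//; try by [exact: itg_poisM|exact: itg_pois|
   apply: itgZ; exact: itg_poisM|apply: itgZ; exact: itg_pois].
have m0 : 0 <= m%:R :> R by [].
have := ler_wpM2l m0 (key z z1); rewrite mulr1 -[ln _ *+ m]mulr_natl mulrN.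
lra.
Qed.

End OuterWeight.

(** * Singular numbers of the weighted operator *)

Section Sufficiency.
Variable R : realType.
Implicit Types (f g w phi : R[i] -> R[i]) (x y : R).

(** Each of the [n + 1] terms of [\sum_(i <= n) y^i] is at least [y^n], and [1 - y] times this sum
    is [1 - y^(n+1)]. *)
Lemma pow_1m_le y n : 0 <= y <= 1 -> (1 - y) * y ^+ n <= n.+1%:R^-1.
Proof.
move=> /andP[y0 y1]; rewrite -div1r ler_pdivlMr//.
have G := geo_sum y (leq0n n.+1); rewrite expr0 in G.
apply: (@le_trans _ _ (1 - y ^+ n.+1)); last by rewrite lerBlDr lerDl exprn_ge0.
rewrite -G -mulrA ler_wpM2l ?subr_ge0// big_mkord mulr_natr -[n.+1 in leLHS]card_ord.
rewrite -sumr_const; apply: ler_sum => i _.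
by rewrite ler_wiXn2l// -ltnS.
Qed.

(** One factor [1 - y] is paired with each of [k] blocks of [n %/ k] factors [y], and [pow_1m_le] is
    applied to each pair. *)
Lemma pow_1mX_le y k n : 0 <= y <= 1 -> (0 < k)%N ->
  (1 - y) ^+ k * y ^+ n <= (k%:R / n.+1%:R) ^+ k.
Proof.
move=> y01 k0; have /andP[y0 y1] := y01; have y1' : 0 <= 1 - y by rewrite subr_ge0.
pose l := (n %/ k)%N.
apply: (@le_trans _ _ (((1 - y) * y ^+ l) ^+ k)).
  by rewrite exprMn ler_wpM2l ?exprn_ge0// -exprM ler_wiXn2l// leq_divM.
rewrite lerXn2r ?nnegrE ?mulr_ge0 ?exprn_ge0 ?invr_ge0//.
apply: le_trans (pow_1m_le l y01) _.
rewrite -[leLHS]div1r ler_pdivrMr// mulrAC ler_pdivlMr// mul1r -natrM ler_nat.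
by rewrite mulnC ltn_ceil.
Qed.

(** By induction with the sharper bound [2 - 1 / n] for [n] terms, as
    [1 / (n + 1)^2 <= 1 / n - 1 / (n + 1)]. *)
Lemma sum_inv_sqr n : \sum_(k < n) (k.+1%:R^-1) ^+ 2 <= 2 :> R.
Proof.
case: n => [|n]; first by rewrite big_ord0.
suff : \sum_(k < n.+1) (k.+1%:R^-1) ^+ 2 <= 2 - n.+1%:R^-1 :> R.
  by move=> h; rewrite (le_trans h)// lerBlDr lerDl invr_ge0.
elim: n => [|n IH]; first by rewrite big_ord1 invr1 expr1n; lra.
rewrite big_ord_recr /= (le_trans (lerD IH (lexx _)))//.
have e : n.+1%:R^-1 - n.+2%:R^-1 = n.+1%:R^-1 * n.+2%:R^-1 :> R.
  have a0 : n.+1%:R != 0 :> R by rewrite pnatr_eq0.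
  have : n.+1%:R + 1 != 0 :> R by rewrite natr1 pnatr_eq0.
  rewrite -[n.+2%:R]natr1; move: (n.+1%:R) a0 => a a0 a1.
  by field; rewrite ?a0 ?a1.
have : n.+2%:R^-1 ^+ 2 <= n.+1%:R^-1 * n.+2%:R^-1 :> R.
  by rewrite expr2 ler_wpM2r ?invr_ge0// lef_pV2 ?posrE// ler_nat.
by rewrite -e; move: (n.+1%:R^-1) (n.+2%:R^-1) => a c; lra.
Qed.

Section Weighted.
Variables w phi : R[i] -> R[i].
Hypotheses (wa : analytic_disk w) (ps : analytic_selfmap phi).
Hypothesis wC : forall m, exists2 C : R, 0 <= C &
  forall z, modc z < 1 -> modc (w z) <= C * (1 - modc (phi z)) ^+ m.

(** The weight supplies [(1 - |phi|)^(k+1)]. After squaring, one of the two extra factors cancels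
    the denominator of [H2_tail]; the [k]-th power, against [|phi|^n], gives [n^-k]. *)
Lemma weighted_tail k : exists2 K : R, 0 <= K & forall f n z, H2 f -> modc z < 1 ->
  modc (w z * (f (phi z) - \sum_(j < n) taylor_coef f j * phi z ^+ j)) ^+ 2 <=
  fine (h2_nsq f) * (K * (n.+1%:R^-1 ^+ k) ^+ 2).
Proof.
have [C C0 HC] := wC k.+1.
exists (C ^+ 2 * (k%:R ^+ k) ^+ 2) => [|f n z fH z1]; first exact: mulr_ge0 (sqr_ge0 _) (sqr_ge0 _).
have y0 := modc_ge0 (phi z); have y1 := ps.2 _ z1.
have T := H2_tail n fH y1; have W := HC _ z1.
set y := modc (phi z) in y0 y1 T W.
have N0 : 0 <= fine (h2_nsq f) by rewrite fine_ge0 ?h2_nsq_ge0.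
have d0 : 0 < 1 - y by rewrite subr_gt0.
have y2 : 1 - y <= 1 - y ^+ 2 by rewrite lerD2l lerN2 expr2 ler_piMl// ltW.
rewrite modcM exprMn.
apply: (@le_trans _ _ ((C * (1 - y) ^+ k.+1) ^+ 2 *
    (fine (h2_nsq f) * (y ^+ 2) ^+ n / (1 - y)))).
  apply: ler_pM; [exact: sqr_ge0|exact: sqr_ge0| |].
    by rewrite lerXn2r ?nnegrE ?modc_ge0 ?(mulr_ge0 C0 (exprn_ge0 _ (ltW d0))).
  apply: le_trans T _; apply: ler_wpM2l.
    exact: mulr_ge0 N0 (exprn_ge0 _ (sqr_ge0 _)).
  by rewrite lef_pV2 ?posrE// (lt_le_trans d0).
have P : ((1 - y) ^+ k * y ^+ n) ^+ 2 <= (k%:R ^+ k * n.+1%:R^-1 ^+ k) ^+ 2.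
  (* [pow_1mX_le] requires a positive exponent; for [k = 0] both sides compare with 1. *)
  case: k => [|k'] in C C0 HC W *.
    rewrite !expr0 !mul1r expr1n exprn_ile1 ?exprn_ge0//.
    by rewrite exprn_ile1// ltW.
  rewrite -exprMn lerXn2r ?nnegrE ?mulr_ge0 ?exprn_ge0 ?mulr_ge0 ?invr_ge0 ?(ltW d0)//.
  by apply: pow_1mX_le => //; rewrite y0 ltW.
rewrite [X in X <= _](_ : _ = fine (h2_nsq f) * (C ^+ 2 * ((1 - y) * ((1 - y) ^+ k * y ^+ n) ^+ 2))).
  apply: ler_wpM2l => //; rewrite -mulrA -exprMn; apply: ler_wpM2l; first exact: sqr_ge0.
  apply: le_trans P; rewrite ler_piMl ?sqr_ge0// lerBlDr lerDl//.
rewrite [(1 - y) ^+ k.+1]exprS [(y ^+ 2) ^+ n]exprAC.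
move: ((1 - y) ^+ k) (y ^+ n) => A B.
by field; rewrite gt_eqF.
Qed.

(** The tail estimate with [k = 0] and [n = 0] bounds [w * (f o phi)] uniformly: the image even lies
    in [Hinf]. *)
Lemma weighted_maps_H2 : maps_H2 (wcomp w phi).
Proof.
move=> f fH; have [fa _] := fH; have [K K0 HK] := weighted_tail 0.
have Ta : analytic_disk (wcomp w phi f).
  apply: (analyticM wa); apply: (analytic_comp fa ps.1) => r r1.
  exact: (selfmap_compact ps r1).
apply: (H2_bounded (M := Num.sqrt (fine (h2_nsq f) * K)) Ta) => z z1.
rewrite -[leLHS]ger0_norm ?modc_ge0// -sqrtr_sqr ler_wsqrtr//.
by have := HK f 0%N z fH z1; rewrite big_ord0 subr0 expr0 expr1n mulr1.
Qed.

(** The operator applied to the Taylor polynomial of [f]; uniqueness of the coefficients makes it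
    linear on [H2]. *)
Definition taylor_trunc n : op R :=
  fun f z => \sum_(j < n) taylor_coef f j * (w z * phi z ^+ j).

Lemma weighted_pow n : H2 (fun z => w z * phi z ^+ n).
Proof.
have [C C0 HC] := wC 0; apply: (@H2_bounded _ _ C); first exact: (analyticM wa (analyticX n ps.1)).
move=> z z1; rewrite modcM modcX -[leRHS]mulr1; apply: ler_pM.
- exact: modc_ge0.
- by rewrite exprn_ge0// modc_ge0.
- by have := HC _ z1; rewrite expr0 mulr1.
- by rewrite exprn_ile1 ?modc_ge0// ltW// ps.2.
Qed.

Lemma taylor_trunc_rank n : finite_rank_le n (taylor_trunc n).
Proof.
split=> [f g c [fa _] [ga _]|].
  have E := taylor_coefP (@has_taylorZD _ _ _ _ _ c (analytic_taylor fa) (analytic_taylor ga)).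
  apply/funext => z; rewrite /taylor_trunc E mulr_sumr -big_split /=.
  by apply: eq_bigr => j _; rewrite mulrDl; congr (_ + _); apply/esym; exact: mulrA.
exists (fun (j : 'I_n) z => w z * phi z ^+ j); split => [j|f _]; first exact: weighted_pow.
by exists (fun j : 'I_n => taylor_coef f j).
Qed.

(** The tail estimate is a uniform bound on the disk, which dominates the norm of [H2]. *)
Lemma weighted_sing_sq k : exists2 K : R, 0 <= K & forall n,
  (sing_sq (wcomp w phi) n <= (K * (n.+1%:R^-1 ^+ k) ^+ 2)%:E)%E.
Proof.
have [K K0 HK] := weighted_tail k; exists K => // n.
apply: ge_ereal_inf; exists (opnorm_sq (fun f z => wcomp w phi f z - taylor_trunc n f z)).
  by exists (taylor_trunc n) => //; exact: taylor_trunc_rank.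
apply: ge_ereal_sup => _ [f [fH f1] <-]; have [fa ff] := fH.
set M := K * _; have M0 : 0 <= M by exact: mulr_ge0 K0 (sqr_ge0 _).
rewrite -[M](sqr_sqrtr M0); apply: h2_bounded.
  have := analyticD (weighted_maps_H2 fH).1 (analyticZ (-1) (analytic_sum (index_enum _)
    (fun j : 'I_n => analyticZ (taylor_coef f j) (weighted_pow j).1))).
  by apply: eq_analytic => z _; rewrite mulN1r.
move=> z z1; rewrite -[leLHS]ger0_norm ?modc_ge0// -sqrtr_sqr ler_wsqrtr//.
have -> : wcomp w phi f z - taylor_trunc n f z =
    w z * (f (phi z) - \sum_(j < n) taylor_coef f j * phi z ^+ j).
  rewrite mulrBr mulr_sumr; congr (_ - _); apply: eq_bigr => j _; exact: mulrCA.
apply: le_trans (HK f n z fH z1) _; rewrite -/M ler_piMl//.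
by rewrite -lee_fin fineK// ge0_fin_numE// h2_nsq_ge0.
Qed.

Lemma weighted_schatten (p : R) : 0 < p -> schatten p (wcomp w phi).
Proof.
move=> p0; split; first exact: weighted_maps_H2.
(* The terms are [O(n^(- k p))], so [k p >= 2] compares them with [1 / n^2]. *)
have [k kp] : exists k : nat, 2 <= k%:R * p.
  exists (Num.truncn (2 / p)).+1; rewrite -ler_pdivrMr//.
  by apply: ltW; exact: truncnS_gt.
have [K K0 HK] := weighted_sing_sq k.
have p2 : 0 <= p / 2 by rewrite divr_ge0 ?(ltW p0).
pose u n := K `^ (p / 2) * n.+1%:R^-1 ^+ 2.
have u0 n : 0 <= u n by exact: mulr_ge0 (powR_ge0 _ _) (sqr_ge0 _).
apply: (@le_lt_trans _ _ (\sum_(0 <= n <oo) (u n)%:E)%E).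
  apply: lee_nneseries => [n _ _|n _]; first exact: poweR_ge0.
  apply: (@le_trans _ _ ((K * (n.+1%:R^-1 ^+ k) ^+ 2)%:E `^ (p / 2))%E).
    apply: (gt0_ler_poweR p2) (HK n); rewrite in_itv /= leey andbT ?sing_sq_ge0//.
    by rewrite lee_fin; exact: mulr_ge0 K0 (sqr_ge0 _).
  rewrite poweR_EFin lee_fin powRM ?sqr_ge0// ler_wpM2l ?powR_ge0//.
  have i0 : 0 <= n.+1%:R^-1 :> R by rewrite invr_ge0.
  rewrite -exprM -powR_mulrn// -powRrM -powR_mulrn//.
  apply: ger_powR; first by rewrite invr_gt0 ltr0Sn invf_le1// ler1n.
  by apply: le_trans kp _; rewrite natrM -mulrA [2 * _]mulrC divfK.
apply: (@le_lt_trans _ _ (K `^ (p / 2) * 2)%:E); last by rewrite ltry.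
apply: nneseries_le_partial => // n; rewrite -mulr_sumr ler_wpM2l ?powR_ge0//.
exact: sum_inv_sqr.
Qed.

Lemma weighted_hilbert_schmidt : hilbert_schmidt (wcomp w phi).
Proof.
split; first exact: weighted_maps_H2.
have [C C0 HC] := wC 1.
pose u n := C ^+ 2 * n.+1%:R^-1 ^+ 2.
have u0 n : 0 <= u n by exact: mulr_ge0 (sqr_ge0 _) (sqr_ge0 _).
apply: (@le_lt_trans _ _ (\sum_(0 <= n <oo) (u n)%:E)%E).
  apply: lee_nneseries => [n _ _|n _]; first exact: h2_nsq_ge0.
  rewrite /u -exprMn; apply: (h2_bounded (weighted_pow n).1) => z z1.
  rewrite modcM modcX.
  apply: (@le_trans _ _ (C * (1 - modc (phi z)) * modc (phi z) ^+ n)).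
    rewrite ler_wpM2r ?exprn_ge0 ?modc_ge0//.
    by have := HC _ z1; rewrite expr1.
  rewrite -mulrA ler_wpM2l//; apply: pow_1m_le; rewrite modc_ge0 ltW//.
  exact: ps.2.
apply: (@le_lt_trans _ _ (C ^+ 2 * 2)%:E); last by rewrite ltry.
apply: nneseries_le_partial => // n; rewrite -mulr_sumr ler_wpM2l ?sqr_ge0//.
exact: sum_inv_sqr.
Qed.

Lemma weight_Hinf : Hinf w.
Proof.
split => //; have [C _ HC] := wC 0; exists C => z /HC; rewrite expr0 mulr1; exact.
Qed.

End Weighted.
End Sufficiency.

Theorem theorem4p6 (R : realType) (phi : R[i] -> R[i]) :
  analytic_selfmap phi ->
  [<-> exists w : R[i] -> R[i],
         H2 w /\ nonzero_disk w /\ hilbert_schmidt (wcomp w phi);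
       exists w : R[i] -> R[i],
         Hinf w /\ nonzero_disk w /\
         (forall p : R, 0 < p -> schatten p (wcomp w phi));
       exists (p : R) (w : R[i] -> R[i]),
         0 < p /\ Hinf w /\ nonzero_disk w /\ schatten p (wcomp w phi);
       log_condition phi].
Proof.
move=> ps; tfae.
(* The given weight serves only to obtain the logarithmic condition, from which a new bounded weight
   is built. *)
- move=> [w [wH [wn hs]]].
  have [v [va vn vC]] := log_weight ps (hilbert_schmidt_log ps wH wn hs).
  exists v; split; first exact: (weight_Hinf va vC).
  by split; [exact: vn|move=> p p0; exact: (weighted_schatten va ps vC p0)].
- move=> [w [wH [wn hs]]]; exists 1, w; split; first exact: ltr01.
  by split; [exact: wH|split; [exact: wn|exact: hs ltr01]].
- by move=> [p [w [p0 [wH [wn hs]]]]]; exact: (schatten_log ps wH wn p0 hs).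
- move=> lc; have [v [va vn vC]] := log_weight ps lc; exists v.
  have [_ [M HM]] := weight_Hinf va vC.
  split; first exact: (H2_bounded va HM).
  by split; [exact: vn|exact: (weighted_hilbert_schmidt va ps vC)].
Qed.
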